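(* For every $r$ with $0<r<1$, $$V_r=\left\{\frac{1+s}{(1+t)^3}: s,t\in\mathbb C,\ |s|\le r,\ |t|\le r\right\}=\left\{\frac{u}{v^3}: u,v\in\mathbb C,\ |u-1|\le r,\ |v-1|\le r\right\}.$$ Moreover, $LV_{1^-}=\{w\in\mathbb C: |\operatorname{Im} w|<2\pi\}$ and $V_{1^-}=\mathbb C\setminus\{0\}$.
   Context: $\mathbb D=\{z\in\mathbb C:|z|<1\}$. An analytic function $g$ on $\mathbb D$ with $g(0)=g'(0)-1=0$ is called convex if it is univalent and $g(\mathbb D)$ is a convex set. $\mathcal C$ denotes the class of close-to-convex functions, that is, analytic functions $f$ on $\mathbb D$ with $f(0)=f'(0)-1=0$ such that $\operatorname{Re}[e^{i\lambda}f'(z)/g'(z)]>0$ for all $z\in\mathbb D$, for some convex function $g$ (normalized by $g(0)=g'(0)-1=0$) and some real constant $\lambda$ with $|\lambda|<\pi/2$. For $f\in\mathcal C$, $f'$ is non-vanishing on $\mathbb D$ and $\log f'$ denotes the continuous branch on $\mathbb D$ with $\log f'(0)=0$. For $z\in\mathbb D$, $V_z=\{f'(z): f\in\mathcal C\}$ and $LV_z=\{\log f'(z): f\in\mathcal C\}$; $V_{1^-}=\bigcup_{0\le r<1}V_r$ and $LV_{1^-}=\bigcup_{0\le r<1}LV_r$. *)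

(* Defs.v *)
From Stdlib Require Import Reals.
From Coquelicot Require Import Coquelicot.

Open Scope R_scope.

Definition Cexp (z : C) : C :=
  (exp (Re z) * cos (Im z), exp (Re z) * sin (Im z)).

Definition unit_disc (z : C) : Prop := Cmod z < 1.

(* Functions on the disc are total functions [C -> C]; since the disc is open,
   differentiability, derivatives and continuity at its points do not depend on
   the values taken outside.  [ex_derive] is complex differentiability here. *)
Definition analytic_on_disc (f : C -> C) : Prop :=
  forall z : C, unit_disc z -> ex_derive f z.

(* [C_derive] is a total operator, equal to the complex derivative wherever the
   latter exists ([C_derive_correct]). *)
Definition normalized (f : C -> C) : Prop :=
  f 0 = RtoC 0 /\ C_derive f 0 = RtoC 1.

Definition injective_on_disc (f : C -> C) : Prop :=
  forall z1 z2 : C,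
    unit_disc z1 -> unit_disc z2 -> f z1 = f z2 -> z1 = z2.

Definition disc_image (f : C -> C) (w : C) : Prop :=
  exists z : C, unit_disc z /\ w = f z.

Definition convex_set (A : C -> Prop) : Prop :=
  forall (a b : C) (t : R),
    A a -> A b -> 0 <= t <= 1 -> A ((1 - t)%R * a + t * b)%C.

Definition convex_function (g : C -> C) : Prop :=
  analytic_on_disc g /\ normalized g /\
  injective_on_disc g /\ convex_set (disc_image g).

Definition close_to_convex (f : C -> C) : Prop :=
  analytic_on_disc f /\ normalized f /\
  exists (g : C -> C) (lambda : R),
    convex_function g /\ Rabs lambda < PI / 2 /\
    forall z : C, unit_disc z ->
      0 < Re (Cexp (Ci * lambda) * (C_derive f z / C_derive g z))%C.

(* [L] is the continuous branch of [log f'] on the disc with [L 0 = 0]; such an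
   [L] is unique on the disc. *)
Definition is_log_derive (f L : C -> C) : Prop :=
  (forall z : C, unit_disc z -> continuous L z /\ Cexp (L z) = C_derive f z) /\
  L 0 = RtoC 0.

(* Sets of complex numbers are predicates: [V z w] means that [w] is in V_z. *)
Definition V (z w : C) : Prop :=
  exists f : C -> C, close_to_convex f /\ w = C_derive f z.

Definition LV (z w : C) : Prop :=
  exists f L : C -> C,
    close_to_convex f /\ is_log_derive f L /\ w = L z.

Definition V_1minus (w : C) : Prop := exists r : R, 0 <= r < 1 /\ V r w.

Definition LV_1minus (w : C) : Prop := exists r : R, 0 <= r < 1 /\ LV r w.

(* Main.v *)
Require Import Defs.
From Stdlib Require Import Reals Ranalysis5 Lra Lia.
From Stdlib Require Import Classical ClassicalEpsilon FunctionalExtensionality.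
From Coquelicot Require Import Coquelicot.
Open Scope R_scope.

(** For convex [g] and [|x| <= 1], [(1 - tau) g(z) + tau g(xz)] is subordinate to [g];
    letting [tau -> 0], Schwarz's lemma gives [Re ((g(z) - g(xz)) / (z g'(z))) >= 0].
    This function of [x] vanishes at [x = 1] with derivative [-1], so Julia's boundary lemma
    bounds its value at [x = 0] and yields [g(z) / (z g'(z)) = 1 + a] with [|a| <= |z|].
    The same bound for [g] composed with the disc automorphism sending [0] to [z], taken at
    [-z], reads [z / g(z) = 1 + b] with [|b| <= |z|]; hence [g'(z) = 1 / ((1 + a)(1 + b))].
    Since [f' / g'] maps into a rotated half-plane, it equals [(1 + s) / (1 + t)] with
    [|s|, |t| <= |z|].  Finally [(1 + t)(1 + a)(1 + b)] is a cube [(1 + t')^3], because the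
    image of [|u - 1| <= r] under the logarithm is convex, and every factor has argument less
    than [PI / 2], so that [|Im (log f')| < 2 PI].  Conversely the functions with
    [f'(z) = (1 + xz) / (1 + yz)^3], [|x|, |y| <= 1], are close-to-convex with respect to
    [z / (1 + yz)].

    The Cauchy theory needed for this starts from bare complex differentiability: Goursat's
    bisection, applied to a homotopy between two circles, gives Cauchy's formula. *)

(** * Continuity and derivatives in the complex plane *)

(* [ring] and [field] fail on equations stated in the carrier of a Coquelicot structure. *)
Ltac as_C_eq := match goal with |- @eq _ ?a ?b => change (@eq C a b) end.

(** Two estimates are needed because [g'(z)] is not controlled directly: one compares [g(z)] with
    [z g'(z)], the other [g(z)] with [z], and [g(z)] drops out when they are multiplied. That [g']
    has no zero is drawn from the strict positivity of [Re (e^(i lambda) f' / g')]. The three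
    factors of the denominator are merged into a cube only at a single point, by averaging their
    logarithms, with no claim that the resulting [t'] is analytic in [z]. For [log f'] the four
    factors therefore stay separate: each is analytic and lies in the right half-plane, so the sum
    of their principal logarithms is continuous along [[0, r]] and must be the given branch there.
    The same count of four arguments, shared equally, shows that the whole strip is attained. The
    set [V_1minus] then comes from the strip by exponentiating, since every nonzero number has a
    logarithm in it. *)

Lemma continuous_C_pair {U : UniformSpace} (f : U -> C) (x : U) :
  continuous (fun y => fst (f y)) x -> continuous (fun y => snd (f y)) x ->
  continuous f x.
Proof.
  intros H1 H2 P [eps HP].
  specialize (H1 (ball (fst (f x)) eps) (locally_ball _ eps)).
  specialize (H2 (ball (snd (f x)) eps) (locally_ball _ eps)).
  unfold filtermap in *.
  generalize (filter_and _ _ H1 H2).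
  apply filter_imp. intros y [A B]. apply HP. split; assumption.
Qed.

Lemma continuous_C_fst {U : UniformSpace} (f : U -> C) (x : U) :
  continuous f x -> continuous (fun y => fst (f y)) x.
Proof. intros H. apply (continuous_comp f fst); [exact H | apply continuous_fst]. Qed.

Lemma continuous_C_snd {U : UniformSpace} (f : U -> C) (x : U) :
  continuous f x -> continuous (fun y => snd (f y)) x.
Proof. intros H. apply (continuous_comp f snd); [exact H | apply continuous_snd]. Qed.

Lemma continuous_Cplus {U : UniformSpace} (f g : U -> C) (x : U) :
  continuous f x -> continuous g x -> continuous (fun y => f y + g y)%C x.
Proof.
  intros Hf Hg. apply continuous_C_pair; simpl.
  - apply (continuous_plus (K := R_AbsRing) (V := R_NormedModule));
      apply continuous_C_fst; assumption.
  - apply (continuous_plus (K := R_AbsRing) (V := R_NormedModule));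
      apply continuous_C_snd; assumption.
Qed.

Lemma continuous_Copp {U : UniformSpace} (f : U -> C) (x : U) :
  continuous f x -> continuous (fun y => - f y)%C x.
Proof.
  intros Hf. apply continuous_C_pair; simpl;
    apply (continuous_opp (K := R_AbsRing) (V := R_NormedModule)).
  - apply continuous_C_fst; assumption.
  - apply continuous_C_snd; assumption.
Qed.

Lemma continuous_Cminus {U : UniformSpace} (f g : U -> C) (x : U) :
  continuous f x -> continuous g x -> continuous (fun y => f y - g y)%C x.
Proof.
  intros Hf Hg. apply continuous_Cplus; [|apply continuous_Copp]; assumption.
Qed.

Lemma continuous_Rmult {U : UniformSpace} (f g : U -> R) (x : U) :
  continuous f x -> continuous g x -> continuous (fun y => f y * g y) x.
Proof. apply (continuous_mult (K := R_AbsRing)). Qed.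

Lemma continuous_Rplus {U : UniformSpace} (f g : U -> R) (x : U) :
  continuous f x -> continuous g x -> continuous (fun y => f y + g y) x.
Proof. apply (continuous_plus (K := R_AbsRing) (V := R_NormedModule)). Qed.

Lemma continuous_Cmult {U : UniformSpace} (f g : U -> C) (x : U) :
  continuous f x -> continuous g x -> continuous (fun y => f y * g y)%C x.
Proof.
  intros Hf Hg.
  pose proof (continuous_C_fst _ _ Hf). pose proof (continuous_C_snd _ _ Hf).
  pose proof (continuous_C_fst _ _ Hg). pose proof (continuous_C_snd _ _ Hg).
  apply continuous_C_pair; simpl.
  - apply (continuous_minus (K := R_AbsRing) (V := R_NormedModule));
      apply continuous_Rmult; assumption.
  - apply continuous_Rplus; apply continuous_Rmult; assumption.
Qed.

Lemma C_norm2_pos (z : C) : z <> 0 -> 0 < fst z ^ 2 + snd z ^ 2.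
Proof.
  destruct z as [a b]; simpl; intros H.
  destruct (Req_dec a 0) as [->|Ha]; [destruct (Req_dec b 0) as [->|Hb]|].
  - exfalso; apply H; reflexivity.
  - nra.
  - nra.
Qed.

Lemma continuous_Cinv {U : UniformSpace} (f : U -> C) (x : U) :
  continuous f x -> f x <> 0 -> continuous (fun y => / f y)%C x.
Proof.
  intros Hf Hx.
  pose proof (continuous_C_fst _ _ Hf) as H1. pose proof (continuous_C_snd _ _ Hf) as H2.
  pose proof (C_norm2_pos _ Hx) as Hp.
  assert (H3 : continuous (fun y => / (fst (f y) ^ 2 + snd (f y) ^ 2)) x).
  { apply (continuous_comp (fun y => fst (f y) ^ 2 + snd (f y) ^ 2) Rinv).
    - apply continuous_Rplus; simpl;
        repeat apply continuous_Rmult; try assumption; apply continuous_const.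
    - apply continuous_Rinv. lra. }
  apply continuous_C_pair; simpl; apply continuous_Rmult; try assumption.
  apply (continuous_opp (K := R_AbsRing) (V := R_NormedModule)); assumption.
Qed.

Lemma continuous_Cdiv {U : UniformSpace} (f g : U -> C) (x : U) :
  continuous f x -> continuous g x -> g x <> 0 ->
  continuous (fun y => f y / g y)%C x.
Proof.
  intros Hf Hg Hx. apply continuous_Cmult; [|apply continuous_Cinv]; assumption.
Qed.

Lemma continuous_RtoC {U : UniformSpace} (f : U -> R) (x : U) :
  continuous f x -> continuous (fun y => RtoC (f y)) x.
Proof.
  intros H. apply continuous_C_pair; simpl; [exact H | apply continuous_const].
Qed.

Lemma continuous_Cmod {U : UniformSpace} (f : U -> C) (x : U) :
  continuous f x -> continuous (fun y => Cmod (f y)) x.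
Proof.
  intros Hf.
  pose proof (continuous_C_fst _ _ Hf). pose proof (continuous_C_snd _ _ Hf).
  unfold Cmod. apply (continuous_comp _ sqrt).
  - apply continuous_Rplus; simpl;
      repeat apply continuous_Rmult; try assumption; apply continuous_const.
  - apply continuous_sqrt.
Qed.

Lemma continuous_C_locally {U : UniformSpace} (f : U -> C) (x : U) (eps : R) :
  0 < eps -> continuous f x -> locally x (fun y => Cmod (f y - f x) < eps).
Proof.
  intros He Hf.
  assert (H : continuous (fun y => Cmod (f y - f x)) x).
  { apply continuous_Cmod, continuous_Cminus; [exact Hf | apply continuous_const]. }
  specialize (H (ball (Cmod (f x - f x)) (mkposreal _ He))
                (locally_ball _ (mkposreal _ He))).
  unfold filtermap in H. revert H. apply filter_imp. intros y Hy.
  change (Rabs (Cmod (f y - f x) - Cmod (f x - f x)) < eps) in Hy.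
  replace (f x - f x)%C with (RtoC 0) in Hy by ring.
  rewrite Cmod_0, Rminus_0_r in Hy.
  rewrite Rabs_pos_eq in Hy; [exact Hy | apply Cmod_ge_0].
Qed.

Lemma locally_C (z : C) (P : C -> Prop) :
  locally z P <-> exists d, 0 < d /\ forall y, Cmod (y - z) < d -> P y.
Proof.
  split.
  - intros [d Hd]. exists d. split; [apply cond_pos|].
    intros y Hy. apply Hd. apply C_NormedModule_mixin_compat1. exact Hy.
  - intros (d & Hd & H).
    (* Balls of the product structure are squares, contained in discs of radius [sqrt 2] times
       larger; as [sqrt 2 < 2], half the radius is enough. *)
    assert (Hd2 : 0 < d / 2) by lra.
    exists (mkposreal _ Hd2). intros y Hy. apply H.
    apply C_NormedModule_mixin_compat2 in Hy. simpl in Hy.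
    change (Cmod (minus y z)) with (Cmod (y - z)) in Hy.
    assert (sqrt 2 < 2).
    { rewrite <- (sqrt_Rsqr 2) at 2 by lra. apply sqrt_lt_1_alt. unfold Rsqr. lra. }
    assert (sqrt 2 * (d / 2) < 2 * (d / 2)) by (apply Rmult_lt_compat_r; lra).
    lra.
Qed.

Lemma continuous_C_eps (f : C -> C) (z : C) :
  continuous f z <->
  forall eps, 0 < eps ->
    exists d, 0 < d /\ forall y, Cmod (y - z) < d -> Cmod (f y - f z) < eps.
Proof.
  split.
  - intros H eps He. apply locally_C. apply continuous_C_locally; assumption.
  - intros H P HP. apply locally_C in HP. destruct HP as (e & He & HP).
    destruct (H e He) as (d & Hd & Hy).
    apply locally_C. exists d. split; [exact Hd|].
    intros y Hyd. apply HP, Hy, Hyd.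
Qed.

(* [is_derive] uses the uniform structure of the absolute value of [C], which is
   not the product structure underlying [continuous]. *)
Lemma locally_AbsRing_C (z : C) (P : C -> Prop) :
  @locally (AbsRing_UniformSpace C_AbsRing) z P <->
  exists d, 0 < d /\ forall y, Cmod (y - z) < d -> P y.
Proof.
  split.
  - intros [d Hd]. exists d. split; [apply cond_pos|]. exact Hd.
  - intros (d & Hd & H). exists (mkposreal d Hd). exact H.
Qed.

Lemma is_C_derive_eps (f : C -> C) (z l : C) :
  is_derive f z l <->
  forall eps, 0 < eps ->
    exists d, 0 < d /\ forall y, Cmod (y - z) < d ->
      Cmod (f y - f z - l * (y - z)) <= eps * Cmod (y - z).
Proof.
  split.
  - intros [_ H] eps He.
    assert (Hl : is_filter_lim (@locally (AbsRing_UniformSpace C_AbsRing) z) z) by (intros P HP; exact HP).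
    specialize (H z Hl (mkposreal _ He)). simpl in H.
    apply locally_AbsRing_C in H. destruct H as (d & Hd & H). exists d. split; [exact Hd|].
    intros y Hy. specialize (H y Hy).
    change (Cmod ((f y - f z) - (y - z) * l)%C <= eps * Cmod (y - z)) in H.
    replace (f y - f z - l * (y - z))%C with ((f y - f z) - (y - z) * l)%C by ring.
    exact H.
  - intros H. split; [apply is_linear_scal_l|].
    intros x Hx eps.
    apply (is_filter_lim_locally_unique (V := AbsRing_NormedModule C_AbsRing)) in Hx. subst x.
    destruct (H eps (cond_pos eps)) as (d & Hd & Hy).
    apply locally_AbsRing_C. exists d. split; [exact Hd|].
    intros y Hyd. specialize (Hy y Hyd).
    change (Cmod ((f y - f z) - (y - z) * l)%C <= eps * Cmod (y - z)).
    replace ((f y - f z) - (y - z) * l)%C with (f y - f z - l * (y - z))%C by ring.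
    exact Hy.
Qed.

(* Caratheodory's form of the derivative: the algebra of derivatives becomes the
   algebra of continuous functions. *)
Lemma is_C_derive_slope (f : C -> C) (z l : C) :
  is_derive f z l <->
  exists p : C -> C, continuous p z /\ p z = l /\
    forall y, (f y - f z = p y * (y - z))%C.
Proof.
  rewrite is_C_derive_eps. split.
  - intros H.
    exists (fun y => if excluded_middle_informative (y = z) then l
                     else ((f y - f z) / (y - z))%C).
    assert (Hz : (if excluded_middle_informative (z = z) then l
                  else ((f z - f z) / (z - z))%C) = l).
    { destruct (excluded_middle_informative (z = z)) as [_|n];
        [reflexivity | exfalso; apply n; reflexivity]. }
    split; [|split; [exact Hz|]].
    + apply continuous_C_eps. rewrite Hz. intros eps He.
      destruct (H (eps / 2) ltac:(lra)) as (d & Hd & Hy).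
      exists d. split; [exact Hd|]. intros y Hyd.
      destruct (excluded_middle_informative (y = z)) as [e|n].
      * replace (l - l)%C with (RtoC 0) by ring. rewrite Cmod_0. exact He.
      * assert (Hn : (y - z <> 0)%C).
        { intros E. apply n. replace y with ((y - z) + z)%C by ring. rewrite E. ring. }
        specialize (Hy y Hyd).
        replace ((f y - f z) / (y - z) - l)%C
          with ((f y - f z - l * (y - z)) / (y - z))%C by (field; exact Hn).
        rewrite Cmod_div by exact Hn.
        apply Cmod_gt_0 in Hn.
        apply Rmult_le_compat_r with (r := / Cmod (y - z)) in Hy;
          [|left; apply Rinv_0_lt_compat; exact Hn].
        rewrite Rmult_assoc, Rinv_r in Hy by lra. unfold Rdiv in *. lra.
    + intros y. destruct (excluded_middle_informative (y = z)) as [e|n].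
      * subst. ring.
      * field. intros E. apply n. replace y with ((y - z) + z)%C by ring. rewrite E. ring.
  - intros (p & Hp & Hpz & Hy) eps He.
    rewrite continuous_C_eps in Hp. destruct (Hp eps He) as (d & Hd & Hd').
    exists d. split; [exact Hd|]. intros y Hyd.
    rewrite Hy. replace (p y * (y - z) - l * (y - z))%C with ((p y - p z) * (y - z))%C
      by (rewrite Hpz; ring).
    rewrite Cmod_mult. apply Rmult_le_compat_r; [apply Cmod_ge_0|].
    left. apply Hd', Hyd.
Qed.

Lemma is_C_derive_continuous (f : C -> C) (z l : C) :
  is_derive f z l -> continuous f z.
Proof.
  intros H. apply is_C_derive_slope in H. destruct H as (p & Hp & _ & E).
  apply continuous_ext with (fun y => f z + p y * (y - z))%C.
  - intros y. rewrite <- E. as_C_eq; ring.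
  - apply continuous_Cplus; [apply continuous_const|].
    apply continuous_Cmult; [exact Hp|].
    apply continuous_Cminus; [apply continuous_id | apply continuous_const].
Qed.

Lemma is_C_derive_const (c z : C) : is_derive (fun _ : C => c) z (RtoC 0).
Proof.
  apply is_C_derive_slope. exists (fun _ => RtoC 0).
  split; [apply continuous_const|]. split; [reflexivity|]. intros y. ring.
Qed.

Lemma is_C_derive_id (z : C) : is_derive (fun x : C => x) z (RtoC 1).
Proof.
  apply is_C_derive_slope. exists (fun _ => RtoC 1).
  split; [apply continuous_const|]. split; [reflexivity|]. intros y. ring.
Qed.

Lemma is_C_derive_plus (f g : C -> C) (z a b : C) :
  is_derive f z a -> is_derive g z b ->
  is_derive (fun x => f x + g x)%C z (a + b)%C.
Proof.
  rewrite !is_C_derive_slope. intros (p & Hp & Pz & Ep) (q & Hq & Qz & Eq).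
  exists (fun y => p y + q y)%C. split; [apply continuous_Cplus; assumption|].
  split; [now rewrite Pz, Qz|]. intros y.
  replace (f y + g y - (f z + g z))%C with ((f y - f z) + (g y - g z))%C by ring.
  rewrite Ep, Eq. ring.
Qed.

Lemma is_C_derive_opp (f : C -> C) (z a : C) :
  is_derive f z a -> is_derive (fun x => - f x)%C z (- a)%C.
Proof.
  rewrite !is_C_derive_slope. intros (p & Hp & Pz & Ep).
  exists (fun y => - p y)%C. split; [apply continuous_Copp; assumption|].
  split; [now rewrite Pz|]. intros y.
  replace (- f y - - f z)%C with (- (f y - f z))%C by ring.
  rewrite Ep. ring.
Qed.

Lemma is_C_derive_minus (f g : C -> C) (z a b : C) :
  is_derive f z a -> is_derive g z b ->
  is_derive (fun x => f x - g x)%C z (a - b)%C.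
Proof.
  intros Hf Hg. apply is_C_derive_plus; [|apply is_C_derive_opp]; assumption.
Qed.

Lemma is_C_derive_mult (f g : C -> C) (z a b : C) :
  is_derive f z a -> is_derive g z b ->
  is_derive (fun x => f x * g x)%C z (a * g z + f z * b)%C.
Proof.
  intros Hf Hg. pose proof (is_C_derive_continuous _ _ _ Hg) as Cg.
  revert Hf Hg.
  rewrite !is_C_derive_slope. intros (p & Hp & Pz & Ep) (q & Hq & Qz & Eq).
  exists (fun y => p y * g y + f z * q y)%C.
  split.
  - apply continuous_Cplus; apply continuous_Cmult; try assumption.
    apply continuous_const.
  - split; [now rewrite Pz, Qz|]. intros y.
    replace (f y * g y - f z * g z)%C
      with ((f y - f z) * g y + f z * (g y - g z))%C by ring.
    rewrite Ep, Eq. ring.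
Qed.

Lemma is_C_derive_comp (f g : C -> C) (z a b : C) :
  is_derive f (g z) a -> is_derive g z b ->
  is_derive (fun x => f (g x)) z (a * b)%C.
Proof.
  intros Hf Hg. pose proof (is_C_derive_continuous _ _ _ Hg) as Cg.
  revert Hf Hg.
  rewrite !is_C_derive_slope. intros (p & Hp & Pz & Ep) (q & Hq & Qz & Eq).
  exists (fun y => p (g y) * q y)%C.
  split.
  - apply continuous_Cmult; [|assumption]. apply continuous_comp; assumption.
  - split; [now rewrite Pz, Qz|]. intros y. rewrite Ep, Eq. ring.
Qed.

Lemma is_C_derive_Cinv (z : C) :
  z <> 0 -> is_derive Cinv z (- / (z * z))%C.
Proof.
  intros Hz. apply is_C_derive_eps. intros eps He.
  assert (Hm : 0 < Cmod z) by (apply Cmod_gt_0; exact Hz).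
  set (m := Cmod z) in *.
  (* The first bound keeps [|y| > m / 2]; the error is [|y - z|^2 / (|z|^2 |y|)], at most
     [2 |y - z|^2 / m^3], whence the second. *)
  exists (Rmin (m / 2) (eps * (m * m * m) / 2)).
  split.
  { apply Rmin_pos; [lra|]. assert (0 < m * m * m) by (repeat apply Rmult_lt_0_compat; lra).
    nra. }
  intros y Hy.
  assert (H1 : Cmod (y - z) < m / 2) by (eapply Rlt_le_trans; [exact Hy | apply Rmin_l]).
  assert (H2 : Cmod (y - z) < eps * (m * m * m) / 2)
    by (eapply Rlt_le_trans; [exact Hy | apply Rmin_r]).
  assert (H3 : m / 2 < Cmod y).
  { assert (m <= Cmod y + Cmod (y - z)); [|lra].
    unfold m. replace z with (y - (y - z))%C at 1 by ring.
    unfold Cminus at 1. eapply Rle_trans; [apply Cmod_triangle|].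
    rewrite Cmod_opp. lra. }
  assert (Hy0 : y <> 0) by (apply Cmod_gt_0; lra).
  replace (/ y - / z - - / (z * z) * (y - z))%C
    with ((y - z) * ((y - z) / (z * z * y)))%C
    by (field; split; assumption).
  rewrite Cmod_mult, Rmult_comm. apply Rmult_le_compat_r; [apply Cmod_ge_0|].
  assert (Hzz : (z * z * y <> 0)%C) by (repeat apply Cmult_neq_0; assumption).
  rewrite Cmod_div by exact Hzz. rewrite !Cmod_mult. fold m.
  apply Rmult_le_reg_r with (m * m * Cmod y); [repeat apply Rmult_lt_0_compat; lra|].
  unfold Rdiv. rewrite Rmult_assoc, Rinv_l
    by (apply Rgt_not_eq; repeat apply Rmult_lt_0_compat; lra).
  rewrite Rmult_1_r.
  assert (0 < eps * (m * m)) by (repeat apply Rmult_lt_0_compat; lra).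
  nra.
Qed.

Lemma is_C_derive_inv (f : C -> C) (z a : C) :
  is_derive f z a -> f z <> 0 ->
  is_derive (fun x => / f x)%C z (- a / (f z * f z))%C.
Proof.
  intros Hf Hz.
  replace (- a / (f z * f z))%C with (- / (f z * f z) * a)%C by (field; exact Hz).
  apply (is_C_derive_comp Cinv f); [apply is_C_derive_Cinv; exact Hz | exact Hf].
Qed.

Lemma is_C_derive_div (f g : C -> C) (z a b : C) :
  is_derive f z a -> is_derive g z b -> g z <> 0 ->
  is_derive (fun x => f x / g x)%C z ((a * g z - f z * b) / (g z * g z))%C.
Proof.
  intros Hf Hg Hz.
  replace ((a * g z - f z * b) / (g z * g z))%C
    with (a * / g z + f z * (- b / (g z * g z)))%C by (field; exact Hz).
  apply (is_C_derive_mult f (fun x => / g x)%C); [exact Hf|].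
  apply is_C_derive_inv; assumption.
Qed.

Lemma is_C_derive_ext_near (f g : C -> C) (z l : C) (r : R) :
  0 < r -> (forall y, Cmod (y - z) < r -> f y = g y) ->
  is_derive f z l -> is_derive g z l.
Proof.
  intros Hr He. apply is_derive_ext_loc. apply locally_AbsRing_C. exists r. split; assumption.
Qed.

Lemma is_C_derive_eq (f : C -> C) (z a b : C) :
  is_derive f z a -> a = b -> is_derive f z b.
Proof. intros H <-. exact H. Qed.

Lemma unit_disc_open (z : C) :
  unit_disc z -> exists d, 0 < d /\ forall y, Cmod (y - z) < d -> unit_disc y.
Proof.
  intros Hz. unfold unit_disc in *. exists (1 - Cmod z). split; [lra|].
  intros y Hy. replace y with ((y - z) + z)%C by ring.
  eapply Rle_lt_trans; [apply Cmod_triangle|]. lra.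
Qed.

Lemma unit_disc_0 : unit_disc 0.
Proof. unfold unit_disc. rewrite Cmod_0. lra. Qed.

(** * Integrals of complex-valued functions and bisection *)

(** [C] is integrated as a real normed module, that is, componentwise; a complex constant is not one
    of its scalars, hence the separate [is_CInt_scal]. *)
Definition CInt (f : R -> C) (a b : R) : C := RInt (V := C_R_CompleteNormedModule) f a b.

Definition is_CInt (f : R -> C) (a b : R) (l : C) : Prop :=
  is_RInt (V := C_R_NormedModule) f a b l.

Lemma is_CInt_unique (f : R -> C) (a b : R) (l : C) : is_CInt f a b l -> CInt f a b = l.
Proof. intros H. apply (is_RInt_unique (V := C_R_CompleteNormedModule)). exact H. Qed.

Definition cont_on (f : R -> C) (a b : R) : Prop :=
  forall t, a <= t <= b -> continuous f t.

Lemma CInt_correct (f : R -> C) (a b : R) :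
  a <= b -> cont_on f a b -> is_CInt f a b (CInt f a b).
Proof.
  intros Hab H. apply (RInt_correct (V := C_R_CompleteNormedModule)).
  apply (ex_RInt_continuous (V := C_R_CompleteNormedModule)).
  rewrite Rmin_left, Rmax_right by exact Hab. exact H.
Qed.

Lemma is_CInt_pair (f : R -> C) (a b : R) (l : C) :
  is_CInt f a b l <->
  is_RInt (fun t => fst (f t)) a b (fst l) /\ is_RInt (fun t => snd (f t)) a b (snd l).
Proof.
  split.
  - intros H. split.
    + exact (is_RInt_fct_extend_fst (U := R_NormedModule) (V := R_NormedModule) f a b l H).
    + exact (is_RInt_fct_extend_snd (U := R_NormedModule) (V := R_NormedModule) f a b l H).
  - intros [H1 H2]. destruct l as [l1 l2].
    exact (is_RInt_fct_extend_pair (U := R_NormedModule) (V := R_NormedModule)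
             f a b l1 l2 H1 H2).
Qed.

Lemma is_CInt_minus (f g : R -> C) (a b : R) (k l : C) :
  is_CInt f a b k -> is_CInt g a b l -> is_CInt (fun t => f t - g t)%C a b (k - l)%C.
Proof. intros H1 H2. exact (is_RInt_minus (V := C_R_NormedModule) f g a b k l H1 H2). Qed.

Lemma is_CInt_scal (c : C) (f : R -> C) (a b : R) (l : C) :
  is_CInt f a b l -> is_CInt (fun t => c * f t)%C a b (c * l)%C.
Proof.
  rewrite !is_CInt_pair. intros [H1 H2]. simpl. split.
  - apply (is_RInt_minus (V := R_NormedModule));
      apply (is_RInt_scal (V := R_NormedModule)); assumption.
  - apply (is_RInt_plus (V := R_NormedModule));
      apply (is_RInt_scal (V := R_NormedModule)); assumption.
Qed.

Lemma is_CInt_const (c : C) (a b : R) : is_CInt (fun _ => c) a b (RtoC (b - a) * c)%C.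
Proof.
  replace (RtoC (b - a) * c)%C with (scal (V := C_R_NormedModule) (b - a) c).
  - apply (is_RInt_const (V := C_R_NormedModule)).
  - destruct c as [x y].
    change ((scal (V := R_NormedModule) (b - a) x, scal (V := R_NormedModule) (b - a) y)
            = (RtoC (b - a) * (x, y))%C).
    unfold Cmult; simpl. unfold scal; simpl. unfold mult; simpl. f_equal; ring.
Qed.

Lemma is_CInt_Chasles (f : R -> C) (a b c : R) (k l : C) :
  is_CInt f a b k -> is_CInt f b c l -> is_CInt f a c (k + l)%C.
Proof. intros H1 H2. exact (is_RInt_Chasles (V := C_R_NormedModule) f a b c k l H1 H2). Qed.

Lemma is_CInt_ext (f g : R -> C) (a b : R) (l : C) :
  a <= b -> (forall t, a <= t <= b -> f t = g t) -> is_CInt f a b l -> is_CInt g a b l.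
Proof.
  intros Hab H. apply (is_RInt_ext (V := C_R_NormedModule)).
  rewrite Rmin_left, Rmax_right by exact Hab. intros x Hx. apply H. lra.
Qed.

Lemma is_CInt_bound (f : R -> C) (a b M : R) (l : C) :
  a <= b -> (forall t, a <= t <= b -> Cmod (f t) <= M) -> is_CInt f a b l ->
  Cmod l <= (b - a) * M.
Proof.
  intros Hab HM H.
  assert (E : forall z : C, norm (V := C_R_NormedModule) z = Cmod z).
  { intros [x y].
    change (sqrt (Rabs x ^ 2 + Rabs y ^ 2) = sqrt (x ^ 2 + y ^ 2)).
    rewrite !pow2_abs. reflexivity. }
  rewrite <- E. apply (norm_RInt_le_const (V := C_R_NormedModule) f a b l M Hab); [|exact H].
  intros t Ht. rewrite E. apply HM, Ht.
Qed.

(** Kept coordinatewise so that the fundamental theorem of calculus and [auto_derive] apply to each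
    real component. *)
Definition path_derive (p : R -> C) (t : R) (d : C) : Prop :=
  is_derive (fun u => fst (p u)) t (fst d) /\ is_derive (fun u => snd (p u)) t (snd d).

Lemma path_derive_continuous (p : R -> C) (t : R) (d : C) :
  path_derive p t d -> continuous p t.
Proof.
  intros [H1 H2]. apply continuous_C_pair.
  - apply (ex_derive_continuous (fun u => fst (p u))). eexists; exact H1.
  - apply (ex_derive_continuous (fun u => snd (p u))). eexists; exact H2.
Qed.

Lemma is_CInt_derive (p dp : R -> C) (a b : R) :
  a <= b -> (forall t, a <= t <= b -> path_derive p t (dp t)) -> cont_on dp a b ->
  is_CInt dp a b (p b - p a)%C.
Proof.
  intros Hab Hd Hc. apply is_CInt_pair. split.
  - apply (is_RInt_derive (V := R_CompleteNormedModule) (fun u => fst (p u))).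
    + rewrite Rmin_left, Rmax_right by exact Hab. intros t Ht. apply Hd, Ht.
    + rewrite Rmin_left, Rmax_right by exact Hab. intros t Ht.
      apply continuous_C_fst. apply Hc, Ht.
  - apply (is_RInt_derive (V := R_CompleteNormedModule) (fun u => snd (p u))).
    + rewrite Rmin_left, Rmax_right by exact Hab. intros t Ht. apply Hd, Ht.
    + rewrite Rmin_left, Rmax_right by exact Hab. intros t Ht.
      apply continuous_C_snd. apply Hc, Ht.
Qed.

(** The mean value theorem fails for complex-valued functions; the bound comes from integrating
    [dp]. *)
Lemma path_lipschitz (p dp : R -> C) (a b L : R) :
  a <= b -> (forall t, a <= t <= b -> path_derive p t (dp t)) -> cont_on dp a b ->
  (forall t, a <= t <= b -> Cmod (dp t) <= L) ->
  Cmod (p b - p a) <= (b - a) * L.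
Proof.
  intros Hab Hd Hc HL. apply is_CInt_bound with dp; try assumption.
  apply is_CInt_derive; assumption.
Qed.

(** Both components of [al * p + be * p^2 / 2] are real quadratic polynomials of this shape in the
    components of [p]. *)
Lemma is_derive_quadratic (x y : R -> R) (t dx dy a b c d l : R) :
  is_derive x t dx -> is_derive y t dy ->
  a * dx + b * dy + (c * (2 * x t * dx - 2 * y t * dy) + d * (dx * y t + x t * dy)) = l ->
  is_derive (fun u => (a * x u + b * y u) + (c * (x u * x u - y u * y u) + d * (x u * y u)))
    t l.
Proof.
  intros H1 H2 <-. auto_derive.
  - repeat split; eexists; eassumption.
  - change (Derive (fun u : R => x u) t) with (Derive x t).
    change (Derive (fun u : R => y u) t) with (Derive y t).
    rewrite (is_derive_unique x t _ H1), (is_derive_unique y t _ H2). ring.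
Qed.

(** An affine function has a primitive, so its integral depends on the endpoints only; in Goursat's
    argument these endpoint values cancel around a closed curve. *)
Lemma is_CInt_affine_along_path (al be : C) (p dp : R -> C) (a b : R) :
  a <= b -> (forall t, a <= t <= b -> path_derive p t (dp t)) -> cont_on dp a b ->
  is_CInt (fun t => (al + be * p t) * dp t)%C a b
    ((al * p b + be * (p b * p b) / 2) - (al * p a + be * (p a * p a) / 2))%C.
Proof.
  intros Hab Hd Hc.
  apply (is_CInt_derive (fun t => al * p t + be * (p t * p t) / 2)%C); [exact Hab| |].
  - intros t Ht. destruct (Hd t Ht) as [H1 H2].
    assert (E2 : forall z : C, (be * z / 2)%C = (((fst be / 2)%R, (snd be / 2)%R) * z)%C).
    { intros z. replace (((fst be / 2)%R, (snd be / 2)%R) : C) with (be / 2)%C; [field|].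
      unfold Cdiv, Cinv, Cmult; simpl. f_equal; field. }
    split.
    + eapply is_derive_ext;
        [|eapply (is_derive_quadratic (fun u => fst (p u)) (fun u => snd (p u)) t _ _
            (fst al) (- snd al) (fst be / 2) (- snd be) _ H1 H2)].
      * intros u. cbv beta. rewrite E2. simpl. field.
      * simpl. field.
    + eapply is_derive_ext;
        [|eapply (is_derive_quadratic (fun u => fst (p u)) (fun u => snd (p u)) t _ _
            (snd al) (fst al) (snd be / 2) (fst be) _ H1 H2)].
      * intros u. cbv beta. rewrite E2. simpl. field.
      * simpl. field.
  - intros t Ht. apply continuous_Cmult; [|apply Hc, Ht].
    apply continuous_Cplus; [apply continuous_const|].
    apply continuous_Cmult; [apply continuous_const|].
    apply (path_derive_continuous p t (dp t)). apply Hd, Ht.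
Qed.

Lemma is_CInt_near_affine (f : C -> C) (al be : C) (p dp : R -> C) (a b E L : R) (l : C) :
  a <= b -> (forall t, a <= t <= b -> path_derive p t (dp t)) -> cont_on dp a b ->
  0 <= E ->
  (forall t, a <= t <= b -> Cmod (dp t) <= L) ->
  (forall t, a <= t <= b -> Cmod (f (p t) - (al + be * p t)) <= E) ->
  is_CInt (fun t => f (p t) * dp t)%C a b l ->
  Cmod (l - ((al * p b + be * (p b * p b) / 2) - (al * p a + be * (p a * p a) / 2)))
    <= (b - a) * (E * L).
Proof.
  intros Hab Hd Hc HE HL Hf Hl.
  apply is_CInt_bound with (fun t => f (p t) * dp t - (al + be * p t) * dp t)%C;
    [exact Hab| |].
  - intros t Ht.
    replace (f (p t) * dp t - (al + be * p t) * dp t)%C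
      with ((f (p t) - (al + be * p t)) * dp t)%C by ring.
    rewrite Cmod_mult. apply Rmult_le_compat; try apply Cmod_ge_0; auto.
  - apply is_CInt_minus; [exact Hl|]. apply is_CInt_affine_along_path; assumption.
Qed.

(** If the first three quarters all fall below a quarter of the modulus, additivity and the triangle
    inequality force the last one above it, so it can be the default. *)
Definition bisect_rectangle (J : R -> R -> R -> R -> C)
  (q : (R * R) * (R * R)) : (R * R) * (R * R) :=
  let '((s0, s1), (t0, t1)) := q in
  let s := (s0 + s1) / 2 in
  let t := (t0 + t1) / 2 in
  let c := Cmod (J s0 s1 t0 t1) / 4 in
  if Rle_dec c (Cmod (J s0 s t0 t)) then ((s0, s), (t0, t))
  else if Rle_dec c (Cmod (J s0 s t t1)) then ((s0, s), (t, t1))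
  else if Rle_dec c (Cmod (J s s1 t0 t)) then ((s, s1), (t0, t))
  else ((s, s1), (t, t1)).

Lemma nested_intervals (u v : nat -> R) :
  (forall n, u n <= u (S n)) -> (forall n, v (S n) <= v n) -> (forall n, u n <= v n) ->
  exists p, forall n, u n <= p <= v n.
Proof.
  intros Hu Hv Huv.
  assert (Mu : forall n k, u n <= u (n + k)%nat).
  { intros n k. induction k as [|k IH].
    - replace (n + 0)%nat with n by lia. lra.
    - replace (n + S k)%nat with (S (n + k)) by lia. specialize (Hu (n + k)%nat). lra. }
  assert (Mv : forall n k, v (n + k)%nat <= v n).
  { intros n k. induction k as [|k IH].
    - replace (n + 0)%nat with n by lia. lra.
    - replace (n + S k)%nat with (S (n + k)) by lia. specialize (Hv (n + k)%nat). lra. }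
  assert (B : forall m n, u m <= v n).
  { intros m n. specialize (Mu m n). specialize (Mv n m). specialize (Huv (m + n)%nat).
    replace (n + m)%nat with (m + n)%nat in Mv by lia. lra. }
  destruct (completeness (fun x => exists n, x = u n)) as [p [Hp1 Hp2]].
  - exists (v O). intros x [n ->]. apply B.
  - exists (u O). exists O. reflexivity.
  - exists p. intros n. split.
    + apply Hp1. exists n. reflexivity.
    + apply Hp2. intros x [m ->]. apply B.
Qed.

(** Goursat's bisection in abstract form: additivity yields nested rectangles with
    [|J| <= 4^n |J_n|], while the estimate at their common point makes [|J_n|] small against the
    square of a perimeter that shrinks like [2^-n]. The powers of 4 cancel. *)
Lemma rectangle_bisection (J : R -> R -> R -> R -> C) (a b c d : R) :
  a <= b -> c <= d ->
  (forall s0 s1 t0 t1, a <= s0 -> s0 <= s1 -> s1 <= b -> c <= t0 -> t0 <= t1 -> t1 <= d ->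
     let s := (s0 + s1) / 2 in let t := (t0 + t1) / 2 in
     J s0 s1 t0 t1 = (J s0 s t0 t + J s0 s t t1 + J s s1 t0 t + J s s1 t t1)%C) ->
  (forall p q, a <= p <= b -> c <= q <= d -> forall eps, 0 < eps ->
     exists dl, 0 < dl /\ forall s0 s1 t0 t1,
       a <= s0 -> s0 <= p -> p <= s1 -> s1 <= b ->
       c <= t0 -> t0 <= q -> q <= t1 -> t1 <= d ->
       s1 - s0 < dl -> t1 - t0 < dl ->
       Cmod (J s0 s1 t0 t1) <= eps * ((s1 - s0) + (t1 - t0)) ^ 2) ->
  J a b c d = RtoC 0.
Proof.
  intros Hab Hcd Hadd Hloc.
  apply NNPP. intros HJ. apply Cmod_gt_0 in HJ.
  set (S_ := fun n => Nat.iter n (bisect_rectangle J) ((a, b), (c, d))).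
  assert (Hinv : forall n,
    let '((s0, s1), (t0, t1)) := S_ n in
    a <= s0 /\ s0 <= s1 /\ s1 <= b /\ c <= t0 /\ t0 <= t1 /\ t1 <= d /\
    s1 - s0 = (b - a) / 2 ^ n /\ t1 - t0 = (d - c) / 2 ^ n /\
    Cmod (J a b c d) <= 4 ^ n * Cmod (J s0 s1 t0 t1)).
  { induction n as [|n IH].
    - simpl. repeat split; try lra.
    - change (S_ (S n)) with (bisect_rectangle J (S_ n)).
      destruct (S_ n) as [[s0 s1] [t0 t1]].
      destruct IH as (H1 & H2 & H3 & H4 & H5 & H6 & H7 & H8 & H9).
      assert (E1 : (b - a) / 2 ^ S n = (s1 - s0) / 2).
      { rewrite H7. simpl. field. apply pow_nonzero. lra. }
      assert (E2 : (d - c) / 2 ^ S n = (t1 - t0) / 2).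
      { rewrite H8. simpl. field. apply pow_nonzero. lra. }
      assert (P4 : 0 < 4 ^ n) by (apply pow_lt; lra).
      assert (K : forall x, Cmod (J s0 s1 t0 t1) / 4 <= x ->
                  Cmod (J a b c d) <= 4 ^ S n * x) by (intros x Hx; simpl; nra).
      unfold bisect_rectangle. rewrite E1, E2.
      destruct (Rle_dec _ _) as [L1|L1]; [repeat split; try lra; apply K, L1|].
      destruct (Rle_dec _ _) as [L2|L2]; [repeat split; try lra; apply K, L2|].
      destruct (Rle_dec _ _) as [L3|L3]; [repeat split; try lra; apply K, L3|].
      repeat split; try lra. apply K.
      pose proof (Hadd s0 s1 t0 t1 H1 H2 H3 H4 H5 H6) as E. simpl in E.
      set (A1 := J s0 ((s0 + s1) / 2) t0 ((t0 + t1) / 2)) in *.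
      set (A2 := J s0 ((s0 + s1) / 2) ((t0 + t1) / 2) t1) in *.
      set (A3 := J ((s0 + s1) / 2) s1 t0 ((t0 + t1) / 2)) in *.
      set (A4 := J ((s0 + s1) / 2) s1 ((t0 + t1) / 2) t1) in *.
      pose proof (Cmod_triangle (A1 + A2 + A3) A4).
      pose proof (Cmod_triangle (A1 + A2) A3).
      pose proof (Cmod_triangle A1 A2).
      rewrite <- E in *. lra. }
  destruct (nested_intervals (fun n => fst (fst (S_ n))) (fun n => snd (fst (S_ n))))
    as [p Hp].
  1-3: intros n; pose proof (Hinv n) as I; try (pose proof (Hinv (S n)) as I');
    try change (S_ (S n)) with (bisect_rectangle J (S_ n)) in *;
    destruct (S_ n) as [[s0 s1] [t0 t1]]; simpl in *;
    repeat (destruct (Rle_dec _ _)); simpl in *; lra.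
  destruct (nested_intervals (fun n => fst (snd (S_ n))) (fun n => snd (snd (S_ n))))
    as [q Hq].
  1-3: intros n; pose proof (Hinv n) as I; try (pose proof (Hinv (S n)) as I');
    try change (S_ (S n)) with (bisect_rectangle J (S_ n)) in *;
    destruct (S_ n) as [[s0 s1] [t0 t1]]; simpl in *;
    repeat (destruct (Rle_dec _ _)); simpl in *; lra.
  pose proof (Hp O) as P0. pose proof (Hq O) as Q0. simpl in P0, Q0.
  set (D := (b - a) + (d - c)).
  set (k := Cmod (J a b c d)) in *.
  assert (HD : 0 <= D) by (unfold D; lra).
  (* This accuracy turns the final bound into [k <= k D^2 / (2 (D^2 + 1)) < k]; the added 1 covers
     the degenerate rectangle [D = 0]. *)
  assert (He : 0 < k / (2 * (D ^ 2 + 1))).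
  { apply Rdiv_lt_0_compat; nra. }
  destruct (Hloc p q P0 Q0 _ He) as (dl & Hdl & Hl).
  destruct (pow_lt_1_zero (/ 2) ltac:(rewrite Rabs_pos_eq; lra) (dl / (D + 1)))
    as [N HN].
  { apply Rdiv_lt_0_compat; lra. }
  specialize (HN N (le_n N)). specialize (Hp N). specialize (Hq N).
  pose proof (Hinv N) as I.
  destruct (S_ N) as [[s0 s1] [t0 t1]]. simpl in Hp, Hq.
  destruct I as (H1 & H2 & H3 & H4 & H5 & H6 & H7 & H8 & H9).
  assert (P2 : 0 < 2 ^ N) by (apply pow_lt; lra).
  rewrite pow_inv in HN. rewrite Rabs_pos_eq in HN
    by (left; apply Rinv_0_lt_compat; exact P2).
  assert (Hsm : D / 2 ^ N < dl).
  { apply Rle_lt_trans with ((D + 1) * / 2 ^ N).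
    - unfold Rdiv. apply Rmult_le_compat_r; [left; apply Rinv_0_lt_compat; exact P2|lra].
    - apply Rmult_lt_compat_l with (r := D + 1) in HN; [|lra].
      replace ((D + 1) * (dl / (D + 1))) with dl in HN by (field; lra). exact HN. }
  assert (Hsum : (s1 - s0) + (t1 - t0) = D / 2 ^ N)
    by (rewrite H7, H8; unfold D; field; lra).
  assert (Hs : s1 - s0 < dl /\ t1 - t0 < dl) by (clear - Hsm Hsum H2 H5; split; lra).

  specialize (Hl s0 s1 t0 t1 H1 (proj1 Hp) (proj2 Hp) H3 H4 (proj1 Hq) (proj2 Hq) H6
                (proj1 Hs) (proj2 Hs)).
  rewrite Hsum in Hl.
  assert (HD2 : 0 < D ^ 2 + 1) by nra.
  assert (P4 : 4 ^ N = 2 ^ N * 2 ^ N).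
  { replace 4 with (2 * 2) by ring. apply Rpow_mult_distr. }
  assert (Hk : k <= k / (2 * (D ^ 2 + 1)) * D ^ 2).
  { eapply Rle_trans; [exact H9|].
    replace (k / (2 * (D ^ 2 + 1)) * D ^ 2)
      with (4 ^ N * (k / (2 * (D ^ 2 + 1)) * (D / 2 ^ N) ^ 2)).
    - apply Rmult_le_compat_l; [rewrite P4; nra | exact Hl].
    - rewrite P4. field. split; lra. }
  assert (k / (2 * (D ^ 2 + 1)) * D ^ 2 < k); [|lra].
  apply Rmult_lt_reg_r with (2 * (D ^ 2 + 1)); [nra|].
  replace (k / (2 * (D ^ 2 + 1)) * D ^ 2 * (2 * (D ^ 2 + 1))) with (k * D ^ 2)
    by (field; nra).
  nra.
Qed.

(** * Goursat's theorem and Cauchy's formula *)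

(** The pull-back of [f dz] to the parameter plane, [Gs] and [Gt] standing for the partial
    derivatives of [G]. Only flat parameter rectangles get bisected, while [G] may bend them into
    the region swept by a homotopy. *)
Definition boundary_integral (f : C -> C) (G Gs Gt : R -> R -> C) (s0 s1 t0 t1 : R) : C :=
  (CInt (fun s => f (G s t0) * Gs s t0) s0 s1 + CInt (fun t => f (G s1 t) * Gt s1 t) t0 t1
   - CInt (fun s => f (G s t1) * Gs s t1) s0 s1
   - CInt (fun t => f (G s0 t) * Gt s0 t) t0 t1)%C.

(** Near a point [f] is affine up to [e' |z - z0|]. The affine part has the primitive [P] and
    contributes nothing around the boundary; what remains is of order [e'] times the length of the
    boundary times its distance to [z0]. *)
Lemma Goursat_rectangle (f : C -> C) (G Gs Gt : R -> R -> C) (a b c d L : R) :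
  a <= b -> c <= d ->
  (forall s t, path_derive (fun s => G s t) s (Gs s t)) ->
  (forall s t, path_derive (fun t => G s t) t (Gt s t)) ->
  (forall s t, continuous (fun s => Gs s t) s) ->
  (forall s t, continuous (fun t => Gt s t) t) ->
  (forall s t, a <= s <= b -> c <= t <= d -> Cmod (Gs s t) <= L /\ Cmod (Gt s t) <= L) ->
  (forall s t, a <= s <= b -> c <= t <= d -> ex_derive f (G s t)) ->
  boundary_integral f G Gs Gt a b c d = RtoC 0.
Proof.
  intros Hab Hcd Hs Ht Cs Ct HL Hf.
  assert (HL0 : 0 <= L).
  { destruct (HL a c ltac:(lra) ltac:(lra)) as [H _].
    eapply Rle_trans; [apply Cmod_ge_0 | exact H]. }
  assert (Is : forall s0 s1 t, a <= s0 -> s0 <= s1 -> s1 <= b -> c <= t <= d ->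
    is_CInt (fun s => f (G s t) * Gs s t)%C s0 s1 (CInt (fun s => f (G s t) * Gs s t)%C s0 s1)).
  { intros s0 s1 t H1 H2 H3 H4. apply CInt_correct; [exact H2|].
    intros s Hs'. apply continuous_Cmult; [|apply Cs].
    apply (continuous_comp (fun s => G s t) f).
    - apply (path_derive_continuous _ _ _ (Hs s t)).
    - destruct (Hf s t) as [l Hl]; [lra | exact H4 |].
      exact (is_C_derive_continuous _ _ _ Hl). }
  assert (It : forall t0 t1 s, c <= t0 -> t0 <= t1 -> t1 <= d -> a <= s <= b ->
    is_CInt (fun t => f (G s t) * Gt s t)%C t0 t1 (CInt (fun t => f (G s t) * Gt s t)%C t0 t1)).
  { intros t0 t1 s H1 H2 H3 H4. apply CInt_correct; [exact H2|].
    intros t Ht'. apply continuous_Cmult; [|apply Ct].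
    apply (continuous_comp (fun t => G s t) f).
    - apply (path_derive_continuous _ _ _ (Ht s t)).
    - destruct (Hf s t) as [l Hl]; [exact H4 | lra |].
      exact (is_C_derive_continuous _ _ _ Hl). }
  apply rectangle_bisection; [exact Hab | exact Hcd | |].
  - intros s0 s1 t0 t1 H1 H2 H3 H4 H5 H6 s t. unfold boundary_integral.
    assert (Es : forall u, c <= u <= d ->
      CInt (fun s => f (G s u) * Gs s u)%C s0 s1 =
      (CInt (fun s => f (G s u) * Gs s u)%C s0 s + CInt (fun s => f (G s u) * Gs s u)%C s s1)%C).
    { intros u Hu. apply is_CInt_unique.
      apply is_CInt_Chasles with s; apply Is; unfold s; lra. }
    assert (Et : forall u, a <= u <= b ->
      CInt (fun t => f (G u t) * Gt u t)%C t0 t1 =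
      (CInt (fun t => f (G u t) * Gt u t)%C t0 t + CInt (fun t => f (G u t) * Gt u t)%C t t1)%C).
    { intros u Hu. apply is_CInt_unique.
      apply is_CInt_Chasles with t; apply It; unfold t; lra. }
    rewrite (Es t0), (Es t1), (Et s0), (Et s1) by lra. ring.
  - intros p q Hp Hq eps He.
    destruct (Hf p q Hp Hq) as [l Hl]. rewrite is_C_derive_eps in Hl.
    (* For a parameter rectangle with sides [h] and [k] the four errors add up to
       [2 L^2 e' (h + k)^2]: one factor [L] is the speed along the boundary, the other bounds the
       distance to [z0]. *)
    set (e' := eps / (2 * L ^ 2 + 1)).
    assert (HL2 : 0 < 2 * L ^ 2 + 1) by nra.
    assert (He' : 0 < e') by (apply Rdiv_lt_0_compat; [exact He | exact HL2]).
    destruct (Hl e' He') as (dl & Hdl & Hd).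
    exists (dl / (2 * L + 1)). split; [apply Rdiv_lt_0_compat; lra|].
    intros s0 s1 t0 t1 H1 H2 H3 H4 H5 H6 H7 H8 H9 H10.
    set (h := s1 - s0) in *. set (k := t1 - t0) in *.
    set (z0 := G p q) in *.
    assert (Hhk : L * (h + k) < dl).
    { apply Rle_lt_trans with ((2 * L) * (dl / (2 * L + 1))); [nra|].
      apply Rmult_lt_reg_r with (2 * L + 1); [lra|].
      replace (2 * L * (dl / (2 * L + 1)) * (2 * L + 1)) with (2 * L * dl) by (field; lra).
      nra. }
    (* One coordinate is moved at a time, and each displacement may have either sign. *)
    assert (Dist : forall s t, s0 <= s <= s1 -> t0 <= t <= t1 -> Cmod (G s t - z0) <= L * (h + k)).
    { intros s t Hs' Ht'.
      assert (D1 : Cmod (G s t - G p t) <= h * L).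
      { destruct (Rle_dec p s) as [Hle|Hgt].
        - eapply Rle_trans.
          + apply (path_lipschitz (fun s => G s t) (fun s => Gs s t) p s L Hle).
            * intros; apply Hs.
            * intros u _; apply Cs.
            * intros u Hu. apply HL; lra.
          + unfold h. apply Rmult_le_compat_r; lra.
        - replace (G s t - G p t)%C with (- (G p t - G s t))%C by ring. rewrite Cmod_opp.
          eapply Rle_trans.
          + apply (path_lipschitz (fun s => G s t) (fun s => Gs s t) s p L); [lra| | |].
            * intros; apply Hs.
            * intros u _; apply Cs.
            * intros u Hu. apply HL; lra.
          + unfold h. apply Rmult_le_compat_r; lra. }
      assert (D2 : Cmod (G p t - G p q) <= k * L).
      { destruct (Rle_dec q t) as [Hle|Hgt].
        - eapply Rle_trans.
          + apply (path_lipschitz (fun t => G p t) (fun t => Gt p t) q t L Hle).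
            * intros; apply Ht.
            * intros u _; apply Ct.
            * intros u Hu. apply HL; lra.
          + unfold k. apply Rmult_le_compat_r; lra.
        - replace (G p t - G p q)%C with (- (G p q - G p t))%C by ring. rewrite Cmod_opp.
          eapply Rle_trans.
          + apply (path_lipschitz (fun t => G p t) (fun t => Gt p t) t q L); [lra| | |].
            * intros; apply Ht.
            * intros u _; apply Ct.
            * intros u Hu. apply HL; lra.
          + unfold k. apply Rmult_le_compat_r; lra. }
      unfold z0. replace (G s t - G p q)%C with ((G s t - G p t) + (G p t - G p q))%C by ring.
      eapply Rle_trans; [apply Cmod_triangle|]. lra. }
    set (al := (f z0 - l * z0)%C).
    set (P := fun z : C => (al * z + l * (z * z) / 2)%C).
    assert (Aff : forall s t, s0 <= s <= s1 -> t0 <= t <= t1 ->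
      Cmod (f (G s t) - (al + l * G s t)) <= e' * (L * (h + k))).
    { intros s t Hs' Ht'.
      replace (f (G s t) - (al + l * G s t))%C
        with (f (G s t) - f z0 - l * (G s t - z0))%C by (unfold al; ring).
      pose proof (Dist s t Hs' Ht').
      eapply Rle_trans; [apply Hd; lra|]. apply Rmult_le_compat_l; lra. }
    assert (HE : 0 <= e' * (L * (h + k))).
    { apply Rmult_le_pos; [lra|]. apply Rmult_le_pos; unfold h, k; lra. }
    assert (Bs : forall t, t0 <= t <= t1 ->
      Cmod (CInt (fun s => f (G s t) * Gs s t)%C s0 s1 - (P (G s1 t) - P (G s0 t)))
        <= h * (e' * (L * (h + k)) * L)).
    { intros t Ht'.
      apply (is_CInt_near_affine f al l (fun s => G s t) (fun s => Gs s t) s0 s1); try lra.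
      - intros; apply Hs.
      - intros u _; apply Cs.
      - intros u Hu; apply HL; lra.
      - intros u Hu; apply Aff; lra.
      - apply Is; lra. }
    assert (Bt : forall s, s0 <= s <= s1 ->
      Cmod (CInt (fun t => f (G s t) * Gt s t)%C t0 t1 - (P (G s t1) - P (G s t0)))
        <= k * (e' * (L * (h + k)) * L)).
    { intros s Hs'.
      apply (is_CInt_near_affine f al l (fun t => G s t) (fun t => Gt s t) t0 t1); try lra.
      - intros; apply Ht.
      - intros u _; apply Ct.
      - intros u Hu; apply HL; lra.
      - intros u Hu; apply Aff; lra.
      - apply It; lra. }
    unfold boundary_integral.
    pose proof (Bs t0 ltac:(lra)) as B1. pose proof (Bs t1 ltac:(lra)) as B2.
    pose proof (Bt s0 ltac:(lra)) as B3. pose proof (Bt s1 ltac:(lra)) as B4.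
    set (I1 := CInt (fun s => f (G s t0) * Gs s t0)%C s0 s1) in *.
    set (I2 := CInt (fun s => f (G s t1) * Gs s t1)%C s0 s1) in *.
    set (I3 := CInt (fun t => f (G s0 t) * Gt s0 t)%C t0 t1) in *.
    set (I4 := CInt (fun t => f (G s1 t) * Gt s1 t)%C t0 t1) in *.
    (* Each side loses the increment of [P] along it; these increments sum to zero around the
       boundary. *)
    replace (I1 + I4 - I2 - I3)%C with
      ((I1 - (P (G s1 t0) - P (G s0 t0))) + (I4 - (P (G s1 t1) - P (G s1 t0)))
       + - (I2 - (P (G s1 t1) - P (G s0 t1))) + - (I3 - (P (G s0 t1) - P (G s0 t0))))%C by ring.
    set (X1 := (I1 - (P (G s1 t0) - P (G s0 t0)))%C) in *.
    set (X4 := (I4 - (P (G s1 t1) - P (G s1 t0)))%C) in *.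
    set (X2 := (I2 - (P (G s1 t1) - P (G s0 t1)))%C) in *.
    set (X3 := (I3 - (P (G s0 t1) - P (G s0 t0)))%C) in *.
    pose proof (Cmod_triangle (X1 + X4 + - X2) (- X3)) as T1.
    pose proof (Cmod_triangle (X1 + X4) (- X2)) as T2.
    pose proof (Cmod_triangle X1 X4) as T3.
    rewrite Cmod_opp in T1, T2.
    assert (Ee : eps = e' * (2 * L ^ 2 + 1)) by (unfold e'; field; apply Rgt_not_eq; exact HL2).
    assert (0 <= e' * (h + k) ^ 2) by (apply Rmult_le_pos; [left; exact He' | apply pow2_ge_0]).
    assert (R1 : 2 * (h * (e' * (L * (h + k)) * L)) + 2 * (k * (e' * (L * (h + k)) * L))
                 = e' * (h + k) ^ 2 * (2 * L ^ 2)) by ring.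
    assert (R2 : e' * (2 * L ^ 2 + 1) * (h + k) ^ 2
                 = e' * (h + k) ^ 2 * (2 * L ^ 2) + e' * (h + k) ^ 2) by ring.
    rewrite Ee, R2. lra.
Qed.

Lemma Cminus_eq_0 (x y : C) : (x - y)%C = 0 -> x = y.
Proof. intros H. replace x with ((x - y) + y)%C by ring. rewrite H. ring. Qed.

(** * Circles, a homotopy between them, and Cauchy's formula *)

Definition cis (t : R) : C := (cos t, sin t).

Lemma Cmod_cis (t : R) : Cmod (cis t) = 1.
Proof.
  unfold Cmod, cis. cbn [fst snd].
  replace (cos t ^ 2 + sin t ^ 2) with 1; [apply sqrt_1|].
  pose proof (sin2_cos2 t) as H. unfold Rsqr in H. rewrite <- H. ring.
Qed.

Lemma cis_neq_0 (t : R) : cis t <> 0.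
Proof. apply Cmod_gt_0. rewrite Cmod_cis. lra. Qed.

Lemma cis_period : cis (2 * PI) = cis 0.
Proof. unfold cis. rewrite cos_2PI, sin_2PI, cos_0, sin_0. reflexivity. Qed.

Lemma continuous_cis (t : R) : continuous cis t.
Proof.
  apply continuous_C_pair; simpl; [apply continuous_cos | apply continuous_sin].
Qed.

Lemma RtoC_scal_pair (x a b : R) : (RtoC x * (a, b))%C = ((x * a)%R, (x * b)%R).
Proof. unfold Cmult, RtoC; simpl. f_equal; ring. Qed.

(** The straight-line homotopy [G] carries the small circle about [a] ([s = 0]) to the large one
    about 0 ([s = 1]). Its sides [t = 0] and [t = 2 * PI] coincide by periodicity and cancel, so
    Goursat's theorem equates the other two. *)
Lemma homotopy_of_circles (F : C -> C) (a : C) (rho e : R) :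
  Cmod a < rho -> rho < 1 -> 0 < e -> Cmod a + e < 1 ->
  (forall z, unit_disc z -> z <> a -> ex_derive F z) ->
  CInt (fun t => F (RtoC rho * cis t) * (RtoC rho * (Ci * cis t)))%C 0 (2 * PI) =
  CInt (fun t => F (a + RtoC e * cis t) * (RtoC e * (Ci * cis t)))%C 0 (2 * PI).
Proof.
  intros Har Hr He Hae HF.
  pose proof (Cmod_ge_0 a) as Ha0.
  set (G := fun s t : R => (RtoC (1 - s) * a + RtoC ((1 - s) * e + s * rho) * cis t)%C).
  set (Gs := fun s t : R => (- a + RtoC (rho - e) * cis t)%C).
  set (Gt := fun s t : R => (RtoC ((1 - s) * e + s * rho) * (Ci * cis t))%C).
  assert (M1 : forall s, 0 <= s <= 1 -> 0 < (1 - s) * e + s * rho) by (intros; nra).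
  assert (H : boundary_integral F G Gs Gt 0 1 0 (2 * PI) = RtoC 0).
  (* The 3 bounds both speeds: [|a| + |rho - e| <= 1 + 2] in [s], and a radius below 1 in [t]. *)
  { apply (Goursat_rectangle F G Gs Gt 0 1 0 (2 * PI) 3).
    - lra.
    - pose proof PI_RGT_0; lra.
    - intros s t. split; unfold G, Gs, cis; simpl; auto_derive; trivial; ring.
    - intros s t. split; unfold G, Gt, cis; simpl; auto_derive; trivial; ring.
    - intros s t. apply continuous_const.
    - intros s t. apply continuous_Cmult; [apply continuous_const|].
      apply continuous_Cmult; [apply continuous_const | apply continuous_cis].
    - intros s t Hs _. split.
      + unfold Gs. eapply Rle_trans; [apply Cmod_triangle|].
        rewrite Cmod_opp, Cmod_mult, Cmod_cis, Cmod_R.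
        assert (Rabs (rho - e) <= 2) by (apply Rabs_le; lra). lra.
      + unfold Gt. rewrite !Cmod_mult, Cmod_cis, Cmod_R, Cmod_Ci.
        rewrite Rabs_pos_eq by (left; apply M1, Hs). nra.
    - intros s t Hs _. apply HF.
      + unfold unit_disc, G. eapply Rle_lt_trans; [apply Cmod_triangle|].
        rewrite !Cmod_mult, Cmod_cis, !Cmod_R.
        rewrite (Rabs_pos_eq ((1 - s) * e + s * rho)) by (left; apply M1, Hs).
        rewrite Rabs_pos_eq by lra.
        destruct (Req_dec s 1) as [->|]; [lra|]. nra.
      (* Meeting [a] would give [(1 - s) e + s rho = s |a|], impossible because [rho > |a|] and
         [e > 0]. *)
      + intros E. assert (E2 : (RtoC ((1 - s) * e + s * rho) * cis t = RtoC s * a)%C).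
        { unfold G in E. rewrite RtoC_minus in E.
          replace (RtoC s * a)%C with (a - (1 - s) * a)%C by ring.
          rewrite <- E at 1. ring. }
        apply (f_equal Cmod) in E2.
        rewrite !Cmod_mult, Cmod_cis, !Cmod_R in E2.
        rewrite (Rabs_pos_eq ((1 - s) * e + s * rho)) in E2 by (left; apply M1, Hs).
        rewrite Rabs_pos_eq in E2 by lra.
        destruct (Req_dec s 1) as [->|]; [lra|]. nra. }
  unfold boundary_integral in H.
  assert (E0 : CInt (fun s => F (G s 0) * Gs s 0)%C 0 1
             = CInt (fun s => F (G s (2 * PI)%R) * Gs s (2 * PI)%R)%C 0 1).
  { unfold G, Gs. rewrite cis_period. reflexivity. }
  rewrite E0 in H.
  assert (E1 : CInt (fun t => F (G 1 t) * Gt 1 t)%C 0 (2 * PI)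
             = CInt (fun t => F (G 0 t) * Gt 0 t)%C 0 (2 * PI)).
  { match type of H with (?x + ?y - ?x - ?z)%C = _ =>
      replace y with (z + (x + y - x - z))%C by ring; rewrite H; ring end. }
  unfold G, Gt in E1.
  replace (1 - 1) with 0 in E1 by ring. replace (1 - 0) with 1 in E1 by ring.
  rewrite !Rmult_0_l, !Rmult_1_l, Rplus_0_l, Rplus_0_r in E1.
  etransitivity; [|etransitivity; [exact E1|]];
    apply (f_equal (fun k => CInt k 0 (2 * PI))), functional_extensionality; intros t.
  - f_equal. f_equal. rewrite Cmult_0_l, Cplus_0_l. reflexivity.
  - f_equal. f_equal. rewrite Cmult_1_l. reflexivity.
Qed.

(** On a circle about 0, [dz = i z dt], so Cauchy's kernel becomes [z / (z - a)] and the factor [i]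
    drops out. On the small circle about [a] the kernel is 1, and continuity of [f] at [a] brings
    the mean value as close to [f a] as desired. *)
Lemma cauchy_formula (f : C -> C) (a : C) (rho : R) :
  analytic_on_disc f -> Cmod a < rho -> rho < 1 ->
  is_CInt (fun t => f (RtoC rho * cis t) * ((RtoC rho * cis t) / (RtoC rho * cis t - a)))%C
    0 (2 * PI) (RtoC (2 * PI) * f a)%C.
Proof.
  intros Hf Har Hr.
  pose proof (Cmod_ge_0 a) as Ha0. pose proof PI_RGT_0 as HPI.
  assert (Hne : forall t, (RtoC rho * cis t - a <> 0)%C).
  { intros t E. assert (E2 : (RtoC rho * cis t)%C = a).
    { replace a with (a + 0)%C by ring. rewrite <- E. ring. }
    apply (f_equal Cmod) in E2. rewrite Cmod_mult, Cmod_cis, Cmod_R, Rabs_pos_eq in E2; lra. }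
  assert (Hin : forall t, unit_disc (RtoC rho * cis t)%C).
  { intros t. unfold unit_disc. rewrite Cmod_mult, Cmod_cis, Cmod_R, Rabs_pos_eq; lra. }
  set (K := fun t => (f (RtoC rho * cis t) * ((RtoC rho * cis t) / (RtoC rho * cis t - a)))%C).
  assert (CK : cont_on K 0 (2 * PI)).
  { intros t _. unfold K.
    assert (continuous (fun t => RtoC rho * cis t)%C t)
      by (apply continuous_Cmult; [apply continuous_const | apply continuous_cis]).
    apply continuous_Cmult.
    - apply (continuous_comp (fun t => RtoC rho * cis t)%C f); [assumption|].
      destruct (Hf _ (Hin t)) as [l Hl]. exact (is_C_derive_continuous _ _ _ Hl).
    - apply continuous_Cdiv; [assumption | | apply Hne].
      apply continuous_Cminus; [assumption | apply continuous_const]. }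
  pose proof (CInt_correct K 0 (2 * PI) ltac:(lra) CK) as IK.
  set (I := CInt K 0 (2 * PI)) in *.
  replace (RtoC (2 * PI) * f a)%C with I; [exact IK|].
  apply Cminus_eq_0, Cmod_eq_0, Rle_antisym; [|apply Cmod_ge_0].
  apply le_epsilon. intros eps Heps. rewrite Rplus_0_l.
  assert (Ca : continuous f a).
  { destruct (Hf a) as [l Hl]; [unfold unit_disc; lra|].
    exact (is_C_derive_continuous _ _ _ Hl). }
  rewrite continuous_C_eps in Ca.
  destruct (Ca (eps / (2 * PI))) as (dl & Hdl & Hd); [apply Rdiv_lt_0_compat; lra|].
  (* The first bound keeps the circle where [f] is close to [f a], the second keeps it inside the
     disc. *)
  set (e := Rmin (dl / 2) ((1 - Cmod a) / 2)).
  assert (He : 0 < e) by (apply Rmin_pos; lra).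
  assert (He1 : e <= dl / 2) by apply Rmin_l.
  assert (He2 : e <= (1 - Cmod a) / 2) by apply Rmin_r.
  assert (HF : forall z, unit_disc z -> z <> a -> ex_derive (fun z => f z / (z - a))%C z).
  { intros z Hz Hza. destruct (Hf z Hz) as [l Hl]. eexists.
    apply is_C_derive_div; [exact Hl| |].
    - apply is_C_derive_minus; [apply is_C_derive_id | apply is_C_derive_const].
    - intros E. apply Hza, Cminus_eq_0, E. }
  pose proof (homotopy_of_circles (fun z => f z / (z - a))%C a rho e
                Har Hr He ltac:(lra) HF) as E. cbv beta in E.
  assert (E1 : CInt (fun t => f (RtoC rho * cis t) / (RtoC rho * cis t - a)
                 * (RtoC rho * (Ci * cis t)))%C 0 (2 * PI) = (Ci * I)%C).
  { apply is_CInt_unique. apply is_CInt_ext with (fun t => Ci * K t)%C; [lra| |].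
    - intros t _. unfold K. field. apply Hne.
    - apply is_CInt_scal. exact IK. }
  set (K2 := fun t => f (a + RtoC e * cis t)%C).
  assert (Hin2 : forall t, unit_disc (a + RtoC e * cis t)%C).
  { intros t. unfold unit_disc. eapply Rle_lt_trans; [apply Cmod_triangle|].
    rewrite Cmod_mult, Cmod_cis, Cmod_R, Rabs_pos_eq; lra. }
  assert (CK2 : cont_on K2 0 (2 * PI)).
  { intros t _. unfold K2. apply (continuous_comp (fun t => a + RtoC e * cis t)%C f).
    - apply continuous_Cplus; [apply continuous_const|].
      apply continuous_Cmult; [apply continuous_const | apply continuous_cis].
    - destruct (Hf _ (Hin2 t)) as [l Hl]. exact (is_C_derive_continuous _ _ _ Hl). }
  pose proof (CInt_correct K2 0 (2 * PI) ltac:(lra) CK2) as IK2.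
  set (I2 := CInt K2 0 (2 * PI)) in *.
  assert (E2 : CInt (fun t => f (a + RtoC e * cis t) / (a + RtoC e * cis t - a)
                 * (RtoC e * (Ci * cis t)))%C 0 (2 * PI) = (Ci * I2)%C).
  { apply is_CInt_unique. apply is_CInt_ext with (fun t => Ci * K2 t)%C; [lra| |].
    - intros t _. unfold K2. replace (a + RtoC e * cis t - a)%C with (RtoC e * cis t)%C by ring.
      field. split; [apply cis_neq_0|]. intros Z. apply RtoC_inj in Z. lra.
    - apply is_CInt_scal. exact IK2. }
  rewrite E1, E2 in E.
  assert (EI : I = I2).
  { replace I with (- Ci * (Ci * I))%C; [rewrite E|];
      rewrite Cmult_assoc; replace (- Ci * Ci)%C with (RtoC 1); try ring;
      unfold Ci, Cmult, Copp, RtoC; simpl; f_equal; ring. }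
  rewrite EI. replace eps with ((2 * PI - 0) * (eps / (2 * PI))) by (field; lra).
  apply is_CInt_bound with (fun t => K2 t - f a)%C; [lra| |].
  - intros t _. unfold K2. left. apply Hd.
    replace (a + RtoC e * cis t - a)%C with (RtoC e * cis t)%C by ring.
    rewrite Cmod_mult, Cmod_cis, Cmod_R, Rabs_pos_eq; lra.
  - apply is_CInt_minus; [exact IK2|].
    replace (RtoC (2 * PI)) with (RtoC (2 * PI - 0)) by (f_equal; ring).
    apply is_CInt_const.
Qed.

(** * Maximum principle and Schwarz's lemma *)

Lemma analytic_continuous (f : C -> C) (z : C) :
  analytic_on_disc f -> unit_disc z -> continuous f z.
Proof. intros Hf Hz. destruct (Hf z Hz) as [l Hl]. exact (is_C_derive_continuous _ _ _ Hl). Qed.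

Lemma analytic_derive (f : C -> C) (z : C) :
  analytic_on_disc f -> unit_disc z -> is_derive f z (C_derive f z).
Proof. intros Hf Hz. apply C_derive_correct; [exact z | exact (Hf z Hz)]. Qed.

Lemma circle_in_disc (rho t : R) : 0 <= rho < 1 -> unit_disc (RtoC rho * cis t)%C.
Proof.
  intros Hr. unfold unit_disc. rewrite Cmod_mult, Cmod_cis, Cmod_R, Rabs_pos_eq; lra.
Qed.

Lemma circle_dist (rho t : R) (a : C) :
  0 <= rho -> rho - Cmod a <= Cmod (RtoC rho * cis t - a).
Proof.
  intros Hr. pose proof (Cmod_triangle (RtoC rho * cis t - a) a) as H.
  replace (RtoC rho * cis t - a + a)%C with (RtoC rho * cis t)%C in H by ring.
  rewrite (Cmod_mult rho), Cmod_cis, Cmod_R, Rabs_pos_eq in H; lra.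
Qed.

Lemma continuous_circle (rho t : R) : continuous (fun t => RtoC rho * cis t)%C t.
Proof. apply continuous_Cmult; [apply continuous_const | apply continuous_cis]. Qed.

Lemma continuous_on_circle (f : C -> C) (rho t : R) :
  analytic_on_disc f -> 0 <= rho < 1 -> continuous (fun t => f (RtoC rho * cis t)%C) t.
Proof.
  intros Hf Hr. apply (continuous_comp (fun t => RtoC rho * cis t)%C f).
  - apply continuous_circle.
  - apply analytic_continuous; [exact Hf | apply circle_in_disc, Hr].
Qed.

Lemma Cpow_derive (f : C -> C) (z l : C) (n : nat) :
  is_derive f z l -> ex_derive (fun x => f x ^ n)%C z.
Proof.
  intros Hf. induction n as [|n [m IH]]; simpl.
  - eexists. apply is_C_derive_const.
  - eexists. apply is_C_derive_mult; [exact Hf | exact IH].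
Qed.

(** Landau's device: Cauchy's formula for [f^n] gives [|f a|^n <= M^n K] with [K] independent of
    [n], and the powers outgrow [K] unless [|f a| <= M]. *)
Lemma maximum_principle (f : C -> C) (a : C) (rho M : R) :
  analytic_on_disc f -> Cmod a < rho -> rho < 1 ->
  (forall t, 0 <= t <= 2 * PI -> Cmod (f (RtoC rho * cis t)%C) <= M) -> Cmod (f a) <= M.
Proof.
  intros Hf Ha Hr HM.
  pose proof (Cmod_ge_0 a) as Ha0. pose proof PI_RGT_0 as HPI.
  assert (HM0 : 0 <= M) by (eapply Rle_trans; [apply Cmod_ge_0 | apply (HM 0); lra]).
  set (K := rho / (rho - Cmod a)).
  assert (Hn : forall n, Cmod (f a) ^ n <= M ^ n * K).
  { intros n.
    assert (Hfn : analytic_on_disc (fun x => f x ^ n)%C).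
    { intros z Hz. destruct (Hf z Hz) as [l Hl]. exact (Cpow_derive _ _ _ n Hl). }
    pose proof (cauchy_formula _ a rho Hfn Ha Hr) as H.
    apply is_CInt_bound with (M := M ^ n * K) in H; [|lra|].
    - rewrite Cmod_mult, Cmod_R, Rabs_pos_eq, Cmod_pow in H by lra.
      apply Rmult_le_reg_l with (2 * PI); [lra|]. rewrite Rminus_0_r in H. exact H.
    - intros t Ht. rewrite Cmod_mult, Cmod_pow.
      pose proof (circle_dist rho t a ltac:(lra)) as Hd.
      apply Rmult_le_compat.
      + apply pow_le, Cmod_ge_0.
      + apply Cmod_ge_0.
      + apply pow_incr. split; [apply Cmod_ge_0 | apply HM, Ht].
      + rewrite Cmod_div by (apply Cmod_gt_0; lra).
        rewrite Cmod_mult, Cmod_cis, Cmod_R, Rabs_pos_eq, Rmult_1_r by lra.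
        unfold K, Rdiv. apply Rmult_le_compat_l; [lra|].
        apply Rinv_le_contravar; lra. }
  apply Rnot_lt_le. intros Hlt.
  assert (HK : 0 <= K) by (unfold K; apply Rlt_le, Rdiv_lt_0_compat; lra).
  (* The growth argument divides by [M]; for [M = 0] the case [n = 1] settles the claim. *)
  destruct (Req_dec M 0) as [E|E].
  { specialize (Hn 1%nat). rewrite E in Hn. simpl in Hn. lra. }
  (* Here [1 + x] is the ratio [|f a| / M], and Bernoulli's inequality [poly] gives
     [(1 + x)^n >= 1 + n x > K] for a suitable [n]. *)
  set (x := Cmod (f a) / M - 1).
  assert (Hx : 0 < x).
  { unfold x. apply Rlt_0_minus. apply Rmult_lt_reg_r with M; [lra|].
    unfold Rdiv. rewrite Rmult_assoc, Rinv_l; lra. }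
  destruct (archimed_cor1 (x / (K + 1))) as (n & Hn1 & Hn2); [apply Rdiv_lt_0_compat; lra|].
  pose proof (poly n x Hx) as Hp.
  assert (HnR : 0 < INR n) by (apply lt_0_INR; exact Hn2).
  assert (K + 1 < INR n * x).
  { apply Rmult_lt_compat_l with (r := INR n * (K + 1)) in Hn1; [|nra].
    replace (INR n * (K + 1) * / INR n) with (K + 1) in Hn1 by (field; lra).
    replace (INR n * (K + 1) * (x / (K + 1))) with (INR n * x) in Hn1 by (field; lra).
    exact Hn1. }
  specialize (Hn n).
  replace (Cmod (f a)) with (M * (1 + x)) in Hn by (unfold x; field; exact E).
  rewrite Rpow_mult_distr in Hn.
  apply Rmult_le_reg_l in Hn; [lra | apply pow_lt; lra].
Qed.

(** * Differentiation of Cauchy integrals with respect to the point *)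

Lemma cont_on_bounded (f : R -> C) (a b : R) :
  a <= b -> cont_on f a b -> exists M, 0 <= M /\ forall t, a <= t <= b -> Cmod (f t) <= M.
Proof.
  intros Hab Hf.
  destruct (continuity_ab_maj (fun t => Cmod (f t)) a b Hab) as (m & Hm & Hm').
  - intros t Ht. apply continuity_pt_filterlim. apply continuous_Cmod, Hf, Ht.
  - exists (Cmod (f m)). split; [apply Cmod_ge_0 | exact Hm].
Qed.

(** A remainder bounded by [M |b - a|^2] uniformly in [t] integrates to at most [2 PI M |b - a|^2],
    so no limit theorem for integrals is involved. *)
Lemma parametric_integral_derive (k : R -> C -> C) (k' : R -> C) (K : C -> C)
  (a l : C) (r M : R) :
  0 < r -> 0 <= M ->
  (forall b, Cmod (b - a) < r -> is_CInt (fun t => k t b) 0 (2 * PI) (K b)) ->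
  is_CInt k' 0 (2 * PI) l ->
  (forall t b, 0 <= t <= 2 * PI -> Cmod (b - a) < r ->
     Cmod (k t b - k t a - k' t * (b - a)) <= M * Cmod (b - a) ^ 2) ->
  is_derive K a l.
Proof.
  intros Hr HM HK Hl Hb. pose proof PI_RGT_0 as HPI.
  apply is_C_derive_eps. intros eps Heps.
  assert (HMP : 0 < 2 * PI * M + 1) by nra.
  exists (Rmin r (eps / (2 * PI * M + 1))). split.
  { apply Rmin_pos; [exact Hr | apply Rdiv_lt_0_compat; lra]. }
  intros b Hba.
  assert (H1 : Cmod (b - a) < r) by (eapply Rlt_le_trans; [exact Hba | apply Rmin_l]).
  assert (H2 : Cmod (b - a) < eps / (2 * PI * M + 1))
    by (eapply Rlt_le_trans; [exact Hba | apply Rmin_r]).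
  apply Rle_trans with ((2 * PI - 0) * (M * Cmod (b - a) ^ 2)).
  - apply is_CInt_bound with (fun t => k t b - k t a - (b - a) * k' t)%C; [lra| |].
    + intros t Ht. rewrite (Cmult_comm (b - a)). apply Hb; assumption.
    + replace (K b - K a - l * (b - a))%C with (K b - K a - (b - a) * l)%C by ring.
      apply is_CInt_minus; [apply is_CInt_minus|].
      * apply HK, H1.
      * apply HK. replace (a - a)%C with (RtoC 0) by ring. rewrite Cmod_0. exact Hr.
      * apply is_CInt_scal, Hl.
  - pose proof (Cmod_ge_0 (b - a)) as H0.
    assert (H3 : (2 * PI * M + 1) * Cmod (b - a) <= eps).
    { apply Rlt_le. apply Rmult_lt_compat_l with (r := 2 * PI * M + 1) in H2; [|exact HMP].
      replace ((2 * PI * M + 1) * (eps / (2 * PI * M + 1))) with eps in H2 by (field; lra).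
      exact H2. }
    assert (H4 : 2 * PI * M * Cmod (b - a) <= eps) by lra.
    apply Rmult_le_compat_r with (r := Cmod (b - a)) in H4; [|exact H0].
    eapply Rle_trans; [|exact H4]. right. ring.
Qed.

(** [phi] is left free: up to [2 * PI], the values [f(z) z] on the circle represent [f] for [n = 1]
    and [f'] for [n = 2], whereas [f(z)] alone represents [f(b) / b] when [f(0) = 0]. *)
Definition cauchy_kernel (phi : R -> C) (rho : R) (n : nat) (b : C) (t : R) : C :=
  (phi t * (/ (RtoC rho * cis t - b)) ^ n)%C.

Lemma cauchy_kernel_cont (phi : R -> C) (rho : R) (n : nat) (b : C) :
  cont_on phi 0 (2 * PI) -> Cmod b < rho ->
  cont_on (cauchy_kernel phi rho n b) 0 (2 * PI).
Proof.
  intros Hphi Hb t Ht. unfold cauchy_kernel.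
  pose proof (Cmod_ge_0 b) as Hb0.
  apply continuous_Cmult; [apply Hphi, Ht|].
  assert (Hc : continuous (fun t => / (RtoC rho * cis t - b))%C t).
  { apply continuous_Cinv.
    - apply continuous_Cminus; [apply continuous_circle | apply continuous_const].
    - apply Cmod_gt_0. pose proof (circle_dist rho t b ltac:(lra)). lra. }
  induction n as [|n IH]; simpl; [apply continuous_const|].
  apply continuous_Cmult; assumption.
Qed.

(** Two exponents cover all uses: [n = 1] differentiates a function given by a Cauchy integral,
    [n = 2] its derivative. *)
Lemma cauchy_kernel_derive (phi : R -> C) (rho : R) (n : nat) (a : C) :
  cont_on phi 0 (2 * PI) -> Cmod a < rho -> (n = 1 \/ n = 2)%nat ->
  is_derive (fun b => CInt (cauchy_kernel phi rho n b) 0 (2 * PI)) a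
    (RtoC (INR n) * CInt (cauchy_kernel phi rho (S n) a) 0 (2 * PI))%C.
Proof.
  intros Hphi Ha Hn. pose proof PI_RGT_0 as HPI. pose proof (Cmod_ge_0 a) as Ha0.
  set (d := rho - Cmod a). assert (Hd : 0 < d) by (unfold d; lra).
  destruct (cont_on_bounded phi 0 (2 * PI) ltac:(lra) Hphi) as (M & HM0 & HM).
  assert (Hba : forall b, Cmod (b - a) < d / 2 -> Cmod b < Cmod a + d / 2).
  { intros b Hb. replace b with ((b - a) + a)%C by ring.
    eapply Rle_lt_trans; [apply Cmod_triangle|]. lra. }
  set (B := / d). assert (HB : 0 < B) by (apply Rinv_0_lt_compat, Hd).
  (* One constant for both exponents: with [u = z - a], [v = z - b], [|1/u| <= B] and
     [|1/v| <= 2 B], the remainders [1/(u^2 v)] and [1/(u^2 v^2) + 2/(u^3 v)] are at most [2 B^3]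
     and [8 B^4]. *)
  apply parametric_integral_derive
    with (k := fun t b => cauchy_kernel phi rho n b t)
         (k' := fun t => (RtoC (INR n) * cauchy_kernel phi rho (S n) a t)%C)
         (r := d / 2) (M := M * (2 * B ^ 3 + 8 * B ^ 4)).
  - lra.
  - apply Rmult_le_pos; [exact HM0|]. assert (0 < B ^ 3) by (apply pow_lt, HB).
    assert (0 < B ^ 4) by (apply pow_lt, HB). lra.
  - intros b Hb. apply CInt_correct; [lra|]. apply cauchy_kernel_cont; [exact Hphi|].
    specialize (Hba b Hb). unfold d in Hba. lra.
  - apply is_CInt_scal. apply CInt_correct; [lra|].
    apply cauchy_kernel_cont; [exact Hphi | exact Ha].
  - intros t b Ht Hb. unfold cauchy_kernel.
    pose proof (circle_dist rho t a ltac:(lra)) as D1. fold d in D1.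
    pose proof (circle_dist rho t b ltac:(lra)) as D2. specialize (Hba b Hb).
    assert (D3 : d / 2 <= Cmod (RtoC rho * cis t - b)) by (unfold d in *; lra).
    set (u := (RtoC rho * cis t - a)%C) in *. set (v := (RtoC rho * cis t - b)%C) in *.
    assert (Hu : u <> 0) by (apply Cmod_gt_0; lra).
    assert (Hv : v <> 0) by (apply Cmod_gt_0; lra).
    assert (Eh : (b - a)%C = (u - v)%C) by (unfold u, v; ring).
    rewrite Eh. set (h := (u - v)%C).
    assert (BU : Cmod (/ u) <= B).
    { rewrite Cmod_inv by exact Hu. apply Rinv_le_contravar; lra. }
    assert (BV : Cmod (/ v) <= 2 * B).
    { rewrite Cmod_inv by exact Hv. unfold B. replace (2 * / d) with (/ (d / 2)) by (field; lra).
      apply Rinv_le_contravar; lra. }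
    pose proof (Cmod_ge_0 (/ u)) as U0. pose proof (Cmod_ge_0 (/ v)) as V0.
    assert (Hmain : exists X : C,
      (phi t * (/ v) ^ n - phi t * (/ u) ^ n
        - RtoC (INR n) * (phi t * (/ u) ^ S n) * h)%C = (phi t * X * (h * h))%C
      /\ Cmod X <= 2 * B ^ 3 + 8 * B ^ 4).
    { assert (B3 : 0 < B ^ 3) by (apply pow_lt, HB).
      assert (B4 : 0 < B ^ 4) by (apply pow_lt, HB).
      destruct Hn as [-> | ->].
      - exists (/ u * / u * / v)%C. split.
        + simpl. unfold h. field. split; assumption.
        + rewrite !Cmod_mult.
          apply Rle_trans with (B * B * (2 * B)); [|nra].
          repeat apply Rmult_le_compat; try assumption; repeat apply Rmult_le_pos; assumption.
      - exists (/ u * / u * (/ v * / v) + RtoC 2 * (/ u * / u * / u * / v))%C. split.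
        + replace (RtoC (INR 2)) with (RtoC 2) by (f_equal; simpl; ring).
          simpl. unfold h. field. split; assumption.
        + eapply Rle_trans; [apply Cmod_triangle|]. rewrite !Cmod_mult, Cmod_R, Rabs_pos_eq by lra.
          apply Rle_trans with (B * B * (2 * B * (2 * B)) + 2 * (B * B * B * (2 * B))); [|nra].
          apply Rplus_le_compat; [|apply Rmult_le_compat_l; [lra|]];
          repeat apply Rmult_le_compat; try assumption; repeat apply Rmult_le_pos; assumption. }
    destruct Hmain as (X & EX & HX). rewrite EX, !Cmod_mult.
    replace (Cmod h ^ 2) with (Cmod h * Cmod h) by ring.
    apply Rmult_le_compat_r; [apply Rle_0_sqr|].
    apply Rmult_le_compat; try apply Cmod_ge_0; [apply HM, Ht | exact HX].
Qed.

Lemma RtoC_neq_0 (x : R) : x <> 0 -> RtoC x <> 0.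
Proof. intros H E. apply H, RtoC_inj, E. Qed.

Lemma two_PI_neq_0 : RtoC (2 * PI) <> 0.
Proof. apply RtoC_neq_0. pose proof PI_RGT_0. lra. Qed.

(** Schwarz's lemma will be applied to functions built from [f'] and [g']. The derivative is itself
    a Cauchy integral, with [n = 2], over a circle that leaves room around [a]. *)
Lemma analytic_C_derive (f : C -> C) :
  analytic_on_disc f -> analytic_on_disc (C_derive f).
Proof.
  intros Hf a Ha. unfold unit_disc in Ha. pose proof (Cmod_ge_0 a) as Ha0.
  pose proof PI_RGT_0 as HPI.
  set (rho := (1 + Cmod a) / 2).
  assert (Hr : Cmod a < rho < 1) by (unfold rho; lra).
  set (phi := fun t => (f (RtoC rho * cis t) * (RtoC rho * cis t))%C).
  assert (Hphi : cont_on phi 0 (2 * PI)).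
  { intros t _. apply continuous_Cmult; [|apply continuous_circle].
    apply continuous_on_circle; [exact Hf | lra]. }
  assert (E1 : forall b, Cmod b < rho ->
    f b = (/ RtoC (2 * PI) * CInt (cauchy_kernel phi rho 1 b) 0 (2 * PI))%C).
  { intros b Hb. pose proof (cauchy_formula f b rho Hf Hb (proj2 Hr)) as H.
    replace (CInt (cauchy_kernel phi rho 1 b) 0 (2 * PI)) with (RtoC (2 * PI) * f b)%C.
    - field. apply two_PI_neq_0.
    - symmetry. apply is_CInt_unique. eapply is_CInt_ext; [lra | | exact H].
      intros t _. unfold cauchy_kernel, phi. simpl. unfold Cdiv. ring. }
  assert (Near : forall b, Cmod b < rho -> forall y, Cmod (y - b) < rho - Cmod b -> Cmod y < rho).
  { intros b Hb y Hy. replace y with ((y - b) + b)%C by ring.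
    eapply Rle_lt_trans; [apply Cmod_triangle|]. lra. }
  assert (E2 : forall b, Cmod b < rho ->
    C_derive f b = (/ RtoC (2 * PI) * CInt (cauchy_kernel phi rho 2 b) 0 (2 * PI))%C).
  { intros b Hb. apply is_C_derive_unique.
    apply is_C_derive_ext_near with (r := rho - Cmod b)
      (f := fun b => (/ RtoC (2 * PI) * CInt (cauchy_kernel phi rho 1 b) 0 (2 * PI))%C);
      [lra | intros y Hy; symmetry; apply E1, (Near b Hb y Hy) |].
    pose proof (cauchy_kernel_derive phi rho 1 b Hphi Hb (or_introl eq_refl)) as H.
    eapply is_C_derive_eq.
    - apply is_C_derive_mult; [apply is_C_derive_const | exact H].
    - simpl. ring. }
  eexists. eapply is_C_derive_ext_near with (r := rho - Cmod a)
      (f := fun b => (/ RtoC (2 * PI) * CInt (cauchy_kernel phi rho 2 b) 0 (2 * PI))%C);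
    [unfold rho; lra | intros y Hy; symmetry; apply E2, (Near a (proj1 Hr) y Hy) |].
  apply is_C_derive_mult; [apply is_C_derive_const|].
  apply (cauchy_kernel_derive phi rho 2 a Hphi (proj1 Hr) (or_intror eq_refl)).
Qed.

(** The removable singularity at 0. Subtracting Cauchy's formulas at [b] and at 0, where
    [z / (z - b) - 1 = b / (z - b)], writes [f b] as [b] times a Cauchy integral [H b], which is
    differentiable at 0. *)
Lemma analytic_factor_zero (f : C -> C) :
  analytic_on_disc f -> f 0 = RtoC 0 ->
  exists h, analytic_on_disc h /\ h 0 = C_derive f 0 /\ forall z, f z = (z * h z)%C.
Proof.
  intros Hf H0. pose proof PI_RGT_0 as HPI.
  set (h := fun z => if excluded_middle_informative (z = RtoC 0)
                     then C_derive f 0 else (f z / z)%C).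
  assert (h0 : h 0 = C_derive f 0).
  { unfold h. destruct (excluded_middle_informative _) as [_|n]; [reflexivity|].
    exfalso; apply n; reflexivity. }
  assert (hn : forall z, z <> RtoC 0 -> h z = (f z / z)%C).
  { intros z Hz. unfold h. destruct (excluded_middle_informative _) as [e|_]; [|reflexivity].
    exfalso; apply Hz, e. }
  exists h. split; [|split; [exact h0|]].
  - intros a Ha. destruct (classic (a = RtoC 0)) as [->|Hz].
    + set (rho := 1 / 2).
      assert (Hr : 0 < rho < 1) by (unfold rho; lra).
      set (phi := fun t => f (RtoC rho * cis t)%C).
      assert (Hphi : cont_on phi 0 (2 * PI)).
      { intros t _. apply continuous_on_circle; [exact Hf | lra]. }
      set (H := fun b => (/ RtoC (2 * PI) * CInt (cauchy_kernel phi rho 1 b) 0 (2 * PI))%C).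
      assert (EH : forall b, Cmod b < rho -> f b = (b * H b)%C).
      { intros b Hb.
        pose proof (cauchy_formula f b rho Hf Hb (proj2 Hr)) as I1.
        pose proof (cauchy_formula f 0 rho Hf ltac:(rewrite Cmod_0; lra) (proj2 Hr)) as I0.
        pose proof (is_CInt_minus _ _ _ _ _ _ I1 I0) as I.
        assert (E : (b * CInt (cauchy_kernel phi rho 1 b) 0 (2 * PI)
                     = RtoC (2 * PI) * f b - RtoC (2 * PI) * f 0)%C).
        { assert (J : is_CInt (fun t => b * cauchy_kernel phi rho 1 b t)%C 0 (2 * PI)
                        (b * CInt (cauchy_kernel phi rho 1 b) 0 (2 * PI))%C).
          { apply is_CInt_scal. apply CInt_correct; [lra|].
            apply cauchy_kernel_cont; assumption. }
          rewrite <- (is_CInt_unique _ _ _ _ J). apply is_CInt_unique.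
          eapply is_CInt_ext; [lra | | exact I].
          intros t _. unfold cauchy_kernel, phi. simpl.
          pose proof (circle_dist rho t b ltac:(lra)) as D1.
          pose proof (circle_dist rho t 0 ltac:(lra)) as D0. rewrite Cmod_0 in D0.
          assert (N1 : (RtoC rho * cis t - b <> 0)%C) by (apply Cmod_gt_0; lra).
          assert (N0 : (RtoC rho * cis t - 0 <> 0)%C) by (apply Cmod_gt_0; lra).
          set (x := (RtoC rho * cis t)%C) in *. clearbody x. field. split; [exact N1|].
          intros Z. apply N0. rewrite Z. ring. }
        unfold H. rewrite H0 in E.
        replace (b * (/ RtoC (2 * PI) * CInt (cauchy_kernel phi rho 1 b) 0 (2 * PI)))%C
          with (/ RtoC (2 * PI) * (b * CInt (cauchy_kernel phi rho 1 b) 0 (2 * PI)))%C by ring.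
        rewrite E. field. apply two_PI_neq_0. }
      assert (DH : exists l, is_derive H (RtoC 0) l).
      { eexists. apply is_C_derive_mult; [apply is_C_derive_const|].
        apply (cauchy_kernel_derive phi rho 1 0 Hphi ltac:(rewrite Cmod_0; lra)
                 (or_introl eq_refl)). }
      destruct DH as [l Hl]. exists l.
      assert (H00 : H 0 = C_derive f 0).
      { symmetry. apply is_C_derive_unique.
        eapply is_C_derive_ext_near with (f := fun b => (b * H b)%C) (r := rho); [lra| |].
        - intros y Hy. symmetry. apply EH. replace (y - 0)%C with y in Hy by ring. exact Hy.
        - eapply is_C_derive_eq; [apply is_C_derive_mult; [apply is_C_derive_id | exact Hl]|].
          cbv beta; as_C_eq; ring. }
      eapply is_C_derive_ext_near with (f := H) (r := rho); [lra| |exact Hl].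
      intros y Hy. replace (y - 0)%C with y in Hy by ring.
      destruct (classic (y = RtoC 0)) as [->|Hy0].
      * rewrite h0. exact H00.
      * rewrite hn by exact Hy0. rewrite EH by exact Hy. field. exact Hy0.
    + destruct (Hf a Ha) as [l Hl]. eexists.
      eapply is_C_derive_ext_near with (f := fun z => (f z / z)%C) (r := Cmod a).
      * apply Cmod_gt_0, Hz.
      * intros y Hy. symmetry. apply hn. intros ->.
        replace (0 - a)%C with (- a)%C in Hy by ring. rewrite Cmod_opp in Hy. lra.
      * apply is_C_derive_div; [exact Hl | apply is_C_derive_id | exact Hz].
  - intros z. destruct (classic (z = RtoC 0)) as [->|Hz].
    + rewrite H0. ring.
    + rewrite hn by exact Hz. field. exact Hz.
Qed.

(** The maximum principle on the circle of radius [rho] bounds [w(z) / z] by [1 / rho]; then [rho]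
    tends to 1. *)
Lemma schwarz (w : C -> C) :
  analytic_on_disc w -> w 0 = RtoC 0 -> (forall z, unit_disc z -> Cmod (w z) <= 1) ->
  forall z, unit_disc z -> Cmod (w z) <= Cmod z.
Proof.
  intros Hw H0 Hb z Hz.
  destruct (analytic_factor_zero w Hw H0) as (h & Hh & _ & E).
  unfold unit_disc in Hz. pose proof (Cmod_ge_0 z) as Hz0.
  assert (Hr : forall rho, Cmod z < rho < 1 -> rho * Cmod (h z) <= 1).
  { intros rho Hr. assert (B : Cmod (h z) <= / rho).
    { apply (maximum_principle h z rho); [exact Hh | lra | lra |].
      intros t _. pose proof (Hb _ (circle_in_disc rho t ltac:(lra))) as B.
      rewrite E, !Cmod_mult, Cmod_cis, Cmod_R, Rabs_pos_eq, Rmult_1_r in B by lra.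
      apply Rmult_le_reg_l with rho; [lra|]. rewrite Rinv_r by lra. exact B. }
    apply Rmult_le_compat_l with (r := rho) in B; [|lra]. rewrite Rinv_r in B by lra. exact B. }
  assert (Hh1 : Cmod (h z) <= 1).
  { apply Rnot_lt_le. intros Hlt.
    (* If [|h z| > 1], some radius below 1 exceeds both [|z|] and [1 / |h z|], against
       [rho |h z| <= 1]. *)
    set (m := Rmax (Cmod z) (/ Cmod (h z))).
    assert (Hi : / Cmod (h z) < 1) by (rewrite <- Rinv_1; apply Rinv_lt_contravar; lra).
    assert (Hm : m < 1) by (apply Rmax_lub_lt; lra).
    assert (H1 : Cmod z <= m) by apply Rmax_l.
    assert (H2 : / Cmod (h z) <= m) by apply Rmax_r.
    specialize (Hr ((m + 1) / 2) ltac:(lra)).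
    assert (H3 : / Cmod (h z) < (m + 1) / 2) by lra.
    apply Rmult_lt_compat_r with (r := Cmod (h z)) in H3; [|lra].
    rewrite Rinv_l in H3; lra. }
  rewrite E, Cmod_mult. pose proof (Cmod_ge_0 (h z)). nra.
Qed.

(** * Half-plane Schwarz lemma, open mapping *)

Lemma Cmod_sqr (z : C) : Cmod z ^ 2 = Re z ^ 2 + Im z ^ 2.
Proof. apply Cmod2_alt. Qed.

Lemma Cmod_le_sqr (x y : C) : Cmod x ^ 2 <= Cmod y ^ 2 -> Cmod x <= Cmod y.
Proof.
  intros H. apply Rsqr_incr_0; try apply Cmod_ge_0. unfold Rsqr. nra.
Qed.

Lemma half_plane_neq_0 (K A : C) : 0 < Re K -> 0 < Re A -> (K + Cconj A <> 0)%C.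
Proof.
  intros H1 H2 E. apply (f_equal Re) in E. destruct K, A; simpl in *. lra.
Qed.

(** The squares of the two sides differ by [4 Re K Re A]. *)
Lemma half_plane_contraction (K A : C) :
  0 <= Re K -> 0 <= Re A -> Cmod (K - A) <= Cmod (K + Cconj A).
Proof.
  intros H1 H2. apply Cmod_le_sqr. rewrite !Cmod_sqr. destruct K, A; simpl in *. nra.
Qed.

(** Schwarz's lemma for [(K - A) / (K + Cconj A)] with [A] the value of [K] at 0. The inequality is
    multiplied out because this denominator may vanish when [Re (K 0) = 0]. *)
Lemma half_plane_schwarz (K : C -> C) :
  analytic_on_disc K -> (forall z, unit_disc z -> 0 <= Re (K z)) ->
  forall z, unit_disc z -> Cmod (K z - K 0) <= Cmod z * Cmod (K z + Cconj (K 0)).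
Proof.
  intros HK Hp z Hz. apply le_epsilon. intros eps Heps.
  (* Shifting [K] by [eps / 2] makes [Re A] positive; the numerator is unchanged and the denominator
     moves by [eps] in all. *)
  set (A := (K 0 + RtoC (eps / 2))%C).
  assert (HA : 0 < Re A).
  { unfold A. specialize (Hp 0 unit_disc_0). destruct (K 0); simpl in *. lra. }
  assert (HX : forall y, unit_disc y -> 0 < Re (K y + RtoC (eps / 2))%C).
  { intros y Hy. specialize (Hp y Hy). destruct (K y); simpl in *. lra. }
  assert (Hne : forall y, unit_disc y -> (K y + RtoC (eps / 2) + Cconj A <> 0)%C)
    by (intros y Hy; apply half_plane_neq_0; [apply HX, Hy | exact HA]).
  assert (Hs : Cmod ((K z + RtoC (eps / 2) - A) / (K z + RtoC (eps / 2) + Cconj A)) <= Cmod z).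
  { apply (schwarz (fun y => (K y + RtoC (eps / 2) - A) / (K y + RtoC (eps / 2) + Cconj A))%C).
    - intros y Hy. destruct (HK y Hy) as [l Hl]. eexists.
      apply is_C_derive_div; [| |apply Hne, Hy].
      + apply is_C_derive_minus; [|apply is_C_derive_const].
        apply is_C_derive_plus; [exact Hl | apply is_C_derive_const].
      + apply is_C_derive_plus; [|apply is_C_derive_const].
        apply is_C_derive_plus; [exact Hl | apply is_C_derive_const].
    - unfold A. unfold Cdiv. ring.
    - intros y Hy. pose proof (Hne y Hy) as N. rewrite Cmod_div by exact N.
      apply Cmod_gt_0 in N. apply Rle_div_l; [exact N|]. rewrite Rmult_1_l.
      apply half_plane_contraction; [specialize (HX y Hy); lra | lra].
    - exact Hz. }
  pose proof (Hne z Hz) as N. rewrite Cmod_div in Hs by exact N.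
  apply Cmod_gt_0 in N. apply Rle_div_l in Hs; [|exact N].
  replace (K z + RtoC (eps / 2) - A)%C with (K z - K 0)%C in Hs by (unfold A; ring).
  eapply Rle_trans; [exact Hs|].
  assert (T : Cmod (K z + RtoC (eps / 2) + Cconj A) <= Cmod (K z + Cconj (K 0)) + eps).
  { replace (K z + RtoC (eps / 2) + Cconj A)%C with ((K z + Cconj (K 0)) + RtoC eps)%C.
    - eapply Rle_trans; [apply Cmod_triangle|]. rewrite Cmod_R, Rabs_pos_eq; lra.
    - unfold A. destruct (K z), (K 0). unfold Cconj, Cplus, RtoC; simpl. f_equal; field. }
  unfold unit_disc in Hz. pose proof (Cmod_ge_0 z).
  apply Rle_trans with (Cmod z * (Cmod (K z + Cconj (K 0)) + eps)).
  - apply Rmult_le_compat_l; assumption.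
  - nra.
Qed.

(** If a value [w] near [g z0] were omitted, [1 / (G - w)] would be analytic and, by the maximum
    principle, bounded at the centre by its maximum on the circle [|v| = 1/2]; but [|G - w|] is
    smaller at the centre. Injectivity keeps [G] away from [g z0] on that circle. *)
Lemma open_mapping (g : C -> C) (z0 : C) (eps : R) :
  analytic_on_disc g -> injective_on_disc g -> unit_disc z0 -> 0 < eps ->
  exists d, 0 < d /\ forall w, Cmod (w - g z0) < d ->
    exists u, unit_disc u /\ Cmod (u - z0) < eps /\ g u = w.
Proof.
  intros Hg Hi Hz Heps. pose proof PI_RGT_0 as HPI.
  unfold unit_disc in Hz.
  set (e := Rmin eps (1 - Cmod z0)).
  assert (He : 0 < e) by (apply Rmin_pos; lra).
  assert (He1 : e <= eps) by apply Rmin_l.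
  assert (He2 : e <= 1 - Cmod z0) by apply Rmin_r.
  assert (Hd : forall v, unit_disc v ->
    Cmod (z0 + RtoC e * v - z0) < e /\ unit_disc (z0 + RtoC e * v)%C).
  { intros v Hv. unfold unit_disc in *.
    assert (E : Cmod (RtoC e * v) < e).
    { rewrite Cmod_mult, Cmod_R, Rabs_pos_eq by lra.
      rewrite <- (Rmult_1_r e) at 2. apply Rmult_lt_compat_l; assumption. }
    split.
    - replace (z0 + RtoC e * v - z0)%C with (RtoC e * v)%C by ring. exact E.
    - eapply Rle_lt_trans; [apply Cmod_triangle|]. lra. }
  set (G := fun v => g (z0 + RtoC e * v)%C).
  assert (HG : analytic_on_disc G).
  { intros v Hv. destruct (Hg _ (proj2 (Hd v Hv))) as [l Hl]. eexists.
    apply (is_C_derive_comp g (fun v => z0 + RtoC e * v)%C); [exact Hl|].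
    apply is_C_derive_plus; [apply is_C_derive_const|].
    apply is_C_derive_mult; [apply is_C_derive_const | apply is_C_derive_id]. }
  assert (HG0 : G 0 = g z0) by (unfold G; f_equal; ring).
  set (D := fun t => Cmod (G (RtoC (1 / 2) * cis t)%C - g z0)).
  destruct (continuity_ab_min D 0 (2 * PI)) as (m & Hm & Hm'); [lra| |].
  { intros t _. apply continuity_pt_filterlim. apply continuous_Cmod, continuous_Cminus.
    - apply (continuous_on_circle G); [exact HG | lra].
    - apply continuous_const. }
  assert (HDm : 0 < D m).
  { apply Cmod_gt_0. intros E. apply Cminus_eq_0 in E.
    pose proof (circle_in_disc (1 / 2) m ltac:(lra)) as Hc.
    apply Hi in E; [| apply (Hd _ Hc) | exact Hz].
    assert (E2 : (RtoC e * (RtoC (1 / 2) * cis m) = 0)%C).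
    { replace (RtoC e * (RtoC (1 / 2) * cis m))%C
        with (z0 + RtoC e * (RtoC (1 / 2) * cis m) - z0)%C by ring.
      rewrite E. ring. }
    apply (f_equal Cmod) in E2. rewrite !Cmod_mult, Cmod_cis, !Cmod_R, Rabs_R0 in E2.
    rewrite !Rabs_pos_eq in E2 by lra. lra. }
  exists (D m / 2). split; [lra|].
  intros w Hw. apply NNPP. intros Hno.
  assert (Hne : forall v, unit_disc v -> (G v - w <> 0)%C).
  { intros v Hv E. apply Hno. exists (z0 + RtoC e * v)%C.
    destruct (Hd v Hv) as [A B]. split; [exact B|]. split; [lra|].
    apply Cminus_eq_0, E. }
  assert (Hinv : analytic_on_disc (fun v => / (G v - w))%C).
  { intros v Hv. destruct (HG v Hv) as [l Hl]. eexists.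
    apply is_C_derive_inv; [|apply Hne, Hv].
    apply is_C_derive_minus; [exact Hl | apply is_C_derive_const]. }
  assert (HM : Cmod (/ (G 0 - w)) <= / (D m / 2)).
  { apply (maximum_principle (fun v => / (G v - w))%C 0 (1 / 2)); [exact Hinv | | lra |].
    - rewrite Cmod_0. lra.
    - intros t Ht. pose proof (circle_in_disc (1 / 2) t ltac:(lra)) as Hc.
      rewrite Cmod_inv by (apply Hne, Hc). apply Rinv_le_contravar; [lra|].
      specialize (Hm t Ht). unfold D in Hm at 2.
      set (X := G (RtoC (1 / 2) * cis t)%C) in *.
      pose proof (Cmod_triangle (X - w) (w - g z0)) as T.
      replace (X - w + (w - g z0))%C with (X - g z0)%C in T by ring. lra. }
  assert (N0 : (G 0 - w <> 0)%C) by (apply Hne, unit_disc_0).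
  rewrite Cmod_inv in HM by exact N0. apply Cmod_gt_0 in N0.
  rewrite HG0 in *.
  replace (w - g z0)%C with (- (g z0 - w))%C in Hw by ring. rewrite Cmod_opp in Hw.
  apply Rinv_lt_contravar in Hw; [lra|]. apply Rmult_lt_0_compat; lra.
Qed.

(** [w] is the inverse of [g] applied to [F], picked pointwise by choice. Openness of [g] makes it
    continuous, and dividing the slope of [F] by that of [g] makes it differentiable. *)
Lemma inverse_composition (g F : C -> C) :
  analytic_on_disc g -> injective_on_disc g ->
  (forall z, unit_disc z -> C_derive g z <> 0) ->
  analytic_on_disc F -> (forall v, unit_disc v -> disc_image g (F v)) ->
  exists w, analytic_on_disc w /\ forall v, unit_disc v -> unit_disc (w v) /\ g (w v) = F v.
Proof.
  intros Hg Hi Hg' HF HFg.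
  set (w := fun v => epsilon (inhabits (RtoC 0)) (fun u => unit_disc u /\ g u = F v)).
  assert (Hw : forall v, unit_disc v -> unit_disc (w v) /\ g (w v) = F v).
  { intros v Hv. unfold w. apply epsilon_spec.
    destruct (HFg v Hv) as (u & Hu & E). exists u. split; [exact Hu | symmetry; exact E]. }
  exists w. split; [|exact Hw].
  intros v0 Hv0. destruct (Hw v0 Hv0) as [Hu0 E0].
  destruct (unit_disc_open v0 Hv0) as (r & Hr & Hrd).
  assert (Cw : continuous w v0).
  { apply continuous_C_eps. intros eps Heps.
    destruct (open_mapping g (w v0) eps Hg Hi Hu0 Heps) as (d & Hd & Hop).
    pose proof (analytic_continuous F v0 HF Hv0) as CF. rewrite continuous_C_eps in CF.
    destruct (CF d Hd) as (d2 & Hd2 & HC).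
    exists (Rmin r d2). split; [apply Rmin_pos; assumption|]. intros y Hy.
    assert (Hy1 : unit_disc y) by (apply Hrd; eapply Rlt_le_trans; [exact Hy | apply Rmin_l]).
    destruct (Hop (F y)) as (u & Hu1 & Hu2 & Hu3).
    - rewrite E0. apply HC. eapply Rlt_le_trans; [exact Hy | apply Rmin_r].
    - destruct (Hw y Hy1) as [Hy2 Hy3]. rewrite <- Hy3 in Hu3.
      apply Hi in Hu3; [|assumption|assumption]. rewrite <- Hu3. exact Hu2. }
  pose proof (analytic_derive g (w v0) Hg Hu0) as Dg.
  apply is_C_derive_slope in Dg. destruct Dg as (p & Cp & Ep & Hp).
  destruct (HF v0 Hv0) as [l Dl]. apply is_C_derive_slope in Dl.
  destruct Dl as (q & Cq & Eq & Hq).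
  assert (Np0 : p (w v0) <> 0) by (rewrite Ep; apply Hg', Hu0).
  exists (q v0 / p (w v0))%C.
  apply is_C_derive_ext_near with (f := fun v => (w v0 + q v / p (w v) * (v - v0))%C) (r := r);
    [exact Hr| |].
  - intros y Hy. specialize (Hrd y Hy). destruct (Hw y Hrd) as [Hy1 Hy2].
    assert (Npy : p (w y) <> 0).
    { intros E. pose proof (Hp (w y)) as H. rewrite E, Cmult_0_l in H.
      apply Cminus_eq_0 in H. apply Hi in H; [|assumption|assumption].
      rewrite H in E. contradiction. }
    pose proof (Hp (w y)) as H. rewrite Hy2, E0, (Hq y) in H.
    replace (q y / p (w y) * (y - v0))%C with (q y * (y - v0) / p (w y))%C by (field; exact Npy).
    rewrite H. field. exact Npy.
  - apply is_C_derive_slope. exists (fun v => q v / p (w v))%C.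
    split; [|split; [reflexivity|]].
    + apply continuous_Cdiv; [exact Cq | | exact Np0].
      apply (continuous_comp w p); assumption.
    + intros y. ring.
Qed.

(** * Convex maps *)

(** Stated without normalisation, so that the class is stable under composition with disc
    automorphisms. *)
Definition convex_map (g : C -> C) : Prop :=
  analytic_on_disc g /\ injective_on_disc g /\
  (forall z, unit_disc z -> C_derive g z <> 0) /\ convex_set (disc_image g).

Lemma unit_disc_mult (x z : C) : Cmod x <= 1 -> unit_disc z -> unit_disc (x * z)%C.
Proof.
  unfold unit_disc. intros Hx Hz. rewrite Cmod_mult.
  pose proof (Cmod_ge_0 x). pose proof (Cmod_ge_0 z). nra.
Qed.

Lemma Re_RtoC_mult (r : R) (z : C) : Re (RtoC r * z)%C = r * Re z.
Proof. destruct z; simpl. ring. Qed.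

(** The real part equals [(|z|^2 - |u|^2 + |z - u|^2) / 2]. *)
Lemma Re_conj_mult_sub (z u : C) : Cmod u <= Cmod z -> 0 <= Re (Cconj z * (z - u))%C.
Proof.
  intros H.
  assert (H2 : Cmod u ^ 2 <= Cmod z ^ 2) by (apply pow_incr; split; [apply Cmod_ge_0 | exact H]).
  rewrite !Cmod_sqr in H2. destruct z as [a b], u as [c d]; simpl in *.
  assert (0 <= (a - c) ^ 2) by apply pow2_ge_0.
  assert (0 <= (b - d) ^ 2) by apply pow2_ge_0. nra.
Qed.

(* The convex combination [(1 - tau) g(v) + tau g(x v)] is subordinate to [g]. *)
Lemma convex_map_subordination (g : C -> C) (x z : C) (tau : R) :
  convex_map g -> Cmod x <= 1 -> unit_disc z -> 0 <= tau <= 1 ->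
  exists u, unit_disc u /\ Cmod u <= Cmod z /\
    g u = (g z - RtoC tau * (g z - g (x * z)))%C.
Proof.
  intros (Hg & Hi & Hg' & Hc) Hx Hz Ht.
  set (F := fun v => (RtoC (1 - tau)%R * g v + RtoC tau * g (x * v))%C).
  assert (HF : analytic_on_disc F).
  { intros v Hv. destruct (Hg v Hv) as [l Hl].
    destruct (Hg _ (unit_disc_mult x v Hx Hv)) as [m Hm]. eexists.
    apply is_C_derive_plus; (apply is_C_derive_mult; [apply is_C_derive_const|]).
    - exact Hl.
    - apply (is_C_derive_comp g (fun v => x * v)%C); [exact Hm|].
      apply is_C_derive_mult; [apply is_C_derive_const | apply is_C_derive_id]. }
  destruct (inverse_composition g F Hg Hi Hg' HF) as (w & Hw & Hwv).
  { intros v Hv. apply Hc; [| | exact Ht].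
    - exists v. split; [exact Hv | reflexivity].
    - exists (x * v)%C. split; [apply unit_disc_mult; assumption | reflexivity]. }
  exists (w z). destruct (Hwv z Hz) as [H1 H2]. split; [exact H1|]. split.
  - apply schwarz; [exact Hw | | | exact Hz].
    + destruct (Hwv 0 unit_disc_0) as [H3 H4].
      apply Hi; [exact H3 | apply unit_disc_0|]. rewrite H4. unfold F.
      replace (x * 0)%C with (RtoC 0) by ring. rewrite RtoC_minus. ring.
    + intros y Hy. left. apply (Hwv y Hy).
  - rewrite H2. unfold F. rewrite RtoC_minus. ring.
Qed.

(** Subordination gives [u] with [|u| <= |z|] and [tau * D = p u * (z - u)], so [Cconj z * D / p u]
    has nonnegative real part; for small [tau], [u] is near [z] and the slope [p u] near [g' z].
    Multiplying by [Cconj z] instead of dividing by [z] keeps the sign and includes [z = 0]. *)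
Lemma convex_map_Re_nonneg (g : C -> C) (x z : C) :
  convex_map g -> Cmod x <= 1 -> unit_disc z ->
  0 <= Re (Cconj z * ((g z - g (x * z)) / C_derive g z))%C.
Proof.
  intros HG Hx Hz. pose proof HG as (Hg & Hi & Hg' & Hc).
  set (D := (g z - g (x * z))%C).
  destruct (classic (D = RtoC 0)) as [E|HD].
  { rewrite E. unfold Cdiv. rewrite Cmult_0_l, Cmult_0_r. simpl. lra. }
  pose proof (analytic_derive g z Hg Hz) as Dg.
  apply is_C_derive_slope in Dg. destruct Dg as (p & Cp & Ep & Hp).
  assert (Np : p z <> 0) by (rewrite Ep; apply Hg', Hz).
  rewrite <- Ep. apply Rnot_lt_le. intros Hneg.
  set (phi := fun u => (Cconj z * (D / p u))%C).
  assert (Cphi : continuous phi z).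
  { apply continuous_Cmult; [apply continuous_const|].
    apply continuous_Cdiv; [apply continuous_const | exact Cp | exact Np]. }
  rewrite continuous_C_eps in Cphi.
  destruct (Cphi (- Re (phi z)) ltac:(unfold phi; lra)) as (eta & Heta & Hphi).
  destruct (open_mapping g z eta Hg Hi Hz Heta) as (d & Hd & Hop).
  assert (HDp : 0 < Cmod D) by (apply Cmod_gt_0, HD).
  (* Small enough for [g z - tau * D] to have a preimage within [eta] of [z]; by injectivity this
     preimage is [u]. *)
  set (tau := Rmin 1 (d / (2 * Cmod D))).
  assert (Ht0 : 0 < tau) by (apply Rmin_pos; [lra | apply Rdiv_lt_0_compat; lra]).
  assert (Ht1 : tau <= 1) by apply Rmin_l.
  assert (Ht2 : tau * Cmod D < d).
  { apply Rle_lt_trans with (d / (2 * Cmod D) * Cmod D).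
    - apply Rmult_le_compat_r; [lra | apply Rmin_r].
    - replace (d / (2 * Cmod D) * Cmod D) with (d / 2) by (field; lra). lra. }
  destruct (convex_map_subordination g x z tau HG Hx Hz ltac:(lra)) as (u & Hu & Hu1 & Hu2).
  fold D in Hu2.
  assert (Hnear : Cmod (u - z) < eta).
  { destruct (Hop (g u)) as (u' & H1 & H2 & H3).
    - rewrite Hu2. replace (g z - RtoC tau * D - g z)%C with (- (RtoC tau * D))%C by ring.
      rewrite Cmod_opp, Cmod_mult, Cmod_R, Rabs_pos_eq; lra.
    - apply Hi in H3; [|assumption|assumption]. rewrite <- H3. exact H2. }
  specialize (Hphi u Hnear).
  pose proof (re_le_Cmod (phi u - phi z)) as HR.
  assert (HR2 : Re (phi u - phi z)%C = Re (phi u) - Re (phi z)) by reflexivity.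
  pose proof (Rle_abs (Re (phi u - phi z)%C)) as HR3.
  assert (Hu0 : Re (phi u) < 0) by lra.
  pose proof (Hp u) as E. rewrite Hu2 in E.
  assert (Npu : p u <> 0).
  { intros E0. rewrite E0, Cmult_0_l in E. apply HD.
    assert (E3 : (RtoC tau * D)%C = 0).
    { replace (RtoC tau * D)%C with (- (g z - RtoC tau * D - g z))%C by ring.
      rewrite E. ring. }
    replace D with (/ RtoC tau * (RtoC tau * D))%C.
    - rewrite E3. ring.
    - field. apply RtoC_neq_0. lra. }
  assert (E4 : (RtoC tau * phi u = Cconj z * (z - u))%C).
  { unfold phi. replace (z - u)%C with (RtoC tau * D / p u)%C; [field; exact Npu|].
    replace (RtoC tau * D)%C with (- (g z - RtoC tau * D - g z))%C by ring.
    rewrite E. field. exact Npu. }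
  apply (f_equal Re) in E4. rewrite Re_RtoC_mult in E4.
  pose proof (Re_conj_mult_sub z u Hu1). nra.
Qed.

Lemma continuous_positive_left (psi : R -> R) (a : R) :
  continuous psi a -> (forall x, a - 1 < x < a -> psi x <= 0) -> psi a <= 0.
Proof.
  intros Hc Hn. apply Rnot_lt_le. intros Hp.
  destruct (Hc (ball (psi a) (mkposreal _ Hp)) (locally_ball _ (mkposreal _ Hp))) as [d Hd].
  pose proof (cond_pos d) as Hd0.
  set (x := a - Rmin (d / 2) (1 / 2)).
  assert (H1 : 0 < Rmin (d / 2) (1 / 2)) by (apply Rmin_pos; lra).
  assert (H2 : Rmin (d / 2) (1 / 2) <= d / 2) by apply Rmin_l.
  assert (H3 : Rmin (d / 2) (1 / 2) <= 1 / 2) by apply Rmin_r.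
  specialize (Hd x). specialize (Hn x).
  assert (Hb : ball a d x).
  { change (Rabs (x - a) < d). apply Rabs_lt_between. unfold x. lra. }
  specialize (Hd Hb). change (Rabs (psi x - psi a) < psi a) in Hd.
  apply Rabs_lt_between in Hd. specialize (Hn ltac:(unfold x; lra)). lra.
Qed.

(* Julia's boundary lemma at [x = 1] for the function
   [K x = (g z - g (x z)) / (z g' z)], which has nonnegative real part and for which
   [K x / (1 - x)] tends to 1. *)
Lemma convex_map_log_derivative (g : C -> C) (z : C) :
  convex_map g -> unit_disc z -> z <> 0 ->
  Cmod ((g z - g 0) / (z * C_derive g z) - 1) <= 1.
Proof.
  intros HG Hz Hz0. pose proof HG as (Hg & Hi & Hg' & Hc).
  assert (Hm : 0 < Cmod z) by (apply Cmod_gt_0, Hz0).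
  pose proof (Hg' z Hz) as Nd.
  set (c := C_derive g z) in *.
  set (K := fun x => ((g z - g (x * z)) / (z * c))%C).
  assert (Nzc : (z * c <> 0)%C) by (apply Cmult_neq_0; assumption).
  assert (Hin : forall x, unit_disc x -> unit_disc (x * z)%C)
    by (intros x Hx; apply unit_disc_mult; [left; exact Hx | exact Hz]).
  assert (HK : analytic_on_disc K).
  { intros x Hx. destruct (Hg _ (Hin x Hx)) as [l Hl]. eexists.
    apply is_C_derive_div; [|apply is_C_derive_const | exact Nzc].
    apply is_C_derive_minus; [apply is_C_derive_const|].
    apply (is_C_derive_comp g (fun x => x * z)%C); [exact Hl|].
    apply is_C_derive_mult; [apply is_C_derive_id | apply is_C_derive_const]. }
  assert (HKre : forall x, unit_disc x -> 0 <= Re (K x)).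
  { intros x Hx. pose proof (convex_map_Re_nonneg g x z HG (Rlt_le _ _ Hx) Hz) as H.
    fold c in H.
    replace (K x) with (RtoC (/ Cmod z ^ 2) * (Cconj z * ((g z - g (x * z)) / c)))%C.
    - rewrite Re_RtoC_mult. apply Rmult_le_pos; [|exact H].
      left. apply Rinv_0_lt_compat, pow_lt, Hm.
    - rewrite RtoC_inv by (apply pow_nonzero; lra). rewrite RtoC_pow.
      rewrite <- RtoC_pow, Cmod2_conj. unfold K. field.
      repeat split; try assumption.
      intros E. apply Hz0. apply Cmod_eq_0. rewrite <- Cmod_conj, E. apply Cmod_0. }
  pose proof (half_plane_schwarz K HK HKre) as HS.
  assert (EK0 : K 0 = ((g z - g 0) / (z * c))%C).
  { unfold K. replace (0 * z)%C with (RtoC 0) by ring. reflexivity. }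
  rewrite <- EK0.
  pose proof (analytic_derive g z Hg Hz) as Dg.
  apply is_C_derive_slope in Dg. destruct Dg as (p & Cp & Ep & Hp). fold c in Ep.
  (* The zero of [K] at [x = 1] is divided out: [K x = (1 - x) * q x], with [q 1 = 1] because the
     slope [p] takes the value [c] at [z]. *)
  set (q := fun x : R => (p (RtoC x * z) / c)%C).
  assert (EK : forall x : R, K (RtoC x) = (RtoC (1 - x) * q x)%C).
  { intros x. unfold K, q.
    replace (g z - g (RtoC x * z))%C with (- (g (RtoC x * z) - g z))%C by ring.
    rewrite Hp, RtoC_minus. field. split; assumption. }
  set (A := K 0) in *.
  (* Squaring [|K - A| <= x |K + Cconj A|] and using [|K - A|^2 = |K + Cconj A|^2 - 4 Re K Re A]
     leaves a common factor [1 - x]; cancelling it gives [psi x <= 0]. At [x = 1] this reads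
     [2 |A|^2 - 4 Re A <= 0], that is, [|A - 1| <= 1]. *)
  set (psi := fun x : R => (1 + x) * Cmod (RtoC (1 - x) * q x + Cconj A) ^ 2
                           - 4 * Re (q x) * Re A).
  assert (Cq : continuous q 1).
  { apply continuous_Cdiv; [| apply continuous_const | exact Nd].
    apply (continuous_comp (fun x : R => RtoC x * z)%C p).
    - apply continuous_Cmult; [|apply continuous_const].
      apply continuous_RtoC. apply continuous_id.
    - replace (RtoC 1 * z)%C with z by ring. exact Cp. }
  assert (Cpsi : continuous psi 1).
  { unfold psi. apply (continuous_minus (K := R_AbsRing) (V := R_NormedModule)).
    - apply continuous_Rmult.
      + apply continuous_Rplus; [apply continuous_const | apply continuous_id].
      + assert (Ccm : continuous (fun x : R => Cmod (RtoC (1 - x) * q x + Cconj A)) 1).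
        { apply continuous_Cmod, continuous_Cplus; [|apply continuous_const].
          apply continuous_Cmult; [|exact Cq]. apply continuous_RtoC.
          apply (continuous_minus (K := R_AbsRing) (V := R_NormedModule));
            [apply continuous_const | apply continuous_id]. }
        simpl. repeat apply continuous_Rmult; try assumption. apply continuous_const.
    - apply continuous_Rmult; [apply continuous_Rmult|]; try apply continuous_const.
      apply continuous_C_fst, Cq. }
  assert (Hpsi : psi 1 <= 0).
  { apply continuous_positive_left; [exact Cpsi|]. intros x Hx.
    assert (Hx1 : unit_disc (RtoC x)) by (unfold unit_disc; rewrite Cmod_R, Rabs_pos_eq; lra).
    specialize (HS (RtoC x) Hx1). fold A in HS. rewrite Cmod_R, Rabs_pos_eq in HS by lra.
    assert (H2 : Cmod (K x - A) ^ 2 <= (x * Cmod (K x + Cconj A)) ^ 2)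
      by (apply pow_incr; split; [apply Cmod_ge_0 | exact HS]).
    rewrite Rpow_mult_distr in H2.
    assert (H3 : Cmod (K x - A) ^ 2 = Cmod (K x + Cconj A) ^ 2 - 4 * Re (K x) * Re A).
    { rewrite !Cmod_sqr. destruct (K x), A. simpl. ring. }
    rewrite H3 in H2. unfold psi. rewrite EK, Re_RtoC_mult in H2.
    set (Y := Cmod (RtoC (1 - x) * q x + Cconj A) ^ 2) in *.
    apply Rmult_le_reg_l with (1 - x); [lra|].
    replace ((1 - x) * ((1 + x) * Y - 4 * Re (q x) * Re A))
      with (Y - 4 * ((1 - x) * Re (q x)) * Re A - x ^ 2 * Y) by ring.
    rewrite Rmult_0_r. lra. }
  unfold psi in Hpsi.
  assert (Eq1 : q 1 = RtoC 1).
  { unfold q. replace (RtoC 1 * z)%C with z by ring. rewrite Ep. field. exact Nd. }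
  rewrite Eq1 in Hpsi. replace (1 - 1) with 0 in Hpsi by ring.
  replace (RtoC 0 * 1 + Cconj A)%C with (Cconj A) in Hpsi by ring.
  rewrite Cmod_conj in Hpsi. simpl (Re 1) in Hpsi.
  apply Rle_trans with (Cmod 1); [|rewrite Cmod_1; lra].
  apply Cmod_le_sqr. rewrite Cmod_sqr in Hpsi. rewrite !Cmod_sqr.
  clear - Hpsi. clearbody A. destruct A; simpl in *. nra.
Qed.

Lemma injective_zero_factor (g h : C -> C) :
  injective_on_disc g -> C_derive g 0 <> 0 -> h 0 = C_derive g 0 ->
  (forall z, g z - g 0 = z * h z)%C -> forall z, unit_disc z -> h z <> 0.
Proof.
  intros Hi Hd Hh0 Hh z Hz E. specialize (Hh z). rewrite E, Cmult_0_r in Hh.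
  apply Cminus_eq_0 in Hh. apply Hi in Hh; [|exact Hz | apply unit_disc_0].
  subst z. rewrite Hh0 in E. contradiction.
Qed.

Lemma analytic_difference_quotient (g : C -> C) :
  analytic_on_disc g ->
  exists h, analytic_on_disc h /\ h 0 = C_derive g 0 /\
    forall z, (g z - g 0 = z * h z)%C.
Proof.
  intros Hg.
  destruct (analytic_factor_zero (fun z => g z - g 0)%C) as (h & H1 & H2 & H3).
  - intros z Hz. destruct (Hg z Hz) as [l Hl]. eexists.
    apply is_C_derive_minus; [exact Hl | apply is_C_derive_const].
  - ring.
  - exists h. split; [exact H1|]. split; [|exact H3]. rewrite H2.
    apply is_C_derive_unique. eapply is_C_derive_eq.
    + apply is_C_derive_minus; [apply (analytic_derive g 0 Hg unit_disc_0)
                               | apply is_C_derive_const].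
    + as_C_eq; ring.
Qed.

(** Once the singularity at 0 is removed, [a] is analytic with [a 0 = 0] and [|a| <= 1]; Schwarz's
    lemma improves the bound to [|z|]. *)
Lemma convex_map_ratio (g : C -> C) :
  convex_map g ->
  exists a, analytic_on_disc a /\ forall z, unit_disc z -> Cmod (a z) <= Cmod z /\
    (g z - g 0 = z * C_derive g z * (1 + a z))%C.
Proof.
  intros HG. pose proof HG as (Hg & Hi & Hg' & Hc).
  destruct (analytic_difference_quotient g Hg) as (h & Hh & Hh0 & Eh).
  set (a := fun z => (h z / C_derive g z - 1)%C).
  assert (Ha : analytic_on_disc a).
  { intros z Hz. destruct (Hh z Hz) as [l Hl].
    destruct (analytic_C_derive g Hg z Hz) as [m Hm]. eexists.
    apply is_C_derive_minus; [|apply is_C_derive_const].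
    apply is_C_derive_div; [exact Hl | exact Hm | apply Hg', Hz]. }
  assert (Ha0 : a 0 = RtoC 0).
  { unfold a. rewrite Hh0. field. apply Hg', unit_disc_0. }
  exists a. split; [exact Ha|]. intros z Hz. split.
  - apply schwarz; [exact Ha | exact Ha0 | | exact Hz].
    intros y Hy. destruct (classic (y = RtoC 0)) as [->|Hy0].
    + rewrite Ha0, Cmod_0. lra.
    + replace (a y) with ((g y - g 0) / (y * C_derive g y) - 1)%C.
      * apply convex_map_log_derivative; assumption.
      * unfold a. rewrite Eh. field. split; [apply Hg', Hy | exact Hy0].
  - rewrite Eh. unfold a. field. apply Hg', Hz.
Qed.

(** * The derivative of a close-to-convex function *)

Definition disc_automorphism (a v : C) : C := ((v + a) / (1 + Cconj a * v))%C.

Lemma one_plus_neq_0 (x : C) : Cmod x < 1 -> (1 + x <> 0)%C.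
Proof.
  intros Hx E. assert (E2 : x = (- (1))%C).
  { replace x with ((1 + x) - 1)%C by ring. rewrite E. ring. }
  rewrite E2, Cmod_opp, Cmod_1 in Hx. lra.
Qed.

Lemma disc_automorphism_den (a v : C) :
  unit_disc a -> unit_disc v -> (1 + Cconj a * v <> 0)%C.
Proof.
  intros Ha Hv. apply one_plus_neq_0.
  apply unit_disc_mult; [rewrite Cmod_conj; left; exact Ha | exact Hv].
Qed.

Lemma disc_automorphism_in (a v : C) :
  unit_disc a -> unit_disc v -> unit_disc (disc_automorphism a v).
Proof.
  intros Ha Hv. pose proof (disc_automorphism_den a v Ha Hv) as N.
  unfold disc_automorphism, unit_disc. rewrite Cmod_div by exact N.
  apply Cmod_gt_0 in N. apply Rlt_div_l; [exact N|]. rewrite Rmult_1_l.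
  apply Rsqr_incrst_0; try apply Cmod_ge_0. unfold unit_disc in *.
  assert (H1 : Cmod a ^ 2 < 1) by (pose proof (Cmod_ge_0 a); nra).
  assert (H2 : Cmod v ^ 2 < 1) by (pose proof (Cmod_ge_0 v); nra).
  rewrite !Rsqr_pow2, !Cmod_sqr. rewrite Cmod_sqr in H1, H2.
  destruct a as [a1 a2], v as [v1 v2]; simpl in *.
  (* The squared moduli of denominator and numerator differ by exactly this product. *)
  assert (0 < (1 - (a1 * (a1 * 1) + a2 * (a2 * 1))) * (1 - (v1 * (v1 * 1) + v2 * (v2 * 1))))
    by (apply Rmult_lt_0_compat; lra).
  nra.
Qed.

Lemma disc_automorphism_opp (a v : C) :
  unit_disc a -> unit_disc v -> disc_automorphism (- a) (disc_automorphism a v) = v.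
Proof.
  intros Ha Hv. pose proof (disc_automorphism_den a v Ha Hv) as N.
  pose proof (disc_automorphism_den a (- a) Ha) as N2.
  unfold unit_disc in N2. rewrite Cmod_opp in N2. specialize (N2 Ha).
  unfold disc_automorphism. rewrite Copp_conj. field.
  split; [exact N|]. intros E. apply N2. rewrite <- E. ring.
Qed.

Lemma disc_automorphism_derive (a v : C) :
  unit_disc a -> unit_disc v ->
  is_derive (disc_automorphism a) v
    ((1 - Cconj a * a) / ((1 + Cconj a * v) * (1 + Cconj a * v)))%C.
Proof.
  intros Ha Hv. pose proof (disc_automorphism_den a v Ha Hv) as N.
  eapply is_C_derive_eq.
  - apply is_C_derive_div; [| |exact N].
    + apply is_C_derive_plus; [apply is_C_derive_id | apply is_C_derive_const].
    + apply is_C_derive_plus; [apply is_C_derive_const|].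
      apply is_C_derive_mult; [apply is_C_derive_const | apply is_C_derive_id].
  - cbv beta. as_C_eq. field. exact N.
Qed.

Lemma one_minus_norm2 (a : C) : (1 - Cconj a * a)%C = RtoC (1 - Cmod a ^ 2).
Proof. rewrite RtoC_minus, Cmod2_conj. ring.
Qed.

Lemma convex_map_automorphism (g : C -> C) (a : C) :
  convex_map g -> unit_disc a -> convex_map (fun v => g (disc_automorphism a v)).
Proof.
  intros (Hg & Hi & Hg' & Hc) Ha.
  assert (Ha2 : unit_disc (- a)%C) by (unfold unit_disc; rewrite Cmod_opp; exact Ha).
  assert (Hd : forall v, unit_disc v ->
    is_derive (fun v => g (disc_automorphism a v)) v
      (C_derive g (disc_automorphism a v)
       * ((1 - Cconj a * a) / ((1 + Cconj a * v) * (1 + Cconj a * v))))%C).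
  { intros v Hv. apply is_C_derive_comp.
    - apply analytic_derive; [exact Hg | apply disc_automorphism_in; assumption].
    - apply disc_automorphism_derive; assumption. }
  split; [|split; [|split]].
  - intros v Hv. eexists. apply Hd, Hv.
  - intros v1 v2 H1 H2 E. apply Hi in E; try (apply disc_automorphism_in; assumption).
    rewrite <- (disc_automorphism_opp a v1), <- (disc_automorphism_opp a v2) by assumption.
    rewrite E. reflexivity.
  - intros v Hv. rewrite (is_C_derive_unique (fun v : C => g (disc_automorphism a v)) v _ (Hd v Hv)).
    pose proof (disc_automorphism_den a v Ha Hv) as N.
    apply Cmult_neq_0; [apply Hg', disc_automorphism_in; assumption|].
    rewrite one_minus_norm2. apply Cmult_neq_0.
    + apply RtoC_neq_0. unfold unit_disc in Ha. pose proof (Cmod_ge_0 a). nra.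
    + intros E. apply (Cmult_neq_0 _ _ N N).
      replace ((1 + Cconj a * v) * (1 + Cconj a * v))%C
        with (((1 + Cconj a * v) * (1 + Cconj a * v)) * ((1 + Cconj a * v) * (1 + Cconj a * v))
              * / ((1 + Cconj a * v) * (1 + Cconj a * v)))%C by (field; exact N).
      rewrite E. ring.
  - assert (Eq : forall w, disc_image g w <-> disc_image (fun v => g (disc_automorphism a v)) w).
    { intros w. split; intros (u & Hu & ->).
      - exists (disc_automorphism (- a) u). split; [apply disc_automorphism_in; assumption|].
        pose proof (disc_automorphism_opp (- a) u Ha2 Hu) as E.
        replace (- - a)%C with a in E by ring. rewrite E. reflexivity.
      - exists (disc_automorphism a u). split; [apply disc_automorphism_in; assumption | reflexivity]. }
    intros x y t Hx Hy Ht. apply Eq. apply Hc; try apply Eq; assumption.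
Qed.

(** With [u = 1 + a], the map [u -> (1 - r^2) / u] preserves the disc [|u - 1| <= r], because
    [1 - r^2] is the power of the origin with respect to its boundary circle. *)
Lemma disc_involution (a : C) (r : R) :
  0 <= r < 1 -> Cmod a <= r ->
  Cmod (RtoC (1 - r ^ 2) / (1 + a) - 1) <= r.
Proof.
  intros Hr Ha. assert (N : (1 + a <> 0)%C) by (apply one_plus_neq_0; lra).
  replace (RtoC (1 - r ^ 2) / (1 + a) - 1)%C with (- ((RtoC (r ^ 2) + a) / (1 + a)))%C
    by (rewrite RtoC_minus; field; exact N).
  rewrite Cmod_opp, Cmod_div by exact N. apply Cmod_gt_0 in N.
  apply Rle_div_l; [exact N|].
  rewrite <- (Rabs_pos_eq r) at 2 by lra. rewrite <- Cmod_R, <- Cmod_mult.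
  apply Cmod_le_sqr.
  assert (H : Cmod a ^ 2 <= r ^ 2) by (apply pow_incr; split; [apply Cmod_ge_0 | exact Ha]).
  rewrite !Cmod_sqr. rewrite Cmod_sqr in H. destruct a as [x y]; simpl in *.
  assert (0 <= (1 - r * r) * (r * (r * 1) - (x * (x * 1) + y * (y * 1)))).
  { apply Rmult_le_pos; nra. }
  nra.
Qed.

(** [g] composed with the automorphism has derivative [g'(0) / (1 - |z|^2)] at [- z], so the ratio
    there yields [z g'(0) / (g z - g 0) = (1 - |z|^2) / (1 + a(- z))], and [disc_involution]
    applies. As this [a] depends on [z], analyticity of [b] is read off the quotient by [h]
    instead. *)
Lemma convex_map_quotient (g : C -> C) :
  convex_map g ->
  exists b, analytic_on_disc b /\ forall z, unit_disc z -> Cmod (b z) <= Cmod z /\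
    ((g z - g 0) * (1 + b z) = z * C_derive g 0)%C.
Proof.
  intros HG. pose proof HG as (Hg & Hi & Hg' & Hc).
  destruct (analytic_difference_quotient g Hg) as (h & Hh & Hh0 & Eh).
  pose proof (Hg' 0 unit_disc_0) as N0.
  pose proof (injective_zero_factor g h Hi N0 Hh0 Eh) as Nh.
  exists (fun z => C_derive g 0 / h z - 1)%C. split.
  { intros z Hz. destruct (Hh z Hz) as [l Hl]. eexists.
    apply is_C_derive_minus; [|apply is_C_derive_const].
    apply is_C_derive_div; [apply is_C_derive_const | exact Hl | apply Nh, Hz]. }
  intros z Hz. split.
  - destruct (classic (z = RtoC 0)) as [->|Hz0].
    { rewrite Hh0. replace (C_derive g 0 / C_derive g 0 - 1)%C with (RtoC 0) by (field; exact N0).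
      lra. }
    destruct (convex_map_ratio _ (convex_map_automorphism g z HG Hz)) as (a & _ & Ha).
    assert (Hmz : unit_disc (- z)%C) by (unfold unit_disc; rewrite Cmod_opp; exact Hz).
    specialize (Ha (- z)%C Hmz). destruct Ha as [Ha E]. rewrite Cmod_opp in Ha.
    assert (E1 : disc_automorphism z (- z) = RtoC 0).
    { unfold disc_automorphism. replace (- z + z)%C with (RtoC 0) by ring. unfold Cdiv. ring. }
    assert (E2 : disc_automorphism z 0 = z).
    { unfold disc_automorphism. field. }
    assert (Hr : 0 <= Cmod z < 1) by (split; [apply Cmod_ge_0 | exact Hz]).
    assert (Nr : RtoC (1 - Cmod z ^ 2) <> 0) by (apply RtoC_neq_0; nra).
    assert (ED : C_derive (fun v => g (disc_automorphism z v)) (- z)%C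
                 = (C_derive g 0 / RtoC (1 - Cmod z ^ 2))%C).
    { apply is_C_derive_unique. eapply is_C_derive_eq.
      - apply is_C_derive_comp; [|apply disc_automorphism_derive; assumption].
        rewrite E1. apply analytic_derive; [exact Hg | apply unit_disc_0].
      - rewrite <- one_minus_norm2. rewrite <- one_minus_norm2 in Nr.
        replace (1 + Cconj z * - z)%C with (1 - Cconj z * z)%C by ring.
        as_C_eq. field. exact Nr. }
    cbv beta in E. rewrite ED, E1, E2 in E.
    assert (Na : (1 + a (- z)%C <> 0)%C) by (apply one_plus_neq_0; lra).
    assert (Ehz : h z = (C_derive g 0 / RtoC (1 - Cmod z ^ 2) * (1 + a (- z)%C))%C).
    { assert (E3 : (z * h z = z * (C_derive g 0 / RtoC (1 - Cmod z ^ 2) * (1 + a (- z)%C)))%C).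
      { rewrite <- Eh. replace (g z - g 0)%C with (- (g 0 - g z))%C by ring. rewrite E.
        field. exact Nr. }
      replace (h z) with (/ z * (z * h z))%C by (field; exact Hz0). rewrite E3.
      field. split; assumption. }
    rewrite Ehz.
    replace (C_derive g 0 / (C_derive g 0 / RtoC (1 - Cmod z ^ 2) * (1 + a (- z)%C)))%C
      with (RtoC (1 - Cmod z ^ 2) / (1 + a (- z)%C))%C.
    + apply disc_involution; assumption.
    + field. repeat split; assumption.
  - rewrite Eh. field. apply Nh, Hz.
Qed.

Lemma convex_map_derive_form (g : C -> C) :
  convex_map g -> normalized g ->
  exists a b, analytic_on_disc a /\ analytic_on_disc b /\
    forall z, unit_disc z -> Cmod (a z) <= Cmod z /\ Cmod (b z) <= Cmod z /\
      (C_derive g z * ((1 + a z) * (1 + b z)) = 1)%C.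
Proof.
  intros HG [H0 H1].
  destruct (convex_map_ratio g HG) as (a & Ha & Haz).
  destruct (convex_map_quotient g HG) as (b & Hb & Hbz).
  exists a, b. split; [exact Ha|]. split; [exact Hb|]. intros z Hz.
  destruct (Haz z Hz) as [A1 A2]. destruct (Hbz z Hz) as [B1 B2].
  split; [exact A1|]. split; [exact B1|].
  destruct (classic (z = RtoC 0)) as [->|Hz0].
  - rewrite Cmod_0 in A1, B1.
    rewrite (Cmod_eq_0 (a 0)) by (apply Rle_antisym; [exact A1 | apply Cmod_ge_0]).
    rewrite (Cmod_eq_0 (b 0)) by (apply Rle_antisym; [exact B1 | apply Cmod_ge_0]).
    rewrite H1. ring.
  - rewrite A2, H1 in B2.
    replace (C_derive g z * ((1 + a z) * (1 + b z)))%C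
      with (/ z * (z * C_derive g z * (1 + a z) * (1 + b z)))%C by (field; exact Hz0).
    rewrite B2. field. exact Hz0.
Qed.

Lemma Cexp_i (l : R) : Cexp (Ci * RtoC l)%C = cis l.
Proof.
  unfold Cexp, cis, Ci, RtoC, Cmult; simpl.
  replace (0 * l - 1 * 0) with 0 by ring. replace (0 * 0 + 1 * l) with l by ring.
  rewrite exp_0, !Rmult_1_l. reflexivity.
Qed.

Lemma cos_pos_of_Rabs (l : R) : Rabs l < PI / 2 -> 0 < cos l.
Proof. intros H. apply Rabs_lt_between in H. apply cos_gt_0; lra. Qed.

(** With [k0 = e^(i lambda)] and [B = (K - k0) / (K + Cconj k0)], solving for [K] gives [K / k0 = (1
    + (Cconj k0 / k0) B) / (1 - B)], and [|B| <= |z|] by the half-plane Schwarz lemma. The factors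
    with [a] and [b] come from [g']. *)
Lemma close_to_convex_derive_form (f : C -> C) :
  close_to_convex f ->
  exists s t a b, analytic_on_disc s /\ analytic_on_disc t /\
    analytic_on_disc a /\ analytic_on_disc b /\
    forall z, unit_disc z ->
      Cmod (s z) <= Cmod z /\ Cmod (t z) <= Cmod z /\
      Cmod (a z) <= Cmod z /\ Cmod (b z) <= Cmod z /\
      C_derive f z = ((1 + s z) / ((1 + t z) * ((1 + a z) * (1 + b z))))%C.
Proof.
  intros (Hf & [Hf0 Hf1] & g & l & (Hg & [Hg0 Hg1] & Hi & Hc) & Hl & Hp).
  pose proof (cos_pos_of_Rabs l Hl) as Hcos.
  (* Division by zero returns 0, so a zero of [g'] would contradict strict positivity. *)
  assert (Hg' : forall z, unit_disc z -> C_derive g z <> 0).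
  { intros z Hz E. specialize (Hp z Hz). rewrite E in Hp.
    replace (C_derive f z / 0)%C with (RtoC 0) in Hp.
    - rewrite Cmult_0_r in Hp. simpl in Hp. lra.
    - unfold Cdiv, Cinv, Cmult, RtoC; simpl. unfold Rdiv. f_equal; ring. }
  assert (HG : convex_map g) by (repeat split; assumption).
  destruct (convex_map_derive_form g HG (conj Hg0 Hg1)) as (a & b & Ha & Hb & Hab).
  rewrite Cexp_i in Hp. set (k0 := cis l) in *.
  set (K := fun z => (k0 * (C_derive f z / C_derive g z))%C).
  assert (Nk : k0 <> 0) by apply cis_neq_0.
  assert (HK : analytic_on_disc K).
  { intros z Hz. destruct (analytic_C_derive f Hf z Hz) as [x Hx].
    destruct (analytic_C_derive g Hg z Hz) as [y Hy]. eexists.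
    apply is_C_derive_mult; [apply is_C_derive_const|].
    apply is_C_derive_div; [exact Hx | exact Hy | apply Hg', Hz]. }
  assert (K0 : K 0 = k0) by (unfold K; rewrite Hf1, Hg1; field).
  assert (Rk : 0 < Re k0) by exact Hcos.
  pose proof (half_plane_schwarz K HK (fun z Hz => Rlt_le _ _ (Hp z Hz))) as HS.
  rewrite K0 in HS.
  assert (Nd : forall z, unit_disc z -> (K z + Cconj k0 <> 0)%C)
    by (intros z Hz; apply half_plane_neq_0; [apply Hp, Hz | exact Rk]).
  set (B := fun z => ((K z - k0) / (K z + Cconj k0))%C).
  assert (HB : analytic_on_disc B).
  { intros z Hz. destruct (HK z Hz) as [x Hx]. eexists.
    apply is_C_derive_div; [| |apply Nd, Hz].
    - apply is_C_derive_minus; [exact Hx | apply is_C_derive_const].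
    - apply is_C_derive_plus; [exact Hx | apply is_C_derive_const]. }
  assert (BB : forall z, unit_disc z -> Cmod (B z) <= Cmod z).
  { intros z Hz. unfold B. rewrite Cmod_div by (apply Nd, Hz).
    apply Rle_div_l; [apply Cmod_gt_0, Nd, Hz | apply HS, Hz]. }
  exists (fun z => Cconj k0 / k0 * B z)%C, (fun z => - B z)%C, a, b.
  split; [|split; [|split; [exact Ha | split; [exact Hb|]]]].
  - intros z Hz. destruct (HB z Hz) as [x Hx]. eexists.
    apply is_C_derive_mult; [apply is_C_derive_const | exact Hx].
  - intros z Hz. destruct (HB z Hz) as [x Hx]. eexists. apply is_C_derive_opp, Hx.
  - intros z Hz. destruct (Hab z Hz) as (A1 & A2 & A3).
    split; [|split; [|split; [exact A1 | split; [exact A2|]]]].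
    + rewrite Cmod_mult, Cmod_div, Cmod_conj by exact Nk.
      unfold k0. rewrite Cmod_cis. replace (1 / 1) with 1 by field. rewrite Rmult_1_l.
      apply BB, Hz.
    + rewrite Cmod_opp. apply BB, Hz.
    + pose proof (Hg' z Hz) as Ng. pose proof (Nd z Hz) as NK.
      assert (Nab : ((1 + a z) * (1 + b z) <> 0)%C).
      { intros E. rewrite E, Cmult_0_r in A3. apply RtoC_inj in A3. lra. }
      assert (Ef : C_derive f z = (K z / k0 * C_derive g z)%C).
      { unfold K. field. split; assumption. }
      assert (Eg : C_derive g z = (/ ((1 + a z) * (1 + b z)))%C).
      { replace (C_derive g z) with (C_derive g z * ((1 + a z) * (1 + b z))
          / ((1 + a z) * (1 + b z)))%C.
        - rewrite A3. unfold Cdiv. ring.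
        - unfold Cdiv. rewrite <- Cmult_assoc, Cinv_r by exact Nab. ring. }
      assert (Na : (1 + a z <> 0)%C) by (intros E; apply Nab; rewrite E; ring).
      assert (Nb : (1 + b z <> 0)%C) by (intros E; apply Nab; rewrite E; ring).
      assert (Nkk : (k0 + Cconj k0 <> 0)%C) by (apply half_plane_neq_0; assumption).
      rewrite Ef, Eg. unfold B. field.
      repeat split; try assumption.
      intros E. apply Nkk. rewrite <- E. ring.
Qed.

(** * Logarithmic coordinates *)

Lemma Cexp_plus (a b : C) : Cexp (a + b)%C = (Cexp a * Cexp b)%C.
Proof.
  destruct a, b. unfold Cexp, Cmult, Cplus; simpl. rewrite exp_plus, cos_plus, sin_plus. f_equal; ring.
Qed.

Lemma Cexp_0 : Cexp 0 = RtoC 1.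
Proof.
  unfold Cexp; simpl. rewrite exp_0, cos_0, sin_0. unfold RtoC. f_equal; ring.
Qed.

Lemma Cexp_neq_0 (a : C) : Cexp a <> 0.
Proof.
  intros E. pose proof (Cexp_plus a (- a)) as H. rewrite E in H.
  replace (a + - a)%C with (RtoC 0) in H by ring. rewrite Cexp_0 in H.
  rewrite Cmult_0_l in H. apply RtoC_inj in H. lra.
Qed.

Lemma Cexp_minus (a b : C) : Cexp (a - b)%C = (Cexp a / Cexp b)%C.
Proof.
  pose proof (Cexp_neq_0 b) as N.
  assert (E : Cexp a = (Cexp (a - b) * Cexp b)%C).
  { rewrite <- Cexp_plus. f_equal. ring. }
  rewrite E. field. exact N.
Qed.

Lemma Cexp_cis (a : C) : Cexp a = (RtoC (exp (Re a)) * cis (Im a))%C.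
Proof. unfold Cexp, cis. rewrite RtoC_scal_pair. reflexivity. Qed.

(** The principal branch on the right half-plane, where every [1 + t] with [|t| < 1] lies; elsewhere
    the value is not a logarithm of [u]. *)
Definition Clog (u : C) : C := (ln (Cmod u), atan (Im u / Re u)).

Lemma Cexp_Clog (u : C) : 0 < Re u -> Cexp (Clog u) = u.
Proof.
  intros Hu.
  assert (Hm : 0 < Cmod u).
  { apply Cmod_gt_0. intros E. rewrite E in Hu. simpl in Hu. lra. }
  set (p := atan (Im u / Re u)).
  assert (Hp : - (PI / 2) < p < PI / 2) by (pose proof (atan_bound (Im u / Re u)); unfold p; lra).
  assert (Hc : 0 < cos p) by (apply cos_gt_0; lra).
  assert (Ht : sin p * Re u = Im u * cos p).
  { assert (E : tan p = Im u / Re u) by apply tan_atan. unfold tan in E.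
    apply (f_equal (fun v => v * cos p * Re u)) in E.
    replace (sin p / cos p * cos p * Re u) with (sin p * Re u) in E by (field; lra).
    rewrite E. field. lra. }
  assert (Hs : sin p * sin p + cos p * cos p = 1) by exact (sin2_cos2 p).
  pose proof (Cmod_sqr u) as HM.
  assert (E1 : Cmod u * cos p = Re u).
  { apply Rsqr_inj; [apply Rmult_le_pos; lra | lra |]. unfold Rsqr.
    replace (Cmod u * cos p * (Cmod u * cos p)) with (Cmod u ^ 2 * (cos p * cos p)) by ring.
    rewrite HM.
    replace ((Re u ^ 2 + Im u ^ 2) * (cos p * cos p))
      with (Re u * Re u * (cos p * cos p) + (Im u * cos p) * (Im u * cos p)) by ring.
    rewrite <- Ht.
    replace (Re u * Re u * (cos p * cos p) + sin p * Re u * (sin p * Re u))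
      with (Re u * Re u * (sin p * sin p + cos p * cos p)) by ring.
    rewrite Hs. ring. }
  assert (E2 : Cmod u * sin p = Im u).
  { apply Rmult_eq_reg_r with (cos p); [|lra].
    rewrite <- Ht, <- E1. ring. }
  unfold Clog, Cexp. cbn [Re Im fst snd]. fold p.
  rewrite exp_ln by exact Hm. rewrite E1, E2. destruct u; reflexivity.
Qed.

Lemma Clog_Cexp (l : C) : Rabs (Im l) < PI / 2 -> Clog (Cexp l) = l.
Proof.
  intros H. apply Rabs_lt_between in H.
  assert (Hc : 0 < cos (Im l)) by (apply cos_gt_0; lra).
  unfold Clog. rewrite Cexp_cis, Cmod_mult, Cmod_cis, Cmod_R.
  pose proof (exp_pos (Re l)) as He.
  rewrite Rabs_pos_eq, Rmult_1_r, ln_exp by lra.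
  unfold cis. rewrite RtoC_scal_pair. cbn [Re Im fst snd].
  replace (exp (Re l) * sin (Im l) / (exp (Re l) * cos (Im l))) with (tan (Im l))
    by (unfold tan; field; lra).
  rewrite atan_tan by lra. destruct l; reflexivity.
Qed.

Lemma continuous_Clog {U : UniformSpace} (f : U -> C) (x : U) :
  continuous f x -> 0 < Re (f x) -> continuous (fun y => Clog (f y)) x.
Proof.
  intros Hf Hx.
  assert (Hm : 0 < Cmod (f x)).
  { apply Cmod_gt_0. intros E. rewrite E in Hx. simpl in Hx. lra. }
  apply continuous_C_pair; unfold Clog; cbn [fst snd].
  - apply (continuous_comp (fun y => Cmod (f y)) ln).
    + apply continuous_Cmod, Hf.
    + apply continuity_pt_filterlim. apply derivable_continuous_pt.
      exists (/ Cmod (f x)). apply derivable_pt_lim_ln, Hm.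
  - apply (continuous_comp (fun y => Im (f y) / Re (f y)) atan).
    + apply continuous_Rmult; [apply continuous_C_snd, Hf|].
      apply (continuous_comp (fun y => Re (f y)) Rinv); [apply continuous_C_fst, Hf|].
      apply continuous_Rinv. lra.
    + apply continuity_pt_filterlim. apply derivable_continuous_pt, derivable_pt_atan.
Qed.

Lemma Re_one_plus_pos (t : C) : Cmod t < 1 -> 0 < Re (1 + t)%C.
Proof.
  intros Ht. pose proof (re_le_Cmod t) as H. apply Rabs_le_between in H.
  destruct t; simpl in *. lra.
Qed.

Lemma Clog_1 : Clog 1 = RtoC 0.
Proof.
  rewrite <- Cexp_0. apply Clog_Cexp. simpl. rewrite Rabs_R0. pose proof PI_RGT_0. lra.
Qed.

Lemma Clog_arg_bound (u : C) : Rabs (Im (Clog u)) < PI / 2.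
Proof.
  unfold Clog. cbn [Im snd]. apply Rabs_lt_between.
  pose proof (atan_bound (Im u / Re u)). lra.
Qed.

(* In the coordinate [l = log u] the disc [|u - 1| <= r] becomes the convex set
   [exp (Re l) + (1 - r^2) exp (- Re l) <= 2 cos (Im l)]. *)
Lemma Cexp_disc (l : C) (r : R) :
  0 <= r ->
  Cmod (Cexp l - 1) <= r <->
  exp (Re l) + (1 - r ^ 2) * exp (- Re l) <= 2 * cos (Im l).
Proof.
  intros Hr. pose proof (exp_pos (Re l)) as He.
  assert (Ei : exp (Re l) * exp (- Re l) = 1)
    by (rewrite <- exp_plus, Rplus_opp_r; apply exp_0).
  set (e := exp (Re l)) in *. set (i := exp (- Re l)) in *.
  assert (Hs : sin (Im l) * sin (Im l) + cos (Im l) * cos (Im l) = 1)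
    by exact (sin2_cos2 (Im l)).
  assert (H2 : Cmod (Cexp l - 1) ^ 2 - r ^ 2 = e * (e + (1 - r ^ 2) * i - 2 * cos (Im l))).
  { rewrite Cmod_sqr. unfold Cexp. fold e.
    replace (e * (e + (1 - r ^ 2) * i - 2 * cos (Im l)))
      with (e * e * (sin (Im l) * sin (Im l) + cos (Im l) * cos (Im l))
            + (1 - r ^ 2) * (e * i) - 2 * e * cos (Im l)) by (rewrite Hs; ring).
    rewrite Ei. simpl. ring. }
  split.
  - intros H. assert (H3 : Cmod (Cexp l - 1) ^ 2 <= r ^ 2)
      by (apply pow_incr; split; [apply Cmod_ge_0 | exact H]).
    assert (H4 : e + (1 - r ^ 2) * i - 2 * cos (Im l) <= 0); [|lra].
    apply Rmult_le_reg_l with e; [exact He|]. rewrite Rmult_0_r. lra.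
  - intros H. apply Rsqr_incr_0; [| apply Cmod_ge_0 | exact Hr].
    rewrite !Rsqr_pow2.
    assert (H4 : e * (e + (1 - r ^ 2) * i - 2 * cos (Im l)) <= e * 0)
      by (apply Rmult_le_compat_l; lra).
    lra.
Qed.

(** Each exponential lies above its tangent line at the mean, and the linear terms cancel in the
    sum. *)
Lemma exp_mean3 (a b c : R) : 3 * exp ((a + b + c) / 3) <= exp a + exp b + exp c.
Proof.
  set (m := (a + b + c) / 3).
  assert (H : forall x, exp m * (1 + (x - m)) <= exp x).
  { intros x. replace (exp x) with (exp m * exp (x - m))
      by (rewrite <- exp_plus; f_equal; ring).
    apply Rmult_le_compat_l; [left; apply exp_pos | apply exp_ineq1_le]. }
  pose proof (H a). pose proof (H b). pose proof (H c).
  assert (E : exp m * (1 + (a - m)) + exp m * (1 + (b - m)) + exp m * (1 + (c - m))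
              = 3 * exp m) by (unfold m at 2 4 6; field).
  lra.
Qed.

Lemma cos_mean2 (a b : R) :
  Rabs a < PI / 2 -> Rabs b < PI / 2 -> cos a + cos b <= 2 * cos ((a + b) / 2).
Proof.
  intros Ha Hb. apply Rabs_lt_between in Ha. apply Rabs_lt_between in Hb.
  rewrite form1.
  assert (0 < cos ((a + b) / 2)) by (apply cos_gt_0; lra).
  pose proof (COS_bound ((a - b) / 2)). nra.
Qed.

(* Jensen for three points from two midpoint steps, adding the mean as a fourth point. *)
Lemma cos_mean3 (a b c : R) :
  Rabs a < PI / 2 -> Rabs b < PI / 2 -> Rabs c < PI / 2 ->
  cos a + cos b + cos c <= 3 * cos ((a + b + c) / 3).
Proof.
  intros Ha Hb Hc.
  set (m := (a + b + c) / 3).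
  assert (Hm : Rabs m < PI / 2).
  { apply Rabs_lt_between in Ha. apply Rabs_lt_between in Hb. apply Rabs_lt_between in Hc.
    apply Rabs_lt_between. unfold m. lra. }
  assert (Hab : Rabs ((a + b) / 2) < PI / 2).
  { apply Rabs_lt_between in Ha. apply Rabs_lt_between in Hb. apply Rabs_lt_between. lra. }
  assert (Hcm : Rabs ((c + m) / 2) < PI / 2).
  { apply Rabs_lt_between in Hc. apply Rabs_lt_between in Hm. apply Rabs_lt_between. lra. }
  pose proof (cos_mean2 a b Ha Hb). pose proof (cos_mean2 c m Hc Hm).
  pose proof (cos_mean2 _ _ Hab Hcm) as H4.
  replace (((a + b) / 2 + (c + m) / 2) / 2) with m in H4 by (unfold m; field). lra.
Qed.

Lemma disc_product_is_cube (t1 t2 t3 : C) (r : R) :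
  r < 1 -> Cmod t1 <= r -> Cmod t2 <= r -> Cmod t3 <= r ->
  exists t, Cmod t <= r /\ ((1 + t1) * ((1 + t2) * (1 + t3)) = (1 + t) ^ 3)%C.
Proof.
  intros Hr H1 H2 H3.
  assert (Hr0 : 0 <= r) by (eapply Rle_trans; [apply Cmod_ge_0 | exact H1]).
  assert (L : forall t, Cmod t <= r -> exists l, Rabs (Im l) < PI / 2 /\ Cexp l = (1 + t)%C /\
    exp (Re l) + (1 - r ^ 2) * exp (- Re l) <= 2 * cos (Im l)).
  { intros t Ht. exists (Clog (1 + t)). split; [apply Clog_arg_bound|].
    assert (E : Cexp (Clog (1 + t)) = (1 + t)%C) by (apply Cexp_Clog, Re_one_plus_pos; lra).
    split; [exact E|]. apply Cexp_disc; [exact Hr0|]. rewrite E.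
    replace (1 + t - 1)%C with t by ring. exact Ht. }
  destruct (L t1 H1) as (l1 & A1 & E1 & D1). destruct (L t2 H2) as (l2 & A2 & E2 & D2).
  destruct (L t3 H3) as (l3 & A3 & E3 & D3).
  (* The mean of the three logarithms stays in the region of [Cexp_disc]: both exponentials are
     convex, [1 - r^2 >= 0], and [cos] is concave on the arguments at hand. Its exponential is the
     cube root. *)
  set (m := ((Re l1 + Re l2 + Re l3) / 3, (Im l1 + Im l2 + Im l3) / 3) : C).
  exists (Cexp m - 1)%C. split.
  - apply Cexp_disc; [exact Hr0|]. unfold m. cbn [Re Im fst snd].
    pose proof (cos_mean3 _ _ _ A1 A2 A3).
    pose proof (exp_mean3 (Re l1) (Re l2) (Re l3)) as P.
    pose proof (exp_mean3 (- Re l1) (- Re l2) (- Re l3)) as Q.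
    replace ((- Re l1 + - Re l2 + - Re l3) / 3) with (- ((Re l1 + Re l2 + Re l3) / 3)) in Q
      by field.
    assert (Hq : 0 <= 1 - r ^ 2) by nra.
    apply Rmult_le_compat_l with (r := 1 - r ^ 2) in Q; [|exact Hq].
    unfold Re, Im in *. lra.
  - replace (1 + (Cexp m - 1))%C with (Cexp m) by ring.
    rewrite <- E1, <- E2, <- E3. simpl. rewrite Cmult_1_r, <- !Cexp_plus. f_equal.
    destruct l1, l2, l3. unfold m, Cplus; simpl. f_equal; field.
Qed.

Lemma close_to_convex_derive_neq_0 (f : C -> C) (z : C) :
  close_to_convex f -> unit_disc z -> C_derive f z <> 0.
Proof.
  intros (_ & _ & g & l & _ & _ & Hp) Hz E. specialize (Hp z Hz). rewrite E in Hp.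
  unfold Cdiv in Hp. rewrite Cmult_0_l, Cmult_0_r in Hp. simpl in Hp. lra.
Qed.

Lemma real_in_disc (r : R) : 0 <= r < 1 -> unit_disc (RtoC r).
Proof. intros H. unfold unit_disc. rewrite Cmod_R, Rabs_pos_eq; lra. Qed.

Lemma V_subset (r : R) (w : C) :
  0 <= r < 1 -> V r w ->
  exists s t : C, Cmod s <= r /\ Cmod t <= r /\ w = ((1 + s) / (1 + t) ^ 3)%C.
Proof.
  intros Hr (f & Hf & ->).
  destruct (close_to_convex_derive_form f Hf) as (s & t & a & b & _ & _ & _ & _ & H).
  pose proof (real_in_disc r Hr) as Hd.
  destruct (H (RtoC r) Hd) as (Hs & Ht & Ha & Hb & E).
  rewrite Cmod_R, Rabs_pos_eq in Hs, Ht, Ha, Hb by lra.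
  destruct (disc_product_is_cube _ _ _ r (proj2 Hr) Ht Ha Hb) as (t' & Ht' & E').
  exists (s (RtoC r)), t'. split; [exact Hs|]. split; [exact Ht'|].
  rewrite E, E'. reflexivity.
Qed.

(** * Extremal functions and the main theorem *)

(** The convex comparison function of the extremal maps: its image is a half-plane for [|y| = 1] and
    a disc for [|y| < 1]. *)
Definition half_plane_map (y z : C) : C := (z / (1 + y * z))%C.

Lemma half_plane_map_den (y z : C) : Cmod y <= 1 -> unit_disc z -> (1 + y * z <> 0)%C.
Proof. intros Hy Hz. apply one_plus_neq_0. apply unit_disc_mult; assumption. Qed.

Lemma half_plane_map_derive (y z : C) :
  Cmod y <= 1 -> unit_disc z ->
  is_derive (half_plane_map y) z (/ ((1 + y * z) * (1 + y * z)))%C.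
Proof.
  intros Hy Hz. pose proof (half_plane_map_den y z Hy Hz) as N.
  eapply is_C_derive_eq.
  - apply is_C_derive_div; [apply is_C_derive_id | | exact N].
    apply is_C_derive_plus; [apply is_C_derive_const|].
    apply is_C_derive_mult; [apply is_C_derive_const | apply is_C_derive_id].
  - cbv beta. as_C_eq. field. exact N.
Qed.

(** The inverse map is [w / (1 - y w)], and [1 - y w = 1 / (1 + y z)]. *)
Lemma half_plane_map_image (y w : C) :
  Cmod y <= 1 -> (disc_image (half_plane_map y) w <-> Cmod w < Cmod (1 - y * w)).
Proof.
  intros Hy. split.
  - intros (z & Hz & ->). pose proof (half_plane_map_den y z Hy Hz) as N.
    unfold half_plane_map.
    replace (1 - y * (z / (1 + y * z)))%C with (/ (1 + y * z))%C by (field; exact N).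
    unfold Cdiv. rewrite Cmod_mult.
    assert (0 < Cmod (/ (1 + y * z)))
      by (rewrite Cmod_inv by exact N; apply Rinv_0_lt_compat, Cmod_gt_0, N).
    unfold unit_disc in Hz. nra.
  - intros H. assert (N : (1 - y * w <> 0)%C).
    { apply Cmod_gt_0. eapply Rle_lt_trans; [apply Cmod_ge_0 | exact H]. }
    exists (w / (1 - y * w))%C. split.
    + unfold unit_disc. rewrite Cmod_div by exact N. apply Cmod_gt_0 in N.
      apply Rlt_div_l; [exact N|]. lra.
    + unfold half_plane_map. field. split; [exact N|].
      intros E. assert (E2 : RtoC 1 = 0) by (rewrite <- E; ring).
      apply RtoC_inj in E2. lra.
Qed.

Lemma half_plane_map_convex (y : C) : Cmod y <= 1 -> convex_function (half_plane_map y).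
Proof.
  intros Hy. split; [|split; [split|split]].
  - intros z Hz. eexists. apply half_plane_map_derive; assumption.
  - unfold half_plane_map, Cdiv. ring.
  - apply is_C_derive_unique. eapply is_C_derive_eq.
    + apply half_plane_map_derive; [exact Hy | apply unit_disc_0].
    + as_C_eq.
      rewrite !Cmult_0_r, Cplus_0_r. field.
  - intros z1 z2 H1 H2 E. unfold half_plane_map in E.
    pose proof (half_plane_map_den y z1 Hy H1) as N1.
    pose proof (half_plane_map_den y z2 Hy H2) as N2.
    apply (f_equal (fun u => u * ((1 + y * z1) * (1 + y * z2)))%C) in E.
    replace (z1 / (1 + y * z1) * ((1 + y * z1) * (1 + y * z2)))%C
      with (z1 * (1 + y * z2))%C in E by (field; exact N1).
    replace (z2 / (1 + y * z2) * ((1 + y * z1) * (1 + y * z2)))%C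
      with (z2 * (1 + y * z1))%C in E by (field; exact N2).
    apply Cminus_eq_0.
    replace (z1 - z2)%C with (z1 * (1 + y * z2) - z2 * (1 + y * z1))%C by ring.
    rewrite E. ring.
  (* Squared, the description of the image is a sublevel set of a quadratic with leading coefficient
     [1 - |y|^2 >= 0], hence convex. *)
  - assert (Sq : forall w, Cmod w < Cmod (1 - y * w) <->
      Cmod w ^ 2 * (1 - Cmod y ^ 2) + 2 * Re (y * w)%C - 1 < 0).
    { intros w.
      assert (E : Cmod w ^ 2 - Cmod (1 - y * w) ^ 2
                = Cmod w ^ 2 * (1 - Cmod y ^ 2) + 2 * Re (y * w)%C - 1).
      { rewrite !Cmod_sqr. destruct y, w. simpl. ring. }
      rewrite <- E. pose proof (Cmod_ge_0 w). pose proof (Cmod_ge_0 (1 - y * w)).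
      split; nra. }
    intros a b t Ha Hb Ht. apply half_plane_map_image in Ha; [|exact Hy].
    apply half_plane_map_image in Hb; [|exact Hy]. apply half_plane_map_image; [exact Hy|].
    apply Sq in Ha. apply Sq in Hb. apply Sq.
    assert (Hy2 : 0 <= 1 - Cmod y ^ 2) by (pose proof (Cmod_ge_0 y); nra).
    set (q := 1 - Cmod y ^ 2) in *.
    assert (E : Cmod ((1 - t)%R * a + t * b) ^ 2 * q + 2 * Re (y * ((1 - t)%R * a + t * b))%C - 1
      = (1 - t) * (Cmod a ^ 2 * q + 2 * Re (y * a)%C - 1)
        + t * (Cmod b ^ 2 * q + 2 * Re (y * b)%C - 1)
        - t * (1 - t) * q * Cmod (a - b) ^ 2).
    { rewrite !Cmod_sqr. clearbody q. destruct y, a, b. simpl. ring. }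
    rewrite E. pose proof (pow2_ge_0 (Cmod (a - b))).
    assert (0 <= t * (1 - t) * q * Cmod (a - b) ^ 2)
      by (apply Rmult_le_pos; [apply Rmult_le_pos; [apply Rmult_le_pos; lra|]|]; assumption).
    set (A := Cmod a ^ 2 * q + 2 * Re (y * a)%C - 1) in *.
    set (B := Cmod b ^ 2 * q + 2 * Re (y * b)%C - 1) in *.
    assert ((1 - t) * A <= (1 - t) * Rmax A B)
      by (apply Rmult_le_compat_l; [lra | apply Rmax_l]).
    assert (t * B <= t * Rmax A B) by (apply Rmult_le_compat_l; [lra | apply Rmax_r]).
    assert (Rmax A B < 0) by (apply Rmax_lub_lt; assumption).
    lra.
Qed.

(** The primitive of [(1 + x z) / (1 + y z)^3] vanishing at 0, in a closed form that also covers
    [x = y] and [y = 0]. *)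
Definition extremal_map (x y z : C) : C :=
  ((z + (x + y) / 2 * (z * z)) / ((1 + y * z) * (1 + y * z)))%C.

Lemma extremal_map_derive (x y z : C) :
  Cmod y <= 1 -> unit_disc z ->
  is_derive (extremal_map x y) z ((1 + x * z) / (1 + y * z) ^ 3)%C.
Proof.
  intros Hy Hz. pose proof (half_plane_map_den y z Hy Hz) as N.
  eapply is_C_derive_eq.
  - apply is_C_derive_div.
    + apply is_C_derive_plus; [apply is_C_derive_id|].
      apply is_C_derive_mult; [apply is_C_derive_const|].
      apply is_C_derive_mult; apply is_C_derive_id.
    + apply is_C_derive_mult; (apply is_C_derive_plus; [apply is_C_derive_const|];
      apply is_C_derive_mult; [apply is_C_derive_const | apply is_C_derive_id]).
    + apply Cmult_neq_0; exact N.
  - cbv beta. as_C_eq. simpl. field. exact N.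
Qed.

(* The real part equals
   [(1 - XY)(1 - RX)(1 - RY) + (XY - Re (conj x y))(1 - R^2)] plus a nonnegative term,
   where [X], [Y], [R] are the moduli of [x], [y], [z]. *)
Lemma half_plane_quotient_pos (x y z : C) :
  Cmod x <= 1 -> Cmod y <= 1 -> unit_disc z -> x <> y ->
  0 < Re ((1 - Cconj x * y) * ((1 + x * z) * Cconj (1 + y * z)))%C.
Proof.
  intros Hx Hy Hz Hxy. unfold unit_disc in Hz.
  set (W := (x * RtoC (1 - Cmod y ^ 2) + y * RtoC (1 - Cmod x ^ 2))%C).
  set (c := Re (Cconj x * y)%C).
  assert (E : Re ((1 - Cconj x * y) * ((1 + x * z) * Cconj (1 + y * z)))%C
    = (1 - c) + Cmod z ^ 2 * (c - Cmod x ^ 2 * Cmod y ^ 2) + Re (z * W)%C).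
  { unfold W, c. rewrite !Cmod_sqr. destruct x, y, z. simpl. ring. }
  rewrite E.
  pose proof (Cmod_ge_0 x) as X0. pose proof (Cmod_ge_0 y) as Y0. pose proof (Cmod_ge_0 z) as Z0.
  set (X := Cmod x) in *. set (Y := Cmod y) in *. set (r := Cmod z) in *.
  assert (HW : Cmod W <= X * (1 - Y ^ 2) + Y * (1 - X ^ 2)).
  { unfold W. eapply Rle_trans; [apply Cmod_triangle|]. rewrite !Cmod_mult, !Cmod_R.
    fold X Y. rewrite !Rabs_pos_eq by nra. lra. }
  assert (HzW : - (r * (X * (1 - Y ^ 2) + Y * (1 - X ^ 2))) <= Re (z * W)%C).
  { pose proof (re_le_Cmod (z * W)) as H. rewrite Cmod_mult in H. fold r in H.
    apply Rabs_le_between in H.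
    assert (r * Cmod W <= r * (X * (1 - Y ^ 2) + Y * (1 - X ^ 2)))
      by (apply Rmult_le_compat_l; assumption).
    lra. }
  assert (Hc : c <= X * Y).
  { unfold c. eapply Rle_trans; [apply Rle_abs|]. eapply Rle_trans; [apply re_le_Cmod|].
    rewrite Cmod_mult, Cmod_conj. unfold X, Y. lra. }
  assert (Hc1 : c < 1).
  { assert (Hd : 0 < Cmod (x - y) ^ 2).
    { apply pow_lt, Cmod_gt_0. intros Ed. apply Hxy, Cminus_eq_0, Ed. }
    assert (Ed : Cmod (x - y) ^ 2 = X ^ 2 + Y ^ 2 - 2 * c).
    { unfold X, Y, c. rewrite !Cmod_sqr. destruct x, y. simpl. ring. }
    assert (X ^ 2 <= 1) by nra. assert (Y ^ 2 <= 1) by nra. lra. }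
  assert (Hid : (1 - c) + r ^ 2 * (c - X ^ 2 * Y ^ 2) - r * (X * (1 - Y ^ 2) + Y * (1 - X ^ 2))
    = (1 - X * Y) * ((1 - r * X) * (1 - r * Y)) + (X * Y - c) * (1 - r ^ 2)) by ring.
  assert (A1 : 0 < (1 - r * X) * (1 - r * Y)) by (apply Rmult_lt_0_compat; nra).
  assert (A2 : 0 < 1 - r ^ 2) by nra.
  assert (A3 : 0 <= 1 - X * Y) by nra.
  (* If [X Y = 1] the first term vanishes and strictness comes from [c < 1]; otherwise it comes from
     the first term. *)
  destruct (Req_dec (X * Y) 1) as [E1|E1].
  - assert (0 < (X * Y - c) * (1 - r ^ 2)) by (apply Rmult_lt_0_compat; lra).
    rewrite E1 in *. lra.
  - assert (0 < (1 - X * Y) * ((1 - r * X) * (1 - r * Y))) by (apply Rmult_lt_0_compat; lra).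
    assert (0 <= (X * Y - c) * (1 - r ^ 2)) by (apply Rmult_le_pos; lra).
    lra.
Qed.

(** Against [half_plane_map y] the quotient of derivatives is [(1 + x z) / (1 + y z)]. The rotation
    is the argument of [k = 1 - Cconj x * y]: multiplying by [|k| |1 + y z|^2] turns the condition
    into [half_plane_quotient_pos]. *)
Lemma extremal_map_close_to_convex (x y : C) :
  Cmod x <= 1 -> Cmod y <= 1 -> close_to_convex (extremal_map x y).
Proof.
  intros Hx Hy. split; [|split; [split|]].
  - intros z Hz. eexists. apply extremal_map_derive; assumption.
  - unfold extremal_map, Cdiv. ring.
  - apply is_C_derive_unique. eapply is_C_derive_eq.
    + apply extremal_map_derive; [exact Hy | apply unit_disc_0].
    + as_C_eq. rewrite !Cmult_0_r, Cplus_0_r.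
      simpl. field.
  - exists (half_plane_map y).
    assert (Ep : forall z, unit_disc z ->
      (C_derive (extremal_map x y) z / C_derive (half_plane_map y) z
       = (1 + x * z) / (1 + y * z))%C).
    { intros z Hz. pose proof (half_plane_map_den y z Hy Hz) as N.
      rewrite (is_C_derive_unique _ _ _ (extremal_map_derive x y z Hy Hz)).
      rewrite (is_C_derive_unique _ _ _ (half_plane_map_derive y z Hy Hz)).
      simpl. field. exact N. }
    (* For [x = y] the quotient is 1 and [lambda = 0] serves, whereas [k] vanishes if [|x| = 1]. *)
    destruct (classic (x = y)) as [Exy|Hxy].
    + exists 0. split; [apply half_plane_map_convex, Hy|].
      split; [rewrite Rabs_R0; pose proof PI_RGT_0; lra|].
      intros z Hz. rewrite Ep by exact Hz. rewrite Cexp_i, <- Exy.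
      replace ((1 + x * z) / (1 + x * z))%C with (RtoC 1).
      * unfold cis. rewrite cos_0, sin_0. simpl. lra.
      * field. apply half_plane_map_den; assumption.
    + set (k := (1 - Cconj x * y)%C).
      (* The inequality at [z = 0] says [Re k > 0], so the argument of [k] is below [PI / 2] in
         modulus. *)
      assert (Hk : 0 < Re k).
      { pose proof (half_plane_quotient_pos x y 0 Hx Hy unit_disc_0 Hxy) as H.
        fold k in H. replace (k * ((1 + x * 0) * Cconj (1 + y * 0)))%C with k in H; [exact H|].
        rewrite !Cmult_0_r, Cplus_0_r. destruct k. unfold Cconj, Cmult, RtoC; simpl.
        f_equal; ring. }
      exists (Im (Clog k)). split; [apply half_plane_map_convex, Hy|].
      split; [apply Clog_arg_bound|].
      intros z Hz. rewrite Ep by exact Hz. rewrite Cexp_i.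
      pose proof (half_plane_map_den y z Hy Hz) as N.
      pose proof (half_plane_quotient_pos x y z Hx Hy Hz Hxy) as H. fold k in H.
      pose proof (Cexp_Clog k Hk) as Ek. rewrite Cexp_cis in Ek.
      pose proof (exp_pos (Re (Clog k))) as He. set (e := exp (Re (Clog k))) in *.
      set (u := cis (Im (Clog k))) in *. rewrite <- Ek in H.
      assert (Nc : Cconj (1 + y * z) <> 0).
      { intros E. apply N. apply Cmod_eq_0. rewrite <- Cmod_conj, E. apply Cmod_0. }
      assert (Hm : 0 < Cmod (1 + y * z) ^ 2) by (apply pow_lt, Cmod_gt_0, N).
      replace (RtoC e * u * ((1 + x * z) * Cconj (1 + y * z)))%C
        with (RtoC (e * Cmod (1 + y * z) ^ 2) * (u * ((1 + x * z) / (1 + y * z))))%C in H.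
      * rewrite Re_RtoC_mult in H.
        assert (0 < e * Cmod (1 + y * z) ^ 2) by (apply Rmult_lt_0_compat; assumption).
        apply Rmult_lt_reg_l with (e * Cmod (1 + y * z) ^ 2); [assumption|].
        rewrite Rmult_0_r. exact H.
      * rewrite RtoC_mult, Cmod2_conj. field. exact N.
Qed.

(** * Values attained by the extremal functions *)

Lemma Cmod_div_le_1 (s : C) (r : R) : 0 < r -> Cmod s <= r -> Cmod (s / RtoC r) <= 1.
Proof.
  intros Hr Hs. rewrite Cmod_div by (apply RtoC_neq_0; lra).
  rewrite Cmod_R, Rabs_pos_eq by lra. apply Rle_div_l; lra.
Qed.

(** The parameters [s / r] and [t / r] have modulus at most 1, and at the real point [r] they turn
    back into [s] and [t]. *)
Lemma V_superset (r : R) (s t : C) :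
  0 < r < 1 -> Cmod s <= r -> Cmod t <= r -> V r ((1 + s) / (1 + t) ^ 3)%C.
Proof.
  intros Hr Hs Ht.
  exists (extremal_map (s / RtoC r) (t / RtoC r)). split.
  - apply extremal_map_close_to_convex; apply Cmod_div_le_1; lra.
  - symmetry. apply is_C_derive_unique. eapply is_C_derive_eq.
    + apply extremal_map_derive; [apply Cmod_div_le_1; lra | apply real_in_disc; lra].
    + assert (N : RtoC r <> 0) by (apply RtoC_neq_0; lra).
      replace (s / RtoC r * RtoC r)%C with s by (field; exact N).
      replace (t / RtoC r * RtoC r)%C with t by (field; exact N). reflexivity.
Qed.

Lemma extremal_map_log (x y : C) :
  Cmod x <= 1 -> Cmod y <= 1 ->
  is_log_derive (extremal_map x y)
    (fun z => Clog (1 + x * z) - RtoC 3 * Clog (1 + y * z))%C.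
Proof.
  intros Hx Hy. split.
  - intros z Hz.
    assert (P : forall u, Cmod u <= 1 -> 0 < Re (1 + u * z)%C)
      by (intros u Hu; apply Re_one_plus_pos; apply unit_disc_mult; assumption).
    assert (Cu : forall u, continuous (fun z => 1 + u * z)%C z).
    { intros u. apply continuous_Cplus; [apply continuous_const|].
      apply continuous_Cmult; [apply continuous_const | apply continuous_id]. }
    split.
    + apply continuous_Cminus; [|apply continuous_Cmult; [apply continuous_const|]];
        apply continuous_Clog; auto.
    + rewrite (is_C_derive_unique _ _ _ (extremal_map_derive x y z Hy Hz)).
      rewrite Cexp_minus.
      replace (RtoC 3 * Clog (1 + y * z))%C
        with (Clog (1 + y * z) + (Clog (1 + y * z) + Clog (1 + y * z)))%C by ring.
      rewrite !Cexp_plus, !Cexp_Clog by auto. simpl. rewrite Cmult_1_r. reflexivity.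
  - rewrite !Cmult_0_r, Cplus_0_r, Clog_1. ring.
Qed.

Lemma LV_superset (w : C) : Rabs (Im w) < 2 * PI -> LV_1minus w.
Proof.
  intros Hw. apply Rabs_lt_between in Hw.
  (* [w = l1 - 3 * l2] with imaginary parts [p] and [- p]: [Im w] is shared equally among the four
     factors, each below [PI / 2]. *)
  set (p := Im w / 4).
  assert (Hp : Rabs p < PI / 2) by (apply Rabs_lt_between; unfold p; lra).
  assert (Hp2 : Rabs (- p) < PI / 2) by (rewrite Rabs_Ropp; exact Hp).
  assert (Hc : 0 < cos p) by (apply cos_pos_of_Rabs, Hp).
  assert (Hc1 : cos p <= 1) by apply COS_bound.
  pose proof (exp_pos (Re w)) as He.
  (* Scaling by [d] keeps both [|1 + t| = d] and [|1 + s| = exp (Re w) * d^3] below [2 cos p], since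
     [d + exp (Re w) * d = cos p] and [d^3 <= d]. *)
  set (d := cos p / (1 + exp (Re w))).
  assert (Hd : 0 < d) by (apply Rdiv_lt_0_compat; lra).
  assert (Ed : d + exp (Re w) * d = cos p) by (unfold d; field; lra).
  assert (Hed : 0 < exp (Re w) * d) by (apply Rmult_lt_0_compat; assumption).
  assert (Hd1 : d < 1) by lra.
  set (l1 := ((Re w + 3 * ln d)%R, p) : C).
  set (l2 := (ln d, - p) : C).
  (* The open disc [|u - 1| < 1] in logarithmic coordinates. *)
  assert (small : forall l : C, exp (Re l) < 2 * cos (Im l) ->
    Cmod (Cexp l - 1) < 1).
  { intros l Hl. pose proof (exp_pos (Re l)) as Hel.
    assert (Hs : sin (Im l) * sin (Im l) + cos (Im l) * cos (Im l) = 1)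
      by exact (sin2_cos2 (Im l)).
    apply Rsqr_incrst_0; [| apply Cmod_ge_0 | lra]. rewrite !Rsqr_pow2, Cmod_sqr.
    unfold Cexp. set (e := exp (Re l)) in *.
    assert (E : Re ((e * cos (Im l), e * sin (Im l))%R - 1)%C ^ 2
              + Im ((e * cos (Im l), e * sin (Im l))%R - 1)%C ^ 2
              = e * (e * (sin (Im l) * sin (Im l) + cos (Im l) * cos (Im l)) - 2 * cos (Im l)) + 1)
      by (simpl; ring).
    rewrite E, Hs. nra. }
  assert (S1 : Cmod (Cexp l1 - 1) < 1).
  { apply small. unfold l1. cbn [Re Im fst snd].
    rewrite exp_plus. replace (3 * ln d) with (ln d + (ln d + ln d)) by ring.
    rewrite !exp_plus, !exp_ln by exact Hd.
    assert (d * (d * d) <= d) by nra. nra. }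
  assert (S2 : Cmod (Cexp l2 - 1) < 1).
  { apply small. unfold l2. cbn [Re Im fst snd].
    rewrite exp_ln, cos_neg by exact Hd. lra. }
  set (s := (Cexp l1 - 1)%C) in *. set (t := (Cexp l2 - 1)%C) in *.
  (* At least 1/2 so that [s] and [t] can be divided by [r], and below 1 because both moduli are. *)
  set (r := Rmax (1 / 2) (Rmax (Cmod s) (Cmod t))).
  assert (R1 : 1 / 2 <= r) by apply Rmax_l.
  assert (R2 : Cmod s <= r) by (eapply Rle_trans; [apply Rmax_l | apply Rmax_r]).
  assert (R3 : Cmod t <= r) by (eapply Rle_trans; [apply Rmax_r | apply Rmax_r]).
  assert (R4 : r < 1) by (repeat apply Rmax_lub_lt; lra).
  exists r. split; [lra|].
  pose proof (Cmod_div_le_1 s r ltac:(lra) R2) as Hx.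
  pose proof (Cmod_div_le_1 t r ltac:(lra) R3) as Hy.
  eexists _, _. split; [apply extremal_map_close_to_convex; [exact Hx | exact Hy]|].
  split; [apply extremal_map_log; assumption|].
  assert (N : RtoC r <> 0) by (apply RtoC_neq_0; lra).
  cbv beta.
  replace (s / RtoC r * RtoC r)%C with s by (field; exact N).
  replace (t / RtoC r * RtoC r)%C with t by (field; exact N).
  replace (1 + s)%C with (Cexp l1) by (unfold s; ring).
  replace (1 + t)%C with (Cexp l2) by (unfold t; ring).
  rewrite !Clog_Cexp by assumption.
  unfold l1, l2, p. destruct w. unfold Cminus, Cplus, Copp, Cmult, RtoC; simpl.
  f_equal; field.
Qed.

(** [D] takes values in the multiples of [2 * PI]. If [D r > 0], the intermediate value theorem
    produces a value in [(0, PI / 2]], where the sine is positive. Used for [D] and for [- D], it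
    gives [D r = 0]. *)
Lemma cis_constant_branch (D : R -> R) (r : R) :
  0 <= r -> (forall x, 0 <= x <= r -> continuous D x) ->
  (forall x, 0 <= x <= r -> cis (D x) = RtoC 1) -> D 0 = 0 -> D r <= 0.
Proof.
  intros Hr Hc H1 H0. apply Rnot_lt_le. intros Hpos.
  assert (Hr0 : 0 < r) by (destruct Hr as [Hr|<-]; [exact Hr | lra]).
  pose proof PI_RGT_0 as HPI.
  set (y := Rmin (D r) (PI / 2)).
  assert (Y1 : 0 < y) by (apply Rmin_pos; lra).
  assert (Y2 : y <= D r) by apply Rmin_l.
  assert (Y3 : y <= PI / 2) by apply Rmin_r.
  destruct (Ranalysis5.f_interv_is_interv D 0 r y Hr0) as (x & Hx & Ex).
  - lra.
  - intros x Hx. apply continuity_pt_filterlim. apply Hc, Hx.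
  - specialize (H1 x Hx). rewrite Ex in H1. apply (f_equal snd) in H1. simpl in H1.
    pose proof (sin_gt_0 y Y1 ltac:(lra)). lra.
Qed.

Lemma cis_opp (t : R) : cis (- t) = Cconj (cis t).
Proof. unfold cis, Cconj; simpl. rewrite cos_neg, sin_neg. reflexivity. Qed.

Lemma Cexp_eq_1 (a : C) : Cexp a = RtoC 1 -> cis (Im a) = RtoC 1.
Proof.
  intros H. rewrite Cexp_cis in H.
  assert (E : exp (Re a) = 1).
  { apply (f_equal Cmod) in H. rewrite Cmod_mult, Cmod_cis, Cmod_R, Cmod_1 in H.
    rewrite Rabs_pos_eq in H by (left; apply exp_pos). lra. }
  rewrite E in H. rewrite <- H. ring.
Qed.

(** Along [[0, r]] the branch [L] and the combination [E] of principal logarithms are continuous,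
    have the same exponential and vanish at 0, so their imaginary parts agree; that of [E] combines
    four arguments, each below [PI / 2] in modulus. *)
Lemma LV_subset (w : C) : LV_1minus w -> Rabs (Im w) < 2 * PI.
Proof.
  intros (r & Hr & f & L & Hf & [HL HL0] & ->).
  destruct (close_to_convex_derive_form f Hf) as (s & t & a & b & As & At & Aa & Ab & H).
  set (E := fun x : R => (Clog (1 + s (RtoC x)) - (Clog (1 + t (RtoC x))
    + (Clog (1 + a (RtoC x)) + Clog (1 + b (RtoC x)))))%C).
  assert (Hin : forall x, 0 <= x <= r -> unit_disc (RtoC x))
    by (intros x Hx; apply real_in_disc; lra).
  assert (Hpos : forall (u : C -> C) z, unit_disc z -> Cmod (u z) <= Cmod z -> 0 < Re (1 + u z)%C).
  { intros u z Hz Hu. apply Re_one_plus_pos. unfold unit_disc in Hz. lra. }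
  assert (Hzero : forall u : C -> C, Cmod (u 0) <= Cmod 0 -> Clog (1 + u 0) = RtoC 0).
  { intros u Hu. rewrite Cmod_0 in Hu.
    rewrite (Cmod_eq_0 (u 0)) by (apply Rle_antisym; [exact Hu | apply Cmod_ge_0]).
    rewrite Cplus_0_r. apply Clog_1. }
  assert (Hcont : forall (u : C -> C) x, analytic_on_disc u -> unit_disc (RtoC x) ->
    Cmod (u (RtoC x)) <= Cmod x -> continuous (fun x : R => Clog (1 + u (RtoC x))%C) x).
  { intros u x Au Hx Hu. apply continuous_Clog; [|apply Hpos; assumption].
    apply continuous_Cplus; [apply continuous_const|].
    apply (continuous_comp (fun x : R => RtoC x) u).
    - apply continuous_RtoC, continuous_id.
    - apply analytic_continuous; assumption. }
  assert (HE : forall x, 0 <= x <= r -> Cexp (L (RtoC x) - E x) = RtoC 1).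
  { intros x Hx. pose proof (Hin x Hx) as Hx1. destruct (H _ Hx1) as (H1 & H2 & H3 & H4 & H5).
    destruct (HL _ Hx1) as [_ H6].
    rewrite Cexp_minus, H6. unfold E. rewrite Cexp_minus, !Cexp_plus.
    rewrite !Cexp_Clog by (apply Hpos; assumption). rewrite <- H5.
    apply Cinv_r. apply close_to_convex_derive_neq_0; assumption. }
  set (D := fun x : R => Im (L (RtoC x) - E x)%C).
  assert (CD : forall x, 0 <= x <= r -> continuous D x).
  { intros x Hx. pose proof (Hin x Hx) as Hx1. destruct (H _ Hx1) as (H1 & H2 & H3 & H4 & H5).
    apply continuous_C_snd. apply continuous_Cminus.
    - apply (continuous_comp (fun x : R => RtoC x) L).
      + apply continuous_RtoC, continuous_id.
      + apply HL, Hx1.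
    - apply continuous_Cminus; [apply Hcont; assumption|].
      apply continuous_Cplus; [apply Hcont; assumption|].
      apply continuous_Cplus; apply Hcont; assumption. }
  assert (D0 : D 0 = 0).
  { destruct (H _ unit_disc_0) as (H1 & H2 & H3 & H4 & H5).
    unfold D, E. rewrite HL0, !Hzero by assumption. simpl. ring. }
  assert (Dc : forall x, 0 <= x <= r -> cis (D x) = RtoC 1)
    by (intros x Hx; apply Cexp_eq_1, HE, Hx).
  assert (P1 : D r <= 0) by (apply (cis_constant_branch D r); (lra || assumption)).
  assert (P2 : - D r <= 0).
  { apply (cis_constant_branch (fun x => - D x) r); [lra | | | lra].
    - intros x Hx. apply (continuous_opp (K := R_AbsRing) (V := R_NormedModule)), CD, Hx.
    - intros x Hx. rewrite cis_opp, Dc by exact Hx. unfold Cconj, RtoC; simpl. f_equal; ring. }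
  assert (EL : Im (L (RtoC r)) = Im (E r)).
  { assert (E0 : D r = 0) by lra. apply Rminus_diag_uniq. exact E0. }
  rewrite EL.
  pose proof (Clog_arg_bound (1 + s (RtoC r))) as B1.
  pose proof (Clog_arg_bound (1 + t (RtoC r))) as B2.
  pose proof (Clog_arg_bound (1 + a (RtoC r))) as B3.
  pose proof (Clog_arg_bound (1 + b (RtoC r))) as B4.
  apply Rabs_lt_between in B1. apply Rabs_lt_between in B2.
  apply Rabs_lt_between in B3. apply Rabs_lt_between in B4.
  apply Rabs_lt_between. unfold E.
  assert (EI : forall p q u v : C, Im (p - (q + (u + v)))%C = Im p - (Im q + (Im u + Im v)))
    by reflexivity.
  rewrite EI. lra.
Qed.

Lemma LV_exp (w : C) : LV_1minus w -> V_1minus (Cexp w).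
Proof.
  intros (r & Hr & f & L & Hf & [HL _] & ->). exists r. split; [exact Hr|].
  exists f. split; [exact Hf|]. apply HL, real_in_disc, Hr.
Qed.

(** Undoing a rotation by 0, [PI], [PI / 2] or [- PI / 2] brings [w] into the right half-plane, and
    [PI / 2 + PI < 2 * PI]. *)
Lemma Cexp_surjective (w : C) : w <> 0 -> exists l, Cexp l = w /\ Rabs (Im l) < 2 * PI.
Proof.
  intros Hw. pose proof PI_RGT_0 as HPI.
  assert (Rot : forall al, Rabs al <= PI -> 0 < Re (cis (- al) * w)%C ->
    exists l, Cexp l = w /\ Rabs (Im l) < 2 * PI).
  { intros al Hal Hre. exists (Clog (cis (- al) * w) + Ci * RtoC al)%C. split.
    - rewrite Cexp_plus, Cexp_Clog, Cexp_i by exact Hre.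
      replace (cis (- al) * w * cis al)%C with (cis (- al) * cis al * w)%C by ring.
      replace (cis (- al) * cis al)%C with (RtoC 1); [ring|].
      rewrite <- !Cexp_i, <- Cexp_plus.
      replace (Ci * RtoC (- al) + Ci * RtoC al)%C with (RtoC 0) by (rewrite RtoC_opp; ring).
      symmetry. apply Cexp_0.
    - pose proof (Clog_arg_bound (cis (- al) * w)) as B.
      assert (E : Im (Clog (cis (- al) * w) + Ci * RtoC al)%C = Im (Clog (cis (- al) * w)) + al)
        by (unfold Cplus, Ci, Cmult, RtoC; simpl; ring).
      rewrite E. eapply Rle_lt_trans; [apply Rabs_triang|]. lra. }
  destruct w as [x y].
  destruct (Rtotal_order x 0) as [Hx|[Hx|Hx]].
  - apply (Rot PI); [rewrite Rabs_pos_eq; lra|].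
    unfold cis. rewrite cos_neg, sin_neg, cos_PI, sin_PI. simpl. lra.
  - destruct (Rtotal_order y 0) as [Hy|[Hy|Hy]].
    + apply (Rot (- (PI / 2))); [rewrite Rabs_Ropp, Rabs_pos_eq; lra|].
      rewrite Ropp_involutive. unfold cis. rewrite cos_PI2, sin_PI2. simpl. lra.
    + exfalso. apply Hw. rewrite Hx, Hy. reflexivity.
    + apply (Rot (PI / 2)); [rewrite Rabs_pos_eq; lra|].
      unfold cis. rewrite cos_neg, sin_neg, cos_PI2, sin_PI2. simpl. lra.
  - apply (Rot 0); [rewrite Rabs_R0; lra|].
    rewrite Ropp_0. unfold cis. rewrite cos_0, sin_0. simpl. lra.
Qed.

Theorem theorem1p9 :
  (forall r : R, 0 < r < 1 ->
     (forall w : C,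
        V r w <->
        exists s t : C,
          Cmod s <= r /\ Cmod t <= r /\ w = ((1 + s) / (1 + t) ^ 3)%C) /\
     (forall w : C,
        V r w <->
        exists u v : C,
          Cmod (u - 1)%C <= r /\ Cmod (v - 1)%C <= r /\ w = (u / v ^ 3)%C)) /\
  (forall w : C, LV_1minus w <-> Rabs (Im w) < 2 * PI) /\
  (forall w : C, V_1minus w <-> w <> RtoC 0).
Proof.
  split; [|split].
  - intros r Hr. split; intros w; split.
    + apply V_subset; lra.
    + intros (s & t & Hs & Ht & ->). apply V_superset; assumption.
    + intros H. destruct (V_subset r w ltac:(lra) H) as (s & t & Hs & Ht & ->).
      exists (1 + s)%C, (1 + t)%C.
      replace (1 + s - 1)%C with s by ring. replace (1 + t - 1)%C with t by ring.
      repeat split; assumption.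
    + intros (u & v & Hu & Hv & ->).
      pose proof (V_superset r _ _ Hr Hu Hv) as H.
      replace (1 + (u - 1))%C with u in H by ring.
      replace (1 + (v - 1))%C with v in H by ring. exact H.
  - intros w. split; [apply LV_subset | apply LV_superset].
  - intros w. split.
    + intros (r & Hr & f & Hf & ->).
      apply close_to_convex_derive_neq_0; [exact Hf | apply real_in_disc, Hr].
    + intros Hw. destruct (Cexp_surjective w Hw) as (l & <- & Hl).
      apply LV_exp, LV_superset, Hl.
Qed.
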